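(* The probability distribution $\varrho_{\mathcal{H}}$ (the spectral density of the hexagonal lattice $\mathcal{H}$) is absolutely continuous with respect to the Lebesgue measure, and has a density given by $$f_H(x)=\frac12\int_0^\infty t|x|\,J_0(|x|t)\,J_0^3(t)\,dt,\quad x\in\mathbb{R},$$ $$f_H(x)=\begin{cases}\dfrac{\sqrt3\,|x|}{\pi(3+x^2)}\;{}_2F_1\!\left(\tfrac13,\tfrac23;1;\dfrac{x^2(9-x^2)^2}{(3+x^2)^3}\right), & x\in[-3,3],\\[2mm] 0, & \text{otherwise.}\end{cases}$$ Similarly, the probability law $\varrho_{\mathcal{T}^*}$ (the spectral density of the triangular lattice with loops $\mathcal{T}^*$) has a density given by $$f_T(x)=\frac12\int_0^\infty t\,J_0(t\sqrt{x})\,J_0^3(t)\,dt,\quad x>0,$$ $$f_T(x)=\begin{cases}\dfrac{\sqrt3}{\pi(3+x)}\;{}_2F_1\!\left(\tfrac13,\tfrac23;1;\dfrac{x(9-x)^2}{(3+x)^3}\right), & x\in[0,9],\\[2mm] 0, & \text{otherwise.}\end{cases}$$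
   Context: The hexagonal lattice $\mathcal{H}$ is the infinite graph with vertex set $V(\mathcal{H})=\{(\sqrt3\,x+\tfrac{\sqrt3}{2}y,\ \tfrac{3}{2}y+c)\in\mathbb{R}^2 : x,y\in\mathbb{Z},\ c\in\{0,1\}\}$, in which every vertex is joined by an edge to its three nearest neighbours in $V(\mathcal{H})$ (Euclidean distance). The triangular lattice $\mathcal{T}$ has vertex set $V(\mathcal{T})=\{v\in V(\mathcal{H}): c=0\}$, in which every vertex is joined by an edge to its six nearest neighbours in $V(\mathcal{T})$. The graph $\mathcal{T}^*$ is obtained from $\mathcal{T}$ by adding three loops at every vertex (equivalently, one loop of weight $3$; each of the three loops counts as a distinct possible step from a vertex to itself). For $\mathcal{L}\in\{\mathcal{H},\mathcal{T}^*\}$, $\mu_k(\mathcal{L})$ denotes the number of closed paths (closed walks; vertices and edges may repeat) of length $k$ on $\mathcal{L}$ starting and ending at a fixed vertex; it does not depend on the vertex. The spectral density $\varrho_{\mathcal{L}}$ is the unique compactly supported Borel probability measure on $\mathbb{R}$ with $\int_{\mathbb{R}}x^k\,d\varrho_{\mathcal{L}}(x)=\mu_k(\mathcal{L})$ for all $k\in\mathbb{N}$. $J_0(x)=\sum_{k=0}^\infty\frac{(-1)^k}{(k!)^2}\left(\frac{x}{2}\right)^{2k}$ is the Bessel function of the first kind of order $0$, and $J_0^3(t)=(J_0(t))^3$. The Gaussian hypergeometric function is ${}_2F_1(a_1,a_2;b;x)=\sum_{j=0}^\infty\frac{a_1^{(j)}a_2^{(j)}}{b^{(j)}j!}x^j$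 with rising factorials $a^{(n)}=\prod_{j=0}^{n-1}(a+j)$. The integrals over $[0,\infty)$ are improper integrals $\lim_{R\to\infty}\int_0^R$ (they need not converge absolutely). The formulas are formulas for probability densities, i.e. understood up to Lebesgue-null sets ($f_H$ has logarithmic singularities at $x=\pm1$ and $f_T$ at $x=1$). *)

(* Defs.v *)
(* MathComp-Analysis; [R : realType] stands for the real numbers. *)
From HB Require Import structures.
From mathcomp Require Import all_boot all_order all_algebra.
From mathcomp Require Import finmap.
From mathcomp Require Import all_classical all_reals all_analysis.
Set Implicit Arguments.
Unset Strict Implicit.
Unset Printing Implicit Defensive.
Import Order.TTheory GRing.Theory Num.Theory.
Import numFieldNormedType.Exports.
Local Open Scope classical_set_scope.
Local Open Scope card_scope.
Local Open Scope ring_scope.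

(** Multigraphs on [V]: [edge G p e q] says that there is a possible step from
    [p] to [q] carrying the label [e]; distinct labels are distinct (parallel)
    steps, and in particular distinct loops when [p = q]. *)
Record multigraph (V : choiceType) := Multigraph {
  edge_label : finType ;
  edge : V -> edge_label -> V -> Prop }.

Section Walks.
Variables (V : choiceType) (G : multigraph V).

(* The list contains the successive steps: the edge taken, and the vertex
   reached. *)
Fixpoint walk (p : V) (s : seq (edge_label G * V)) (q : V) : Prop :=
  if s is (e, p') :: s' then edge p e p' /\ walk p' s' q else p = q.

Definition closed_walks (p : V) (k : nat) : set (seq (edge_label G * V)) :=
  [set s | size s = k /\ walk p s p].

(* [fset_set A] is [A] when [A] is finite, which is the case for the closed
   walks in the locally finite graphs below. *)
Definition num_closed_walks (p : V) (k : nat) : nat :=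
  #|` fset_set (closed_walks p k) |.

End Walks.

Section Lattices.
Variable R : realType.

Definition edist (p q : R * R) : R :=
  Num.sqrt ((p.1 - q.1) ^+ 2 + (p.2 - q.2) ^+ 2).

(* [q] is one of the [n] nearest neighbours of [p] in [V]: fewer than [n] points
   of [V] other than [p] are strictly closer to [p] than [q] is.  In the lattices
   below, the [n]-th and the [n.+1]-st smallest distances are different, so that
   this selects exactly [n] points. *)
Definition nearest_neighbour (n : nat) (V : set (R * R)) (p q : R * R) : Prop :=
  [/\ V p, V q, q <> p &
      exists2 m, (m < n)%N &
        [set r | [/\ V r, r <> p & edist p r < edist p q]] #= `I_m].

Definition hex_point (x y : int) (c : bool) : R * R :=
  (Num.sqrt 3 * x%:~R + Num.sqrt 3 / 2 * y%:~R, 3 / 2 * y%:~R + c%:R).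

Definition hex_vertices : set (R * R) :=
  [set p | exists x y c, p = hex_point x y c].

Definition tri_vertices : set (R * R) :=
  [set p | exists x y, p = hex_point x y false].

Definition hexagonal : multigraph (R * R)%type :=
  @Multigraph (R * R)%type unit
    (fun p _ q => nearest_neighbour 3 hex_vertices p q).

(* The label [None] is for the edges of the triangular lattice, the labels
   [Some i], with [i < 3], for the three loops at every vertex. *)
Definition triangular_loops : multigraph (R * R)%type :=
  @Multigraph (R * R)%type (option 'I_3)
    (fun p e q => if e is Some _ then tri_vertices p /\ q = p
                  else nearest_neighbour 6 tri_vertices p q).

End Lattices.

Section SpectralDensity.
Variable R : realType.
Local Notation mu := (@lebesgue_measure R).

Definition compactly_supported (rho : probability (measurableTypeR R) R) : Prop :=
  exists2 K : set R, compact K & rho (~` K) = 0%E.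

Definition spectral_density (G : multigraph (R * R)%type) (p : R * R)
    (rho : probability (measurableTypeR R) R) : Prop :=
  compactly_supported rho /\
  forall k : nat, (\int[rho]_x (x ^+ k)%:E = (num_closed_walks G p k)%:R%:E)%E.

Definition has_density (rho : probability (measurableTypeR R) R) (f : R -> R)
    : Prop :=
  [/\ measurable_fun [set: R] f, (forall x, 0 <= f x) &
      forall A, measurable A -> rho A = (\int[mu]_(x in A) (f x)%:E)%E].

(* The improper integral of [g] over [0, +oo) converges to [l]. *)
Definition improper_integral0y (g : R -> R) (l : R) : Prop :=
  Rintegral mu `[0, r] g @[r --> +oo] --> l.

End SpectralDensity.

Section SpecialFunctions.
Variable R : realType.

Definition besselJ0 (x : R) : R :=
  limn (series (fun k : nat => (- 1) ^+ k / (k`!%:R) ^+ 2 * (x / 2) ^+ (2 * k))).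

Definition rising (a : R) (n : nat) : R := \prod_(j < n) (a + j%:R).

Definition hyp2F1 (a1 a2 b x : R) : R :=
  limn (series (fun j : nat =>
    rising a1 j * rising a2 j / (rising b j * j`!%:R) * x ^+ j)).

Definition hex_density (x : R) : R :=
  if -3 <= x <= 3 then
    Num.sqrt 3 * `|x| / (pi * (3 + x ^+ 2)) *
    hyp2F1 (1 / 3) (2 / 3) 1
      (x ^+ 2 * (9 - x ^+ 2) ^+ 2 / (3 + x ^+ 2) ^+ 3)
  else 0.

Definition tri_density (x : R) : R :=
  if 0 <= x <= 9 then
    Num.sqrt 3 / (pi * (3 + x)) *
    hyp2F1 (1 / 3) (2 / 3) 1 (x * (9 - x) ^+ 2 / (3 + x) ^+ 3)
  else 0.

End SpecialFunctions.

(* Main.v *)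
(** Let [F(x) = sqrt 3 / (pi (3 + x)) 2F1(1/3, 2/3; 1; x (9-x)^2 / (3+x)^3)]. With
    [p(x) = x (x-1) (x-9)] it satisfies [(p F')' + (x-3) F = 0] off [{0, 1, 9}], and
    the boundary terms at the logarithmic singularity [1] cancel, so the moments of
    [F] on [0, 9] satisfy the recurrence
    [(n+1)^2 m_(n+1) = (10 n^2 + 10 n + 3) m_n - 9 n^2 m_(n-1)].
    The numbers [n!^2 [x^n] B(x)^3], with [B = sum x^n / n!^2], satisfy the same
    recurrence, since [B] solves [theta^2 B = x B]; they are the sums of squared
    trinomial coefficients which count the closed walks, because the adjacency
    operator of the triangular lattice with loops is [A A^*], with
    [A f (x) = f (x) + f (x + e_1) + f (x + e_2)], while the hexagonal adjacency
    operator has the off-diagonal blocks [A] and [A^*].  The total mass is [1] because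
    the generating function of the closed walks is itself [3/(3+x) 2F1(..)], whose
    singularity (with constant given by the sine product at 1/3) must match, by
    Abel summation, the growth [n m_n / 9^n -> 9 F(9)].  Compactly
    supported measures with equal moments are equal.

    For the integral representation, [J_0(t) = B(-t^2/4)], hence
    [J_0(t)^3 = int_0^oo 2 s F(s^2) J_0(t s) ds].  Lommel's identity
    [(s^2-r^2) int_0^R t J_0(r t) J_0(s t) dt = R (s J_1(R s) J_0(R r) - r J_0(R s) J_1(R r))]
    and the Riemann-Lebesgue lemma for [sqrt t J_0(t)] and [sqrt t J_1(t)] invert this
    Hankel transform at every [r > 0] with [r^2] different from [1] and [9]. *)
Require Import Defs.
From HB Require Import structures.
From mathcomp Require Import all_boot all_order all_algebra.
From mathcomp Require Import finmap.
From mathcomp Require Import all_classical all_reals all_analysis.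
From mathcomp Require Import measurable_realfun ring lra zify.
Set Implicit Arguments.
Unset Strict Implicit.
Unset Printing Implicit Defensive.
Import Order.TTheory GRing.Theory Num.Theory.
Import numFieldNormedType.Exports.
Local Open Scope classical_set_scope.
Local Open Scope card_scope.
Local Open Scope ring_scope.


(** * Derivatives and integrals *)

(** The recurrence determines the moments only up to a common factor. That factor is found by
    reading one solution of the equation at two places: the moments see the regular value at 9,
    while the generating function, rescaled by 9, solves the same equation as the density and sees
    the logarithmic singularity at 1.

    This singularity is never estimated sharply. Integrability near 1 comes from a primitive of the
    nonnegative function $(3-x)F$ with finite one-sided limits. Since 1 minus the hypergeometric
    argument has a double zero at $x=1$, a crude power bound already makes $(x-1)\,{}_2F_1$ vanish
    there.

    The Bessel integral need not converge absolutely, so integrals are exchanged only for $t$ in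
    $[0,T]$. The resulting kernel has a pole at $s=r$. Instead of treating it as an approximate
    identity, the proof splits off an explicit Gaussian transform with the right value at $r$; this
    part carries the whole limit, and in the rest the pole is removable and Riemann-Lebesgue gives
    0. All excluded points form finite, hence null, sets. *)

Section Derivatives.
Context {R : realType}.
Implicit Types (f g : R -> R) (x a b c : R).

(* A synonym that type class resolution does not see through. *)
Definition isder f x a : Prop := is_derive x (1 : R) f a.

Lemma der_eq f x a b : isder f x a -> a = b -> isder f x b.
Proof. by move=> ? <-. Qed.

Lemma derC c x : isder (fun _ => c) x 0.
Proof. exact: is_derive_cst. Qed.

Lemma derI x : isder (fun y => y) x 1.
Proof. exact: is_derive_id. Qed.

Lemma derD f g x a b : isder f x a -> isder g x b ->
  isder (fun y => f y + g y) x (a + b).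
Proof. exact: is_deriveD. Qed.

Lemma derN f x a : isder f x a ->
  isder (fun y => - f y) x (- a).
Proof. exact: is_deriveN. Qed.

Lemma derM f g x a b : isder f x a -> isder g x b ->
  isder (fun y => f y * g y) x (a * g x + f x * b).
Proof.
move=> fa gb; have := is_deriveM fa gb; move/is_derive_eq; apply.
by rewrite /GRing.scale /=; ring.
Qed.

Lemma derX f n x a : isder f x a ->
  isder (fun y => f y ^+ n) x (n%:R * f x ^+ n.-1 * a).
Proof.
move=> fa; have -> : (fun y => f y ^+ n) = f ^+ n by rewrite exprfctE.
exact: is_deriveX.
Qed.

Lemma derV f x a : f x != 0 -> isder f x a ->
  isder (fun y => (f y)^-1) x (- a / f x ^+ 2).
Proof.
move=> f0 fa; have := is_deriveV f0 fa; move/is_derive_eq; apply.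
by rewrite /GRing.scale /=; field.
Qed.

Lemma der_comp f g x a b : isder f x a -> isder g (f x) b ->
  isder (fun y => g (f y)) x (b * a).
Proof.
by move=> fa gb; have := @is_derive1_comp _ g f x b a gb fa.
Qed.

Lemma der_cvg f x a : isder f x a -> f y @[y --> x] --> f x.
Proof.
move=> [df _]; have /derivable1_diffP/differentiable_continuous := df; exact.
Qed.

Lemma der_near f g x a : (\forall y \near x, f y = g y) ->
  isder f x a -> isder g x a.
Proof.
by move=> fg fa; exact: (near_eq_is_derive fg fa).
Qed.

Lemma within_cont_der f (I : interval R) (d : R -> R) :
  (forall x, x \in I -> isder f x (d x)) ->
  {within [set` I], continuous f}.
Proof.
by move=> fd; apply: derivable_within_continuous => x /fd[].
Qed.

Lemma itv_sub_oo a b c d : a < c -> d < b -> forall x, x \in `[c, d] -> a < x < b.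
Proof. by move=> ac db x; rewrite in_itv/= => /andP[cx xd]; apply/andP; split; lra. Qed.

(** Differentiability is assumed on a larger open interval, so one-sided behaviour at [x] and [y]
    never has to be discussed. *)
Lemma mvt_oo f (d : R -> R) a b :
  (forall x, a < x < b -> isder f x (d x)) ->
  forall x y, a < x -> x < y -> y < b ->
    exists c, [/\ x < c, c < y & f y - f x = d c * (y - x)].
Proof.
move=> fd x y ax xy yb.
have [z|z|c] := @MVT R f d x y xy.
- by rewrite in_itv/= => /andP[? ?]; apply: fd; apply/andP; split; lra.
- by apply: (@within_cont_der f `[x, y] d) => w /(itv_sub_oo ax yb)/fd.
- by rewrite in_itv/= => /andP[xc cy] e; exists c; split.
Qed.

Lemma mono_oo f (d : R -> R) a b :
  (forall x, a < x < b -> isder f x (d x)) ->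
  (forall x, a < x < b -> 0 <= d x) ->
  forall x y, a < x -> x <= y -> y < b -> f x <= f y.
Proof.
move=> fd d0 x y ax; rewrite le_eqVlt => /predU1P[->//|xy] yb.
have [c [xc cy e]] := mvt_oo fd ax xy yb.
by rewrite -subr_ge0 e mulr_ge0 ?d0 ?subr_ge0//; [apply/andP; split; lra|lra].
Qed.

Lemma const_oo f a b :
  (forall x, a < x < b -> isder f x 0) ->
  forall x y, a < x < b -> a < y < b -> f x = f y.
Proof.
move=> fd; suff H : forall x y, a < x -> x < y -> y < b -> f x = f y.
  move=> x y /andP[ax xb] /andP[ay yb].
  case: (ltgtP x y) => [xy|yx|->//]; first exact: H.
  by apply/esym; apply: H.
move=> x y ax xy yb; have [c [_ _]] := mvt_oo (d := fun=> 0) fd ax xy yb.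
by rewrite mul0r => /eqP; rewrite subr_eq0 => /eqP.
Qed.

End Derivatives.

Ltac der :=
  apply: der_eq; [  repeat first [ exact: derC | exact: derI | eassumption
               | apply: derD | apply: derN | apply: derM | apply: derX
             | apply: derV ] | rewrite /= ].

(** * Exhaustion of domains and the fundamental theorem on open intervals *)

Section Integrals.
Context {R : realType}.
Local Notation mu := (@lebesgue_measure R).

Section IncreasingUnion.
Context d (T : measurableType d) (m : {measure set T -> \bar R}).
Variables (D : set T) (E : (set T)^nat) (f : T -> \bar R).
Hypotheses (mD : measurable D) (mE : forall n, measurable (E n)).
Hypotheses (ED : forall n, E n `<=` D).
Hypothesis DE : forall x, D x -> \forall n \near \oo, E n x.
Hypothesis mf : measurable_fun D f.

Let restr n : (\int[m]_(x in E n) f x = \int[m]_(x in D) (f \_ (E n)) x)%E.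
Proof. by rewrite -integral_mkcondr; congr integral; apply/esym/setIidr/ED. Qed.

Let mrestr n : measurable_fun D (f \_ (E n)).
Proof.
apply/(measurable_restrict _ (mE n)) => //.
by apply: measurable_funS mf => // x [].
Qed.

Let cvgrestr x : D x -> (f \_ (E n)) x @[n --> \oo] --> f x.
Proof.
move=> Dx; apply: cvg_near_cst; apply: filterS (DE Dx) => n Enx.
by rewrite patchE mem_set.
Qed.

Lemma cvg_integral_increasing_integrable : m.-integrable D f ->
  (\int[m]_(x in E n) f x @[n --> \oo] --> \int[m]_(x in D) f x)%E.
Proof.
move=> fi; under eq_fun do rewrite restr.
have [] := @dominated_convergence _ _ _ m D mD (fun n => f \_ (E n)) f (abse \o f) => //.
- by apply: aeW => x Dx; exact: cvgrestr.
- exact: integrable_abse.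
- apply: aeW => x n Dx; rewrite patchE; case: ifPn => //= _.
  by rewrite /= normr0 abse_ge0.
Qed.

Lemma cvg_integral_increasing_ge0 : (forall x, D x -> (0 <= f x)%E) ->
  (forall n x, E n x -> E n.+1 x) ->
  (\int[m]_(x in E n) f x @[n --> \oo] --> \int[m]_(x in D) f x)%E.
Proof.
move=> f0 EE; under eq_fun do rewrite restr.
have := @cvg_monotone_convergence _ _ _ m D mD (fun n => f \_ (E n)) mrestr.
have -> : (\int[m]_(x in D) f x =
    \int[m]_(x in D) limn (fun n => (f \_ (E n)) x))%E.
  apply: eq_integral => x /set_mem Dx; apply/esym/cvg_lim => //; exact: cvgrestr.
apply => [n x Dx|x Dx].
  by rewrite patchE; case: ifPn => // _; exact: f0.
apply/nondecreasing_seqP => n; rewrite !patchE.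
case: ifPn => [/set_mem/EE/mem_set ->//|_].
by case: ifPn => // _; exact: f0.
Qed.

End IncreasingUnion.

(** Integrability and value travel together: [Rintegral] is the [fine] part of an extended integral
    and would silently return 0 for an infinite one. *)
Definition has_int (D : set R) (f : R -> R) (l : R) : Prop :=
  mu.-integrable D (EFin \o f) /\ Rintegral mu D f = l.

Lemma has_intE D f l : measurable D -> has_int D f l -> (\int[mu]_(x in D) (f x)%:E = l%:E)%E.
Proof.
move=> mD [fi <-]; rewrite /Rintegral fineK //.
exact: integrable_fin_num fi.
Qed.

Lemma FTC_cc (H f : R -> R) (a b c d : R) : a < c -> c < d -> d < b ->
  (forall x, a < x < b -> isder H x (f x)) ->
  (forall x, a < x < b -> f y @[y --> x] --> f x) ->
  (\int[mu]_(x in `[c, d]) (f x)%:E = (H d - H c)%:E)%E.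
Proof.
move=> ac cd db Hf fc; rewrite EFinB.
have Hcvg x : a < x < b -> H y @[y --> x] --> H x by move=> /Hf/der_cvg.
apply: continuous_FTC2 => //.
- apply: continuous_in_subspaceT => x.
  by rewrite inE/= => /(itv_sub_oo ac db); exact: fc.
- split.
  + by move=> x /subset_itv_oo_cc/(itv_sub_oo ac db)/Hf[].
  + by apply: cvg_at_right_filter; apply: Hcvg; apply/andP; split; lra.
  + by apply: cvg_at_left_filter; apply: Hcvg; apply/andP; split; lra.
- move=> x /subset_itv_oo_cc/(itv_sub_oo ac db)/Hf Hx.
  by rewrite derive1E; exact: derive_val.
Qed.

Section OpenFTC.
Variables (H f : R -> R) (a b A B : R).
Hypothesis ab : a < b.
Hypothesis Hf : forall x, a < x < b -> isder H x (f x).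
Hypothesis fc : forall x, a < x < b -> f y @[y --> x] --> f x.
Hypothesis Ha : H x @[x --> a^'+] --> A.
Hypothesis Hb : H x @[x --> b^'-] --> B.

(** The offset 3 keeps [e n] at most $(b-a)/3$, so that every compact interval [E n] is
    nondegenerate. *)
Let e n : R := (b - a) / n.+3%:R.
Let E n : set R := `[a + e n, b - e n]%classic.

Let e_gt0 n : 0 < e n.
Proof. by rewrite divr_gt0 ?subr_gt0. Qed.

Let e_lt n : a + e n < b - e n.
Proof.
have : e n <= (b - a) / 3.
  by rewrite ler_pM2l ?subr_gt0// lef_pV2 ?posrE// ler_nat.
have := e_gt0 n; lra.
Qed.

Let e0 : e n @[n --> \oo] --> 0.
Proof.
rewrite -(mulr0 (b - a)); apply: cvgMr => //.
have := @cvg_harmonic R; rewrite -(cvg_shiftn 2) /=.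
by apply: cvg_trans; apply: near_eq_cvg; apply: nearW => n /=; rewrite addn2.
Qed.

Let measurable_f : measurable_fun `]a, b[ f.
Proof.
apply: open_continuous_measurable_fun => // x; rewrite inE/= in_itv/=; exact: fc.
Qed.

Let HE : H (b - e n) - H (a + e n) @[n --> \oo] --> B - A.
Proof.
apply: cvgB.
- move/cvg_at_leftP : Hb; apply; split; first by move=> n; rewrite gtrBl.
  by rewrite -[X in _ --> X]subr0; apply: cvgB => //; exact: cvg_cst.
- move/cvg_at_rightP : Ha; apply; split; first by move=> n; rewrite ltrDl.
  by rewrite -[X in _ --> X]addr0; apply: cvgD => //; exact: cvg_cst.
Qed.

Let intE n : (\int[mu]_(x in E n) (f x)%:E = (H (b - e n) - H (a + e n))%:E)%E.
Proof. by apply: (FTC_cc _ (e_lt n)) Hf fc; rewrite ?ltrDl ?gtrBl. Qed.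

Let EsubD n : E n `<=` `]a, b[.
Proof.
by move=> x /itv_sub_oo H'; rewrite /= in_itv/=; apply: H'; rewrite ?ltrDl ?gtrBl.
Qed.

Let Ecover x : `]a, b[%classic x -> \forall n \near \oo, E n x.
Proof.
rewrite /= in_itv/= => /andP[ax xb].
have h : 0 < Num.min (x - a) (b - x) by rewrite lt_min; apply/andP; split; lra.
move/cvgrPdist_lt : e0 => /(_ _ h); apply: filterS => n.
rewrite sub0r normrN gtr0_norm ?e_gt0// lt_min => /andP[? ?].
by rewrite /E /= in_itv/=; apply/andP; split; lra.
Qed.

Lemma open_FTC_integrable : mu.-integrable `]a, b[ (EFin \o f) ->
  has_int `]a, b[ f (B - A).
Proof.
move=> fi; split => //; rewrite /Rintegral.
suff -> : (\int[mu]_(x in `]a, b[) (f x)%:E = (B - A)%:E)%E by [].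
have := cvg_integral_increasing_integrable (m := mu) (measurable_itv `]a, b[)
  (E := E) (fun n => measurable_itv _) EsubD Ecover _ fi.
move=> /(_ (measurable_int _ fi)) /cvg_lim <- //.
apply/cvg_lim => //=; under eq_fun do rewrite intE.
by apply: cvg_EFin HE; apply: nearW.
Qed.

(** For a nonnegative integrand the finite limits of the primitive already force integrability, by
    monotone convergence along the intervals [E n]. This is how singular end points are handled
    later. *)
Lemma open_FTC_ge0 : (forall x, a < x < b -> 0 <= f x) ->
  has_int `]a, b[ f (B - A).
Proof.
move=> f0; apply: open_FTC_integrable.
apply/integrableP; split; first exact/measurable_EFinP.
under eq_integral => x do rewrite inE/= in_itv/= => xab.
have -> : (\int[mu]_(x in `]a, b[) `|(EFin \o f) x| =
           \int[mu]_(x in `]a, b[) (f x)%:E)%E.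
  apply: eq_integral => x; rewrite inE/= in_itv/= => /f0 ?.
  by rewrite ger0_norm.
have := cvg_integral_increasing_ge0 (m := mu) (f := EFin \o f)
  (measurable_itv `]a, b[) (E := E) (fun n => measurable_itv _) EsubD Ecover.
move=> /(_ _ _ _)/cvg_lim <- //.
- rewrite (_ : limn _ = (B - A)%:E) ?ltry//; apply/cvg_lim => //=.
  under eq_fun do rewrite intE.
  by apply: cvg_EFin HE; apply: nearW.
- exact/measurable_EFinP.
- move=> n x; rewrite /E /= !in_itv/=.
  have : e n.+1 <= e n by rewrite ler_pM2l ?subr_gt0// lef_pV2 ?posrE// ler_nat.
  by move=> ? /andP[? ?]; apply/andP; split; lra.
Qed.

End OpenFTC.
End Integrals.

(** * Power series *)

Section PowerSeries.
Context {R : realType}.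
Implicit Types (c : R^nat) (x z l : R).

(** A relation rather than a value: sums, multiples and shifts of convergent series compose, and a
    differential equation for the sum reduces, through [pcvg_unique], to a recurrence between
    coefficients. *)
Definition pcvg c x l : Prop := pseries c x @ \oo --> l.
Definition psum c x : R := limn (pseries c x).

Lemma pcvgP c x l : pcvg c x l -> psum c x = l.
Proof. by move=> cl; apply/cvg_lim. Qed.

Lemma pcvg_ext c d x l : c =1 d -> pcvg c x l -> pcvg d x l.
Proof. by move=> cd; rewrite /pcvg (_ : d = c)//; apply/funext => n; rewrite cd. Qed.

Lemma pcvg_eq c x l l' : pcvg c x l -> l = l' -> pcvg c x l'.
Proof. by move=> ? <-. Qed.

Lemma pcvg_unique c x l l' : pcvg c x l -> pcvg c x l' -> l = l'.
Proof. by move=> /pcvgP <- /pcvgP <-. Qed.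

Lemma pcvg0 x : pcvg (fun=> 0) x 0.
Proof.
rewrite /pcvg (_ : pseries _ _ = fun=> 0); first exact: cvg_cst.
by apply/funext => n; rewrite /pseries /series /= big1// => i _; rewrite mul0r.
Qed.

Lemma pcvgD c d x l m : pcvg c x l -> pcvg d x m ->
  pcvg (fun n => c n + d n) x (l + m).
Proof.
move=> cl dm; rewrite /pcvg (_ : pseries _ _ = pseries c x + pseries d x).
  exact: cvgD.
apply/funext => n; rewrite /pseries /series /= -[RHS]/(_ + _) -big_split /=.
by apply: eq_bigr => i _; rewrite mulrDl.
Qed.

Lemma pcvgZ c x l k : pcvg c x l -> pcvg (fun n => k * c n) x (k * l).
Proof.
move=> cl; rewrite /pcvg (_ : pseries _ _ = fun n => k * pseries c x n).
  by apply: cvgM => //; exact: cvg_cst.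
apply/funext => n; rewrite /pseries /series /= mulr_sumr.
by apply: eq_bigr => i _; rewrite mulrA.
Qed.

Definition shiftup c n : R := if n is m.+1 then c m else 0.

Lemma pcvg_shiftup c x l : pcvg c x l -> pcvg (shiftup c) x (x * l).
Proof.
move=> cl; rewrite /pcvg -cvg_shiftS.
rewrite (_ : (fun n => pseries _ _ n.+1) = fun n => x * pseries c x n).
  by apply: cvgM => //; exact: cvg_cst.
apply/funext => n; rewrite /pseries /series /= big_nat_recl//= mul0r add0r mulr_sumr.
by apply: eq_bigr => i _; rewrite exprS; ring.
Qed.

Lemma pcvg_at0 c : pcvg c 0 (c 0%N).
Proof.
rewrite /pcvg -cvg_shiftS (_ : (fun n => _) = fun=> c 0%N); first exact: cvg_cst.
apply/funext => n; rewrite /pseries /series /= big_nat_recl//= expr0 mulr1.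
by rewrite big1 ?addr0// => i _; rewrite exprS mul0r mulr0.
Qed.

Lemma psum_ge0 c x : 0 <= x -> (forall n, 0 <= c n) -> cvgn (pseries c x) ->
  0 <= psum c x.
Proof.
move=> x0 c0 cv; apply: limr_ge => //; apply: nearW => n.
by rewrite /pseries /series /=; apply: sumr_ge0 => i _; rewrite mulr_ge0 ?exprn_ge0.
Qed.

Definition conv_in c (r : R) := forall z, `|z| < r -> cvgn (pseries c z).

Lemma conv_inP c r z : conv_in c r -> `|z| < r -> pcvg c z (psum c z).
Proof. by move=> h /h. Qed.

Lemma conv_in_bounded c (M : R) : (forall n, `|c n| <= M) -> conv_in c 1.
Proof.
move=> cM z z1; apply: normed_cvg.
have M0 : 0 <= M by apply: le_trans (cM 0%N).
apply: (@series_le_cvg _ _ (geometric M `|z|)) => //= [n|n|].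
- by rewrite mulr_ge0// exprn_ge0.
- by rewrite normrM normrX ler_wpM2r ?exprn_ge0.
- by apply: is_cvg_geometric_series; rewrite normr_id.
Qed.

Lemma pow_mul_bounded (q : R) : 0 <= q < 1 ->
  exists M, forall n, n.+1%:R * q ^+ n <= M.
Proof.
move=> /andP[q0 q1]; have [->|qN0] := eqVneq q 0.
  exists 1 => -[|n]; first by rewrite mulr1.
  by rewrite exprS mul0r mulr0 ler01.
have qp : 0 < q by rewrite lt_neqAle eq_sym qN0.
(* With $1/q = 1+h$, Bernoulli's inequality gives $1+nh \le q^{-n}$, and $n+1 \le (1+1/h)(1+nh)$. *)
pose h := q^-1 - 1.
have h0 : 0 < h by rewrite subr_gt0 invf_gt1.
exists (1 + h^-1) => n.
have bern : 1 + n%:R * h <= q^-1 ^+ n.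
  elim: n => [|n IH]; first by rewrite mul0r addr0 expr0.
  rewrite exprS (_ : q^-1 = 1 + h); last by rewrite /h; ring.
  apply: (@le_trans _ _ ((1 + h) * (1 + n%:R * h))).
    rewrite -subr_ge0 (_ : _ - _ = n%:R * h ^+ 2); first by rewrite mulr_ge0// sqr_ge0.
    by rewrite -(natr1 n); ring.
  by rewrite ler_pM2l; [rewrite (_ : 1 + h = q^-1) // /h; ring|lra].
have : n.+1%:R <= (1 + h^-1) * (1 + n%:R * h).
  rewrite -subr_ge0 (_ : _ - _ = n%:R * h + h^-1); last first.
    by rewrite -(natr1 n); field; rewrite gt_eqF.
  by rewrite addr_ge0// ?mulr_ge0// ?invr_ge0 ltW.
move=> /le_trans -/(_ ((1 + h^-1) * q^-1 ^+ n)).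
rewrite ler_pM2l ?addr_gt0 ?invr_gt0// => /(_ bern) H.
by rewrite -ler_pdivlMr ?exprn_gt0// -exprVn.
Qed.

(** At an intermediate radius [K] the terms $|c_n|K^n$ are bounded. With $q=|z|/K<s<1$, the factor
    $n+1$ of the differentiated series is absorbed by $(q/s)^n$, and a geometric series of ratio [s]
    remains. *)
Lemma conv_in_diffs c r : conv_in c r -> conv_in (pseries_diffs c) r.
Proof.
move=> cr z zr.
have r0 : 0 <= r by rewrite ltW// (le_lt_trans _ zr).
pose K := (`|z| + r) / 2.
have K0 : 0 < K by rewrite /K; have := normr_ge0 z; lra.
have zK : `|z| < K by rewrite /K; lra.
have /cr cK : `|K| < r by rewrite gtr0_norm// /K; lra.
have [M0 [M0r cM]] := cvg_series_bounded cK.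
have {}cM n : `|c n| * K ^+ n <= `|M0| + 1.
  have := cM (`|M0| + 1) _ n I; rewrite /= normrM normrX (gtr0_norm K0); apply.
  by rewrite (le_lt_trans (ler_norm _))// ltrDl.
pose q := `|z| / K.
pose s := (q + 1) / 2.
have q0 : 0 <= q by rewrite divr_ge0// ltW.
have q1 : q < 1 by rewrite ltr_pdivrMr// mul1r.
have s0 : 0 < s by rewrite /s; lra.
have [M2 hM2] : exists M, forall n, n.+1%:R * (q / s) ^+ n <= M.
  by apply: pow_mul_bounded; rewrite divr_ge0 ?(ltW s0)//= ltr_pdivrMr// /s; lra.
apply: normed_cvg.
apply: (@series_le_cvg _ _ (geometric ((`|M0| + 1) / K * M2) s)) => //= [n|n|].
- have M20 : 0 <= M2 by apply: le_trans (hM2 0%N); rewrite expr0 mulr1.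
  by rewrite mulr_ge0 ?exprn_ge0 ?(ltW s0)// mulr_ge0 ?divr_ge0 ?addr_ge0 ?(ltW K0)//.
- rewrite /pseries_diffs !normrM normrX normr_nat.
  have -> : `|z| = q * K by rewrite /q divfK// gt_eqF.
  apply: (@le_trans _ _ ((`|c n.+1| * K ^+ n.+1) / K * (n.+1%:R * q ^+ n))).
    rewrite (exprMn _ q) exprS le_eqVlt; apply/orP; left; apply/eqP.
    by field; rewrite gt_eqF.
  have -> : (`|M0| + 1) / K * M2 * s ^+ n = (`|M0| + 1) / K * (M2 * s ^+ n) by ring.
  apply: ler_pM => //.
  + by rewrite !mulr_ge0 ?exprn_ge0 ?invr_ge0 ?(ltW K0).
  + by rewrite mulr_ge0 ?exprn_ge0.
  + by rewrite ler_pM2r ?invr_gt0.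
  + have := hM2 n; rewrite expr_div_n mulrA ler_pdivrMr ?exprn_gt0//.
- by apply: is_cvg_geometric_series; rewrite gtr0_norm// /s; lra.
Qed.

Lemma psum_der c r x : conv_in c r -> `|x| < r ->
  isder (psum c) x (psum (pseries_diffs c) x).
Proof.
move=> cr xr; pose K := (`|x| + r) / 2.
have K0 : 0 < K by rewrite /K; have := normr_ge0 x; lra.
have Kr : `|K| < r by rewrite gtr0_norm// /K; lra.
apply: (@pseries_snd_diffs _ c K x).
- exact: cr.
- exact: (conv_in_diffs cr Kr).
- exact: (conv_in_diffs (conv_in_diffs cr) Kr).
- by rewrite (gtr0_norm K0) /K; lra.
Qed.

(* Abel: the Cesaro-type easy direction, [(1 - x) sum c_n x^n -> lim c_n]. *)
Lemma abel_limit c l : c @ \oo --> l ->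
  (1 - x) * psum c x @[x --> 1^'-] --> l.
Proof.
move=> cl.
have [M cM] : exists M, forall n, `|c n| <= M.
  have [M [Mr hM]] := cvg_seq_bounded (cvgP _ cl).
  by exists (M + 1) => n; apply: hM; rewrite ?ltrDl.
have ci := conv_in_bounded cM.
apply/cvgrPdist_le => e e0.
have e20 : 0 < e / 2 by rewrite divr_gt0.
move/cvgrPdist_le : cl => /(_ _ e20) [N _ HN].
pose S := \sum_(0 <= i < N) `|c i - l|.
have S0 : 0 <= S by apply: sumr_ge0.
near=> x.
have x0 : 0 < x by near: x; exact: nbhs_left_gt.
have x1 : x < 1 by near: x; exact: nbhs_left_lt.
have xS : (1 - x) * S <= e / 2.
  have : 1 - x <= e / 2 / (S + 1).
    have : 1 - e / 2 / (S + 1) <= x by near: x; apply: nbhs_left_ge; rewrite gtrBl divr_gt0// ltr_wpDl.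
    lra.
  move=> h; apply: (@le_trans _ _ (e / 2 / (S + 1) * S)); first by rewrite ler_wpM2r.
  rewrite -mulrA ler_piMr// ?(ltW e20)// mulrC ler_pdivrMr ?ltr_wpDl//; lra.
have xn : `|x| < 1 by rewrite gtr0_norm.
have geo : pcvg (fun=> 1) x (1 - x)^-1.
  rewrite /pcvg (_ : pseries _ _ = series (geometric 1 x)).
    by rewrite -[(1 - x)^-1]mul1r; exact: cvg_geometric_series.
  by apply/funext.
have cx := conv_inP ci xn.
have dx : pcvg (fun n => c n - l) x (psum c x - l / (1 - x)).
  apply: (pcvg_eq (l := psum c x + - l * (1 - x)^-1)); last by rewrite mulNr.
  have := pcvgD cx (pcvgZ (k := - l) geo); apply: pcvg_ext => n /=; ring.
have bound : `|psum c x - l / (1 - x)| <= S + e / 2 / (1 - x).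
  have dxn : `|pseries (fun n => c n - l) x m| @[m --> \oo] --> `|psum c x - l / (1 - x)|.
    exact: cvg_norm dx.
  rewrite -(cvg_lim _ dxn)//; apply: limr_le; first by apply/cvg_ex; eexists; exact: dxn.
  apply: nearW => m; rewrite /pseries /series /=.
  apply: (le_trans (ler_norm_sum _ _ _)).
  apply: (@le_trans _ _ (\sum_(0 <= i < m) ((if (i < N)%N then `|c i - l| else 0) + e / 2 * x ^+ i))).
    apply: ler_sum => i _; rewrite normrM normrX (gtr0_norm x0).
    case: ltnP => iN.
      apply: (@le_trans _ _ (`|c i - l| * 1)).
        by rewrite ler_wpM2l// exprn_ile1// ltW.
      by rewrite mulr1 lerDl mulr_ge0 ?exprn_ge0// ltW.
    rewrite add0r ler_wpM2r ?exprn_ge0 ?(ltW x0)// distrC; exact: HN.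
  rewrite big_split /= lerD//.
    rewrite /S -big_mkcond /= !big_mkord.
    rewrite [leRHS](_ : _ = \sum_(i < N | true) `|c i - l|)//.
    have -> : \sum_(i < m | (i < N)%N) `|c i - l| = \sum_(0 <= i < minn m N) `|c i - l|.
      by rewrite big_mkord (big_ord_widen_cond m xpredT (fun i => `|c i - l|)) ?geq_minl//; apply: eq_bigl => i; rewrite ltn_min ltn_ord.
    rewrite -(big_mkord xpredT (fun i => `|c i - l|)) (big_cat_nat (n := minn m N) (leq0n _) (geq_minr _ _)) /= lerDl.
    exact: sumr_ge0.
  rewrite -mulr_sumr ler_wpM2l ?(ltW e20)//.
  have -> : \sum_(0 <= i < m) x ^+ i = (1 - x ^+ m) / (1 - x).
    elim: m => [|k IH]; first by rewrite big_nil expr0 subrr mul0r.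
    by rewrite big_nat_recr//= IH exprS; field; rewrite subr_eq0 gt_eqF.
  by rewrite ler_pdivrMr ?subr_gt0// mulVf ?subr_eq0 ?gt_eqF// gerBl exprn_ge0// ltW.
have x1' : 0 < 1 - x by rewrite subr_gt0.
rewrite distrC (_ : _ - l = (1 - x) * (psum c x - l / (1 - x))); last first.
  by rewrite mulrBr [(1 - x) * (l / _)]mulrC divfK// gt_eqF.
rewrite normrM gtr0_norm//; apply: (@le_trans _ _ ((1 - x) * (S + e / 2 / (1 - x)))).
  by rewrite ler_pM2l.
rewrite mulrDr [(1 - x) * (e / 2 / _)]mulrC divfK ?gt_eqF//; lra.
Unshelve. all: by end_near. Qed.

End PowerSeries.

(** * The hypergeometric series *)

Section HypergeometricCoefficients.
Context {R : realType}.
Local Notation mu := (@lebesgue_measure R).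

Lemma integrable_cc (f : R -> R) (a b : R) :
  (forall x, f y @[y --> x] --> f x) -> mu.-integrable `[a, b] (EFin \o f).
Proof.
move=> cf; apply: continuous_compact_integrable; first exact: segment_compact.
by apply: continuous_subspaceT => x; exact: cf.
Qed.

Lemma Rintegral_FTC (H f : R -> R) (a b : R) : a <= b ->
  (forall x, isder H x (f x)) ->
  (forall x, f y @[y --> x] --> f x) ->
  Rintegral mu `[a, b] f = H b - H a.
Proof.
rewrite le_eqVlt => /predU1P[<-|ab] Hf cf.
  by rewrite set_itv1 Rintegral_set1 subrr.
rewrite /Rintegral (@FTC_cc _ H f (a - 1) (b + 1) a b) //; lra.
Qed.

(** The cosine integrals from the classical derivation of the sine product: passing from [m] to
    [m.+2] multiplies [wallis 0 m / wallis a m] by $1-a^2/(m+2)^2$. *)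
Definition wallis (a : R) (m : nat) : R :=
  Rintegral mu `[0, pi / 2] (fun x => cos (a * x) * cos x ^+ m).

Lemma der_cosZ (a x : R) : isder (fun y => cos (a * y)) x (- sin (a * x) * a).
Proof.
apply: (@der_comp _ (fun y => a * y) cos).
  by der; ring.
exact: is_derive_cos.
Qed.

Lemma der_sinZ (a x : R) : isder (fun y => sin (a * y)) x (cos (a * x) * a).
Proof.
apply: (@der_comp _ (fun y => a * y) sin).
  by der; ring.
exact: is_derive_sin.
Qed.

Let cwallis (a : R) m (x : R) : cos (a * y) * cos y ^+ m @[y --> x] --> (cos (a * x) * cos x ^+ m : R).
Proof.
apply: (@der_cvg _ (fun y => cos (a * y) * cos y ^+ m)); apply: derM.
  exact: der_cosZ.
by apply: derX; exact: is_derive_cos.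
Qed.

Let iwallis a m := integrable_cc (0 : R) (pi / 2) (@cwallis a m).

Lemma wallis_rec a m :
  m.+2%:R * m.+1%:R * wallis a m = (m.+2%:R ^+ 2 - a ^+ 2) * wallis a m.+2.
Proof.
rewrite -!RintegralZl//; try exact: iwallis.
apply/esym/eqP; rewrite -subr_eq0 -RintegralB//; last 2 first.
- by apply: integrable_cc => x; apply: cvgM; [exact: cvg_cst|exact: cwallis].
- by apply: integrable_cc => x; apply: cvgM; [exact: cvg_cst|exact: cwallis].
(* A primitive of the difference of the two integrands: the terms in $\sin(ax)\sin x$ cancel in its
   derivative. It vanishes at 0 and at $\pi/2$. *)
pose H x : R := m.+2%:R * (cos (a * x) * (cos x ^+ m.+1 * sin x))
  - a * (sin (a * x) * cos x ^+ m.+2).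
have dc x := is_derive_cos x.
have ds x := is_derive_sin x.
rewrite (@Rintegral_FTC H _) //.
- by rewrite /H cos_pihalf !exprS !(mul0r, mulr0) sin0 !(mul0r, mulr0) ?subrr ?oppr0.
- by rewrite divr_ge0// pi_ge0.
- move=> x; apply: der_eq.
    apply: derD.
      apply: derM; [exact: derC|apply: derM; [exact: der_cosZ|]].
      by apply: derM; [apply: derX; exact: dc|exact: ds].
    apply: derN; apply: derM; [exact: derC|apply: derM; [exact: der_sinZ|]].
    by apply: derX; exact: dc.
  have s2 : sin x * sin x = 1 - cos x ^+ 2 by rewrite -expr2 sin2cos2.
  rewrite /= !exprS -!(natr1 m) -(natr1 m.+1) -!(natr1 m).
  transitivity (- ((m%:R + 1 + 1) * ((m%:R + 1) * cos (a * x) * cos x ^+ m * (sin x * sin x)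
    - cos (a * x) * (cos x * cos x * cos x ^+ m)) +
    a * a * cos (a * x) * (cos x * cos x * cos x ^+ m))); first by ring.
  by rewrite s2 expr2; ring.
- move=> x; apply: cvgB; apply: cvgM; try exact: cvg_cst; exact: cwallis.
Qed.

Lemma wallis_le a b m n : (forall x, 0 <= x <= pi / 2 ->
    cos (a * x) * cos x ^+ m <= cos (b * x) * cos x ^+ n) ->
  wallis a m <= wallis b n.
Proof.
move=> h; apply: le_Rintegral => //; try exact: iwallis.

Qed.

Lemma wallis_gt0 m : 0 < wallis 0 m.*2.
Proof.
elim: m => [|m IH].
  rewrite /wallis (_ : (fun _ => _) = cst 1); last first.
    by apply/funext => x; rewrite mul0r cos0 double0 expr0 mul1r.
  rewrite Rintegral_cst//= mul1r lebesgue_measure_itv/= lte_fin divr_gt0 ?pi_gt0//=.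
  by rewrite subr0 divr_gt0// pi_gt0.
have := wallis_rec 0 m.*2; rewrite expr0n subr0 doubleS => e.
have : 0 < m.*2.+2%:R ^+ 2 * wallis 0 m.*2.+2.
  by rewrite -e !mulr_gt0.
by rewrite pmulr_rgt0// exprn_gt0.
Qed.

(** On $[0,\pi/2]$ one has $\cos^2 x\le\cos x\le\cos(ax)\le1$, so [wallis a n.*2] lies between
    [wallis 0 n.*2.+2] and [wallis 0 n.*2], whose quotient is $(2n+1)/(2n+2)$. *)
Lemma wallis_ratio_cvg (a : R) : 0 <= a <= 1 ->
  wallis a n.*2 / wallis 0 n.*2 @[n --> \oo] --> (1 : R).
Proof.
move=> /andP[a0 a1].
apply: (@squeeze_cvgr _ _ _ _ (fun n => 1 - harmonic n) (fun=> 1)); last 2 first.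
- rewrite -[X in _ --> X]subr0; apply: cvgB; [exact: cvg_cst|exact: cvg_harmonic].
- exact: cvg_cst.
apply: nearW => n; have w0 := wallis_gt0 n.
rewrite ler_pdivrMr// ler_pdivlMr// mul1r; apply/andP; split; last first.
  apply: wallis_le => x /andP[x0 xp].
  rewrite ler_wpM2r ?exprn_ge0 ?cos_ge0_pihalf//; last by rewrite mul0r cos0 cos_le1.
  by rewrite xp andbT (le_trans _ x0)// oppr_le0 divr_ge0// pi_ge0.
have -> : (1 - harmonic n) * wallis 0 n.*2 <= wallis a n.*2 = 
   ((1 - harmonic n) * wallis 0 n.*2 <= wallis a n.*2) by [].
apply: (@le_trans _ _ (wallis 0 n.*2.+2)).
  have := wallis_rec 0 n.*2; rewrite expr0n subr0 => e.
  have -> : wallis 0 n.*2.+2 = n.*2.+1%:R / n.*2.+2%:R * wallis 0 n.*2.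
    apply: (@mulfI _ (n.*2.+2%:R ^+ 2)); first by rewrite expf_neq0.
    by rewrite -e; field.
  rewrite ler_pM2r// /harmonic /= ler_pdivlMr// mulrBl mul1r.
  rewrite [_.+1%:R^-1 * _](_ : _ = 2); last first.
    by rewrite -doubleS -mul2n natrM mulrCA mulVf ?mulr1// pnatr_eq0.
  by rewrite -(natr1 n.*2.+1); lra.
apply: wallis_le => x /andP[x0 xp]; rewrite mul0r cos0 mul1r.
have c0 : 0 <= cos x.
  by rewrite cos_ge0_pihalf// xp andbT (le_trans _ x0)// oppr_le0 divr_ge0// pi_ge0.
have pp := @pi_gt0 R.
rewrite exprS exprS mulrA ler_wpM2r ?exprn_ge0//.
apply: (@le_trans _ _ (cos x)); first by rewrite ler_piMr// cos_le1.
have ax : a * x <= x by rewrite ler_piMl.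
move: ax; rewrite le_eqVlt => /predU1P[->//|ax].
rewrite ltW// ltr_cos// in_itv/=; apply/andP; split; rewrite ?mulr_ge0//; lra.
Qed.

(** Tripling the angle gives $\sin\pi=0$, that is $s(3-4s^2)=0$ with $s>0$. *)
Lemma sin_pi3 : sin (pi / 3) = Num.sqrt 3 / 2 :> R.
Proof.
have pp := @pi_gt0 R.
pose s : R := sin (pi / 3); pose c : R := cos (pi / 3); rewrite -/s.
have s0 : 0 < s by apply: sin_gt0_pi; apply/andP; split; lra.
have e : c ^+ 2 = 1 - s ^+ 2 by rewrite /c cos2sin2.
have : sin (pi / 3 + (pi / 3 + pi / 3)) = 0 :> R.
  by rewrite (_ : _ + _ = pi) ?sinpi//; field.
rewrite sinD cosD sinD -/s -/c => h.
have h2 : s * (3 - 4 * s ^+ 2) = 0.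
  by rewrite -h; transitivity (s * (3 * (1 - s ^+ 2) - s * s)); [ring|rewrite -e; ring].
move/eqP: h2; rewrite mulf_eq0 gt_eqF//= subr_eq0 => /eqP h3.
have : s = Num.sqrt (s ^+ 2) by rewrite sqrtr_sqr gtr0_norm.
have -> : s ^+ 2 = 3 / 2 ^+ 2 by lra.
by move=> ->; rewrite sqrtrM// sqrtrV ?exprn_ge0// sqrtr_sqr ger0_norm.
Qed.

Definition hypc (j : nat) : R :=
  rising (1 / 3) j * rising (2 / 3) j / (rising 1 j * j`!%:R).

Lemma risingS (a : R) n : rising a n.+1 = rising a n * (a + n%:R).
Proof. by rewrite /rising big_ord_recr. Qed.

Lemma rising1 n : rising (1 : R) n = n`!%:R.
Proof.
elim: n => [|n IH]; first by rewrite /rising big_ord0 fact0.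
by rewrite risingS IH factS mulnC natrM nat1r.
Qed.

Lemma rising_gt0 (a : R) n : 0 < a -> 0 < rising a n.
Proof. by move=> a0; apply: prodr_gt0 => i _; rewrite ltr_pwDl. Qed.

Lemma hypc0 : hypc 0 = 1.
Proof. by rewrite /hypc /rising !big_ord0 fact0 !mulr1 divr1. Qed.

Lemma hypc_rec j :
  j.+1%:R ^+ 2 * hypc j.+1 = (j%:R ^+ 2 + j%:R + 2 / 9) * hypc j.
Proof.
rewrite /hypc !risingS rising1 factS natrM -(natr1 j).
have f0 : (j`!%:R : R) != 0 by rewrite pnatr_eq0 -lt0n fact_gt0.
by field; rewrite f0 /= natr1 pnatr_eq0.
Qed.

Lemma hypc_ge0 j : 0 <= hypc j.
Proof.
by rewrite /hypc divr_ge0 ?mulr_ge0// ltW// ?rising_gt0//; lra.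
Qed.

(* Euler's product for the sine at 1/3, with [wallis (2 / 3)] as remainder. *)
Lemma hypc_wallis n : 
  n.+1%:R * hypc n.+1 = (1 - harmonic n / 3) * (Num.sqrt 3 / (2 * pi)) *
    (wallis (2 / 3) n.*2 / wallis 0 n.*2)^-1.
Proof.
have pp := @pi_gt0 R.
(* Regrouping $(1/3)_{n+1}(2/3)_{n+1}$ as $\frac13(n+\frac23)\prod_{j=1}^n(j^2-\frac19)$ leaves the
   unpaired factor $(n+2/3)/(n+1)$, which is [1 - harmonic n / 3]. Positivity is carried along so
   that the division is legitimate. *)
suff H : n.+1%:R * hypc n.+1 * wallis (2 / 3) n.*2 = 
     (1 - harmonic n / 3) * (Num.sqrt 3 / (2 * pi)) * wallis 0 n.*2 /\ 0 < wallis (2 / 3) n.*2.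
  case: H => H w0; apply: (@mulIf _ (wallis (2 / 3) n.*2)); first by rewrite gt_eqF.
  by rewrite H invf_div -[RHS]mulrA divfK// gt_eqF.
elim: n => [|n [IH w0]].
  (* The integral of $\cos(2x/3)$ is $\frac32\sin(\pi/3)$: here the $\sqrt3$ of the densities
     enters. *)
  have w0 : wallis (2 / 3) 0.*2 = 3 * Num.sqrt 3 / 4.
    rewrite /wallis (_ : (fun _ => _) = fun x => cos (2 / 3 * x)); last first.
      by apply/funext => x; rewrite double0 expr0 mulr1.
    rewrite (@Rintegral_FTC (fun x => 3 / 2 * sin (2 / 3 * x))) ?divr_ge0 ?pi_ge0//.
    - rewrite mulr0 sin0 (_ : 2 / 3 * (pi / 2) = pi / 3); last by field.
      by rewrite sin_pi3; field.
    - by move=> x; apply: der_eq; [apply: derM; [exact: derC|exact: der_sinZ]|rewrite /=; field].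
    - move=> x; exact: der_cvg (der_cosZ (2 / 3) x).
  rewrite w0; split; last by rewrite divr_gt0// mulr_gt0// sqrtr_gt0.
  have -> : wallis 0 0.*2 = pi / 2.
    rewrite /wallis (_ : (fun _ => _) = cst 1); last first.
      by apply/funext => x; rewrite mul0r cos0 double0 expr0 mul1r.
    rewrite Rintegral_cst//= mul1r lebesgue_measure_itv/= lte_fin divr_gt0 ?pi_gt0//=.
    by rewrite subr0.
  have := hypc_rec 0; rewrite hypc0 expr1n mul1r => ->.
  rewrite /harmonic /= mulr0n expr0n /=.
  by move: pp; move: (pi : R) => p p0; field; rewrite gt_eqF.
have e0 := wallis_rec 0 n.*2.
have e2 := wallis_rec (2 / 3) n.*2.
have w2 : 0 < wallis (2 / 3) n.*2.+2.
  have : 0 < (n.*2.+2%:R ^+ 2 - (2 / 3) ^+ 2) * wallis (2 / 3) n.*2.+2.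
    by rewrite -e2 !mulr_gt0.
  rewrite pmulr_rgt0// subr_gt0 (@lt_le_trans _ _ 1)//; first lra.
  by rewrite exprn_ege1// ler1n.
rewrite doubleS; split => //.
have hr := hypc_rec n.+1.
have n20 : (n.+2%:R : R) != 0 by rewrite pnatr_eq0.
have n10 : (n.+1%:R : R) != 0 by rewrite pnatr_eq0.
have d20 : (n.*2.+2%:R : R) = 2 * n.+1%:R by rewrite -doubleS -mul2n natrM.
have d21 : (n.*2.+1%:R : R) = 2 * n%:R + 1 by rewrite -natr1 -mul2n natrM.
move: e0 e2; rewrite expr0n subr0 d20 d21 => e0 e2.
have E2 : (n.+2%:R * hypc n.+2) * wallis (2 / 3) n.*2.+2 * (n.+2%:R * (n.+1%:R ^+2 - 1 / 9)) =
   (n.+1%:R ^+ 2 + n.+1%:R + 2 / 9) * hypc n.+1 * (n.+1%:R * (2 * n%:R + 1) / 2 * wallis (2 / 3) n.*2).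
  rewrite -hr; transitivity (n.+2%:R ^+ 2 * hypc n.+2 / 4 * ((2 * n.+1%:R) * (2 * n%:R + 1) * wallis (2 / 3) n.*2)); last by field.
  by rewrite e2; field.
have nz : n.+2%:R * (n.+1%:R ^+ 2 - 1 / 9) != 0 :> R.
  rewrite mulf_neq0// gt_eqF// subr_gt0 (@lt_le_trans _ _ 1)//; first lra.
  by rewrite exprn_ege1// ler1n.
apply: (mulIf nz); rewrite E2.
have -> : (n.+1%:R ^+ 2 + n.+1%:R + 2 / 9) * hypc n.+1 *
  (n.+1%:R * (2 * n%:R + 1) / 2 * wallis (2 / 3) n.*2) =
  (n.+1%:R ^+ 2 + n.+1%:R + 2 / 9) * ((2 * n%:R + 1) / 2) *
   (n.+1%:R * hypc n.+1 * wallis (2 / 3) n.*2) by ring.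
rewrite IH.
have e0' : (2 * n%:R + 1) * wallis 0 n.*2 = (2 * n.+1%:R) * wallis 0 n.*2.+2.
  apply: (@mulfI _ (2 * n.+1%:R)); first by rewrite mulf_neq0.
  by rewrite [RHS]mulrA -expr2 -e0; ring.
transitivity ((n.+1%:R ^+ 2 + n.+1%:R + 2 / 9) * ((1 - harmonic n / 3) * (Num.sqrt 3 / (2 * pi))) / 2
  * ((2 * n%:R + 1) * wallis 0 n.*2)); first by ring.
rewrite e0' /harmonic /= -!(natr1 n.+1) -!(natr1 n).
rewrite -!(natr1 n.+1) -!(natr1 n) in n20 n10; move: pp n10 n20.
move: (wallis 0 n.*2.+2) (pi : R) (n%:R : R) => w p m p0 n10 n20; field.
by rewrite n20 n10 gt_eqF.
Qed.

(** This is $\sin(\pi/3)/\pi=1/(\Gamma(1/3)\Gamma(2/3))$, the weight of the logarithmic singularity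
    of the hypergeometric function at 1. *)
Definition hypc_lim : R := Num.sqrt 3 / (2 * pi).

Lemma cvg_hypc : n.+1%:R * hypc n.+1 @[n --> \oo] --> hypc_lim.
Proof.
under eq_fun do rewrite hypc_wallis.
rewrite -[hypc_lim]mulr1 -[X in _ * X]invr1; apply: cvgM; last first.
  by apply: cvgV; [exact: oner_neq0|apply: wallis_ratio_cvg; apply/andP; split; lra].
rewrite -[hypc_lim]mul1r; apply: cvgM; last exact: cvg_cst.
rewrite -[X in _ --> X]subr0; apply: cvgB; first exact: cvg_cst.
rewrite -(mul0r 3^-1); apply: cvgM; [exact: cvg_harmonic|exact: cvg_cst].
Qed.

End HypergeometricCoefficients.

(** * Gauss's equation, its rational pullback and the self-adjoint form *)

Section HypergeometricFunction.
Context {R : realType}.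
Local Notation mu := (@lebesgue_measure R).

Definition hypG : R -> R := psum hypc.
Definition hypG' : R -> R := psum (pseries_diffs hypc).
Definition hypG'' : R -> R := psum (pseries_diffs (pseries_diffs hypc)).

(** The induction step is $(j+2)(j^2+j+2/9)\le(j+1)^3$. The bound serves twice: it bounds the
    coefficients of [hypG], and it dominates [hypG'] by the geometric series. *)
Lemma hypc_le j : j.+1%:R * @hypc R j <= 1.
Proof.
elim: j => [|j IH]; first by rewrite hypc0 mulr1.
have j0 : 0 <= j%:R :> R by [].
have : j.+1%:R ^+ 3 * (j.+2%:R * @hypc R j.+1) <= j.+1%:R ^+ 3 * 1.
  have -> : j.+1%:R ^+ 3 * (j.+2%:R * @hypc R j.+1) =
      j.+2%:R * (j%:R ^+ 2 + j%:R + 2 / 9) * (j.+1%:R * hypc j).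
    by rewrite exprS -mulrA [_ ^+ 2 * _]mulrCA hypc_rec; ring.
  apply: (@le_trans _ _ (j.+2%:R * (j%:R ^+ 2 + j%:R + 2 / 9) * 1)).
    by rewrite ler_wpM2l// mulr_ge0// !addr_ge0// exprn_ge0.
  by rewrite !mulr1 -(natr1 j.+1) -(natr1 j); nra.
by rewrite ler_pM2l// exprn_gt0.
Qed.

Lemma hypc_bounded j : `|@hypc R j| <= 1.
Proof.
rewrite ger0_norm ?hypc_ge0// (le_trans _ (hypc_le j))//.
by rewrite ler_peMl ?hypc_ge0// ler1n.
Qed.

Definition hypc_conv := conv_in_bounded hypc_bounded.
Definition hypc_conv' := conv_in_diffs hypc_conv.
Definition hypc_conv'' := conv_in_diffs hypc_conv'.

Lemma der_hypG z : `|z| < 1 -> isder hypG z (hypG' z).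
Proof. by move=> z1; apply: psum_der z1; exact: hypc_conv. Qed.

Lemma der_hypG' z : `|z| < 1 -> isder hypG' z (hypG'' z).
Proof. by move=> z1; apply: psum_der z1; exact: hypc_conv'. Qed.

(** Gauss's equation is [hypc_rec] read coefficientwise, multiplication by [z] being a shift. The
    first two coefficients are separate because the shifts contribute zeros there. *)
Lemma hypG_ode z : `|z| < 1 ->
  z * (1 - z) * hypG'' z + (1 - 2 * z) * hypG' z - 2 / 9 * hypG z = 0.
Proof.
move=> z1.
have h0 := conv_inP hypc_conv z1.
have h1 := conv_inP hypc_conv' z1.
have h2 := conv_inP hypc_conv'' z1.
apply: (@pcvg_unique _ (fun=> 0) z); last exact: pcvg0.
apply: pcvg_eq; first (apply: pcvg_ext; last first).
- exact: (pcvgD (pcvgD (pcvgD (pcvg_shiftup h2) (pcvgZ (k := -1) (pcvg_shiftup (pcvg_shiftup h2))))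
    (pcvgD h1 (pcvgZ (k := -2) (pcvg_shiftup h1)))) (pcvgZ (k := - (2 / 9)) h0)).
- move=> [|[|n]] /=; rewrite /pseries_diffs.
  + by have := @hypc_rec R 0; rewrite mulr0n expr0n/= => e; lra.
  + by have := @hypc_rec R 1 => e; lra.
  + have := @hypc_rec R n.+2; rewrite -!(natr1 n.+2) -!(natr1 n.+1) -!(natr1 n) => e.
    by rewrite -[RHS](subrr ((n%:R + 1 + 1 + 1) ^+ 2 * hypc n.+3)) {2}e; ring.
- by rewrite -/hypG -/hypG' -/hypG''; ring.
Qed.

Lemma hypG_ge0 z : 0 <= z < 1 -> 0 <= hypG z.
Proof.
move=> /andP[z0 z1]; apply: psum_ge0 => //; first exact: hypc_ge0.
by apply: hypc_conv; rewrite ger0_norm.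
Qed.

Lemma hypG0 : hypG 0 = 1.
Proof. by rewrite /hypG (pcvgP (@pcvg_at0 R hypc)) hypc0. Qed.

Lemma hypG'_le z : 0 <= z < 1 -> hypG' z <= (1 - z)^-1.
Proof.
move=> /andP[z0 z1]; have zn : `|z| < 1 by rewrite ger0_norm.
have h1 := conv_inP hypc_conv' zn.
have geo : series (geometric (1 : R) z) @ \oo --> (1 - z)^-1.
  by rewrite -[(1 - z)^-1]mul1r; exact: cvg_geometric_series.
rewrite -(cvg_lim _ geo)//; apply: ler_lim.
- by apply: hypc_conv'.
- by apply/cvg_ex; eexists; exact: geo.
- apply: nearW => n; rewrite /pseries /series /=; apply: ler_sum => i _.
  rewrite ler_wpM2r ?exprn_ge0// /pseries_diffs (le_trans _ (hypc_le i.+1))//.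
  by rewrite ler_wpM2r ?hypc_ge0// ler_nat.
Qed.

Lemma cvg_hypG'_1 : (1 - z) * hypG' z @[z --> 1^'-] --> (hypc_lim : R).
Proof. by apply: abel_limit; exact: cvg_hypc. Qed.

(* [G] has at most a logarithmic singularity at 1, hence is [O((1-z)^(-1/4))]. *)
Lemma hypG_bound : exists A : R, forall s, 0 < s -> s ^+ 4 <= 1 / 2 ->
  hypG (1 - s ^+ 4) <= A + 4 / s.
Proof.
(* Since [hypG'] is at most $1/(1-z)$, this sum is nonincreasing, so beyond 1/2 [hypG] exceeds a
   constant by at most $-\ln(1-z)$. At $1-z=s^4$ this is $4\ln(1/s)\le4/s$. *)
have dK z : 0 < z < 1 -> isder (fun z => hypG z + ln (1 - z)) z (hypG' z + - (1 - z)^-1).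
  move=> /andP[z0 z1]; apply: derD; first by apply: der_hypG; rewrite gtr0_norm.
  have -> : - (1 - z)^-1 = (1 - z)^-1 * (0 + - 1) by ring.
  apply: (@der_comp R (fun y => 1 - y) (@ln R)); last first.
    by apply: is_derive1_ln; rewrite subr_gt0.
  by apply: derD; [exact: derC|apply: derN; exact: derI].
exists (hypG (1 / 2) + ln (1 - 1 / 2)) => s s0 s1.
have s4 : 0 < s ^+ 4 by rewrite exprn_gt0.
have := @mono_oo _ (fun z => - (hypG z + ln (1 - z))) (fun z => - (hypG' z + - (1 - z)^-1)) 0 1.
move=> /(_ _ _ (1 / 2) (1 - s ^+ 4)) H.
have {H} : - (hypG (1 / 2) + ln (1 - 1 / 2)) <= - (hypG (1 - s ^+ 4) + ln (1 - (1 - s ^+ 4))).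
  apply: H; try lra.
    by move=> x x01; apply: derN; exact: dK.
  by move=> x /andP[x0 x1]; rewrite oppr_ge0 subr_le0; apply: hypG'_le; rewrite ltW.
rewrite lerN2 (_ : 1 - (1 - s ^+ 4) = s ^+ 4); last by ring.
rewrite lnXn// => h.
have : ln (s^-1) <= s^-1 by rewrite ltW// ln_sublinear// invr_gt0.
rewrite lnV ?posrE// => h2; rewrite -[ln s *+ 4]mulr_natl in h; lra.
Qed.

Variable k : R.
Hypothesis k0 : 0 <= k.

Definition zmap (x : R) : R := x * (9 - x) ^+ 2 / (3 + x) ^+ 3.
Definition zmap' (x : R) : R := 27 * (x - 1) * (x - 9) / (3 + x) ^+ 4.
(** The factor [k] stays free because two normalizations occur: $\sqrt3/\pi$ for the density, and 3
    for the generating function of the walks. *)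
Definition hypF (x : R) : R := k / (3 + x) * hypG (zmap x).
Definition hypF' (x : R) : R :=
  k * (zmap' x / (3 + x) * hypG' (zmap x) - hypG (zmap x) / (3 + x) ^+ 2).
Definition zmap_ok (x : R) := 0 <= x /\ zmap x < 1.

(** The argument reaches the singular value 1 only at $x=1$, from below and to second order. *)
Lemma zmap_onem x : 0 <= x -> 1 - zmap x = 27 * (x - 1) ^+ 2 / (3 + x) ^+ 3.
Proof. by move=> x0; rewrite /zmap; field; rewrite gt_eqF// ltr_wpDr. Qed.

Lemma zmap_okP x : 0 <= x -> x != 1 -> zmap_ok x.
Proof.
move=> x0 x1; split => //; rewrite -subr_gt0 zmap_onem//.
have h : 0 < (x - 1) ^+ 2 by rewrite exprn_even_gt0//= subr_eq0.
have h2 : 0 < (3 + x) ^+ 3 by rewrite exprn_gt0// ltr_wpDr.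
by rewrite divr_gt0// mulr_gt0.
Qed.

Lemma zmap_ge0 x : 0 <= x -> 0 <= zmap x.
Proof. by move=> x0; rewrite /zmap divr_ge0 ?(mulr_ge0 x0 (sqr_ge0 _))// exprn_ge0// addr_ge0. Qed.

Lemma zmap_norm x : zmap_ok x -> `|zmap x| < 1.
Proof. by move=> [x0 x1]; rewrite ger0_norm ?zmap_ge0. Qed.

Lemma hypF_ge0 x : zmap_ok x -> 0 <= hypF x.
Proof.
move=> [x0 x1]; rewrite /hypF mulr_ge0 ?divr_ge0 ?addr_ge0//.
by apply: hypG_ge0; rewrite zmap_ge0.
Qed.

Lemma der_zmap x : 0 <= x -> isder zmap x (zmap' x).
Proof.
move=> x0; have x3 : 3 + x != 0 by rewrite gt_eqF// ltr_wpDr.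
by der; [rewrite expf_neq0|rewrite /zmap'; field].
Qed.

Lemma der_hypF x : zmap_ok x -> isder hypF x (hypF' x).
Proof.
move=> ok; have [x0 _] := ok; have x3 : 3 + x != 0 by rewrite gt_eqF// ltr_wpDr.
have dx3 : isder (fun y => 3 + y) x 1 by der; ring.
apply: der_eq.
  apply: derM; first by apply: derM; [exact: derC|apply: derV; [exact: x3|exact: dx3]].
  apply: der_comp; first exact: der_zmap.
  exact: der_hypG (zmap_norm ok).
by rewrite /= /hypF'; field.
Qed.

Definition cubic (x : R) : R := x ^+ 3 - 10 * x ^+ 2 + 9 * x.

Lemma der_cubic x : isder cubic x (3 * x ^+ 2 - 20 * x + 9).
Proof. by der; ring. Qed.

(* The self-adjoint equation [(p F')' + (x - 3) F = 0]. *)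
Lemma hypF_ode x : zmap_ok x ->
  isder (fun y => cubic y * hypF' y) x (- (x - 3) * hypF x).
Proof.
move=> ok; have [x0 _] := ok; have x3 : 3 + x != 0 by rewrite gt_eqF// ltr_wpDr.
have dz := der_zmap x0.
have dG := der_comp dz (der_hypG (zmap_norm ok)).
have dG' := der_comp dz (der_hypG' (zmap_norm ok)).
have dx3 : isder (fun y => 3 + y) x 1 by der; ring.
have dz' : isder zmap' x (27 * (2 * x - 10) / (3 + x) ^+ 4 - 4 * 27 * (x - 1) * (x - 9) / (3 + x) ^+ 5).
  by der; [rewrite expf_neq0|field].
have dp := der_cubic x.
have ode := hypG_ode (zmap_norm ok).
apply: der_eq.
  apply: derM; first exact: dp.
  apply: derM; first exact: derC.
  apply: derD.
    apply: derM; last exact: dG'.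
    by apply: derM; [exact: dz'|apply: derV; [exact: x3|exact: dx3]].
  apply: derN; apply: derM; first exact: dG.
  by apply: derV; [rewrite expf_neq0|apply: derX; exact: dx3].
rewrite /= /hypF' /hypF.
move: ode; set G := hypG _; set G1 := hypG' _; set G2 := hypG'' _ => ode.
have {}ode : zmap x * (1 - zmap x) * G2 = 2 / 9 * G - (1 - 2 * zmap x) * G1.
  by move/eqP: ode; rewrite subr_eq0 => /eqP e; lra.
(* The product of [cubic] and the square of [zmap'] contains $z(1-z)$, the leading coefficient of
   Gauss's equation, so the second derivative of [hypG] can be eliminated. *)
have e2 : cubic x * (zmap' x * (3 + x)^-1 * (G2 * zmap' x)) =
    27 * (x - 1) * (x - 9) / (3 + x) ^+ 3 * (zmap x * (1 - zmap x) * G2).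
  by rewrite zmap_onem// /cubic /zmap' /zmap; field.
transitivity ((3 * x ^+ 2 - 20 * x + 9) * (k * (zmap' x / (3 + x) * G1 - G / (3 + x) ^+ 2))
  + cubic x * k * ((27 * (2 * x - 10) / (3 + x) ^+ 4 - 4 * 27 * (x - 1) * (x - 9) / (3 + x) ^+ 5) / (3 + x) * G1
    - 2 * zmap' x * G1 / (3 + x) ^+ 2 + 2 * G / (3 + x) ^+ 3)
  + k * (cubic x * (zmap' x * (3 + x)^-1 * (G2 * zmap' x)))); first by field.
by rewrite e2 ode /cubic /zmap' /zmap; field.
Qed.

(** Lagrange's boundary form $p\,(x^nF'-(x^n)'F)$ of the self-adjoint operator $Ly=(py')'+(x-3)y$.
    As $LF=0$, its derivative is $-F\,L(x^n)$. *)
Definition momH n (x : R) : R := cubic x * (x ^+ n * hypF' x - n%:R * x ^+ n.-1 * hypF x).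

(** The polynomial $L(x^n)$; its three coefficients are those of the moment recurrence. *)
Definition momL n (x : R) : R :=
  n.+1%:R ^+ 2 * x ^+ n.+1 - (10 * n%:R ^+ 2 + 10 * n%:R + 3) * x ^+ n
  + 9 * n%:R ^+ 2 * x ^+ n.-1.

Lemma der_momH n x : zmap_ok x -> isder (momH n) x (- hypF x * momL n x).
Proof.
move=> ok; have dF := der_hypF ok; have dF' := hypF_ode ok; have dp := der_cubic x.
have -> : momH n = fun y => y ^+ n * (cubic y * hypF' y) - cubic y * (n%:R * y ^+ n.-1) * hypF y.
  by apply/funext => y; rewrite /momH; ring.
apply: der_eq.
  apply: derD; first by apply: derM; [apply: derX; exact: derI|exact: dF'].
  apply: derN; apply: derM; last exact: dF.
  apply: derM; first exact: dp.
  by apply: derM; [exact: derC|apply: derX; exact: derI].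
rewrite /momL /cubic /=; case: n => [|[|n]] /=.
- by rewrite !expr0 !mulr0n; ring.
- by rewrite !expr0 !mulr0n; ring.
- by rewrite !exprS -!(natr1 n.+2) -!(natr1 n.+1) -!(natr1 n); ring.
Qed.

Lemma momH_cvg0 n : momH n x @[x --> 0] --> 0.
Proof.
have ok : zmap_ok 0 by apply: zmap_okP; rewrite // eq_sym oner_neq0.
have e : 0 = momH n 0 by rewrite /momH /cubic; ring.
by rewrite [X in _ --> X]e; exact: (der_cvg (der_momH n ok)).
Qed.

Lemma momH_cvg9 n : momH n x @[x --> (9 : R)] --> 0.
Proof.
have ok : zmap_ok 9 by apply: zmap_okP; rewrite // gt_eqF//; lra.
have e : 0 = momH n 9 by rewrite /momH /cubic; ring.
by rewrite [X in _ --> X]e; exact: (der_cvg (der_momH n ok)).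
Qed.

End HypergeometricFunction.

(** * Moments of the density *)

Section HasInt.
Context {R : realType}.
Local Notation mu := (@lebesgue_measure R).
Implicit Types (D E : set (measurableTypeR R)) (f g : R -> R).

Lemma has_int_ext D f g a : {in D, f =1 g} -> measurable D ->
  has_int D f a -> has_int D g a.
Proof.
move=> fg mD [fi <-]; split.
  by apply: eq_integrable fi => // x Dx /=; rewrite fg.
by apply: eq_Rintegral => x Dx; rewrite fg.
Qed.

Lemma has_intD D f g a b : measurable D -> has_int D f a -> has_int D g b ->
  has_int D (fun x => f x + g x) (a + b).
Proof.
move=> mD [fi <-] [gi <-]; split; last exact: RintegralD.
have -> : EFin \o (fun x => f x + g x) = ((EFin \o f) \+ (EFin \o g))%E by [].
exact: integrableD.
Qed.

Lemma has_intZ D f a c : measurable D -> has_int D f a ->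
  has_int D (fun x => c * f x) (c * a).
Proof.
move=> mD [fi <-]; split; last exact: RintegralZl.
have -> : EFin \o (fun x => c * f x) = (fun x => c%:E * (EFin \o f) x)%E by [].
exact: integrableZl.
Qed.

Lemma has_int_self D f : mu.-integrable D (EFin \o f) -> has_int D f (Rintegral mu D f).
Proof. by []. Qed.

Lemma integrable_setU D E f : measurable D -> measurable E ->
  mu.-integrable D (EFin \o f) -> mu.-integrable E (EFin \o f) ->
  mu.-integrable (D `|` E) (EFin \o f).
Proof.
move=> mD mE /integrableP[mf fi] /integrableP[mg gi].
have mU : measurable_fun (D `|` E) (EFin \o f) by apply/measurable_funU.
apply/integrableP; split => //.
have UE : D `|` E = D `|` (E `\` D).
  apply/seteqP; split => x; last by case; [left|case=> ? _; right].
  by case=> [|Ex]; [left|case: (pselect (D x)) => Dx; [left|right]].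
rewrite UE in mU *; rewrite ge0_integral_setU//; last 3 first.
- exact: measurableD.
- exact: measurableT_comp.
- by apply/disj_set2P; rewrite setDE setICA setICr setI0.
apply: lte_add_pinfty => //; apply: le_lt_trans gi.
apply: ge0_subset_integral => //; first exact: measurableD.
exact: measurableT_comp.
Qed.

Lemma has_int_setU D E f a b : measurable D -> measurable E -> D `&` E = set0 ->
  has_int D f a -> has_int E f b -> has_int (D `|` E) f (a + b).
Proof.
move=> mD mE DE [fi <-] [gi <-].
have fU := integrable_setU mD mE fi gi.
by split => //; apply: Rintegral_setU => //; apply/disj_set2P.
Qed.

Lemma has_int_restrict D f a : measurable D -> has_int D f a ->
  has_int setT (f \_ D) a.
Proof.
move=> mD [fi <-]; split; last by rewrite -Rintegral_mkcond.
rewrite -restrict_EFin; apply/integrable_restrict => //.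
by rewrite setTI.
Qed.

Lemma integrableM_bounded D f g (C : R) : measurable D ->
  mu.-integrable D (EFin \o f) -> measurable_fun D g ->
  (forall x, D x -> `|g x| <= C) ->
  mu.-integrable D (EFin \o (fun x => f x * g x)).
Proof.
move=> mD fi mg gC; have mf : measurable_fun D f by move/measurable_int : fi => /measurable_EFinP.
apply: (@le_integrable _ _ _ mu D mD _ (fun x => C%:E * (f x)%:E)%E).
- by apply/measurable_EFinP; exact: measurable_funM.
- move=> x Dx; rewrite /= lee_fin !normrM mulrC ler_wpM2r//.
  by rewrite (le_trans (gC x Dx))// ler_norm.
- exact: integrableZl.
Qed.

Lemma integrable_le D f g : measurable D -> mu.-integrable D (EFin \o g) ->
  measurable_fun D f -> (forall x, D x -> `|f x| <= g x) ->
  mu.-integrable D (EFin \o f).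
Proof.
move=> mD gi mf fg; apply: (@le_integrable _ _ _ mu D mD _ (EFin \o g)) => //.
- exact/measurable_EFinP.
- by move=> x Dx /=; rewrite lee_fin (le_trans (fg x Dx))// ler_norm.
Qed.

Lemma measurable_oo f (a b : R) : (forall x, a < x < b -> f y @[y --> x] --> f x) ->
  measurable_fun `]a, b[ f.
Proof.
by move=> fc; apply: open_continuous_measurable_fun => // x; rewrite inE/= in_itv/=; exact: fc.
Qed.

Lemma continuous_measurable f : (forall x, f y @[y --> x] --> f x) ->
  measurable_fun setT f.
Proof. by move=> fc; apply: continuous_measurable_fun => x; exact: fc. Qed.

Lemma der_measurable f : (forall x, exists a, isder f x a) -> measurable_fun setT f.
Proof. by move=> h; apply: continuous_measurable => x; have [a /der_cvg] := h x. Qed.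

End HasInt.

Ltac der0 := eexists;
  repeat first [ exact: derC | exact: derI | eassumption
               | apply: derD | apply: derN | apply: derM | apply: derX ].

(** * Boundary limits at the singular points and the moment recurrence *)

Section Moments.
Context {R : realType}.
Local Notation mu := (@lebesgue_measure R).
Variable k : R.
Hypothesis k0 : 0 <= k.

(** Both sides of 1 are folded onto the left of 1, so the one-sided asymptotics of [hypG] and
    [hypG'] become two-sided limits in [x]. This makes the boundary terms from the two sides
    equal. *)
Lemma cvg_zmap_1 : zmap x @[x --> (1 : R)^'] --> (1 : R)^'-.
Proof.
have zc : zmap x @[x --> (1 : R)] --> (1 : R).
  have e : (1 : R) = zmap 1 by rewrite /zmap; field.
  by rewrite [X in _ --> X]e; apply: der_cvg; exact: der_zmap.
move=> A /=; rewrite /at_left /within /= => hA.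
have hz := zc _ hA.
change (\forall x \near (1 : R)^', A (zmap x)).
near=> x.
have x0 : 0 < x by near: x; apply: nbhs_dnbhs; exact: lt_nbhsr.
have [_ z1] : zmap_ok x by apply: zmap_okP; [exact: ltW|]; near: x; exact: nbhs_dnbhs_neq.
have : (fun y : R => y < 1 -> A y) (zmap x) by near: x; apply: nbhs_dnbhs.
by apply.
Unshelve. all: by end_near. Qed.

Lemma cvg_hypG'_zmap :
  (1 - zmap x) * hypG' (zmap x) @[x --> (1 : R)^'] --> (hypc_lim : R).
Proof. exact: (cvg_comp _ _ cvg_zmap_1 cvg_hypG'_1). Qed.

(** With $s$ the fourth root of [1 - zmap x], [hypG_bound] gives $A+4/s$, while $|x-1|$ is only of
    order $s^2$ by the double zero; the product is $O(s)$. *)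
Lemma cvg_hypG_zmap : (x - 1) * hypG (zmap x) @[x --> (1 : R)^'] --> (0 : R).
Proof.
have [A hA] := @hypG_bound R.
pose s x : R := Num.sqrt (Num.sqrt (1 - zmap x)).
have s0 : s x @[x --> (1 : R)^'] --> 0.
  have zc : zmap x @[x --> (1 : R)] --> zmap 1 by apply: der_cvg; exact: der_zmap.
  have e0 : 0 = s 1 by rewrite /s zmap_onem// subrr expr0n /= mulr0 mul0r !sqrtr0.
  apply: cvg_trans; first by apply: cvg_app; exact: nbhs_dnbhs.
  rewrite [X in _ --> X]e0 /s.
  do 2!(apply: (@cvg_comp _ _ _ _ Num.sqrt); last exact: sqrt_continuous).
  by apply: cvgB => //; exact: cvg_cst.
have bnd : 8 * A * s x ^+ 2 + 32 * s x @[x --> (1 : R)^'] --> 0.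
  rewrite [X in _ --> X](_ : _ = 8 * A * (0 * 0) + 32 * 0); last by ring.
  apply: cvgD; last by apply: cvgM => //; exact: cvg_cst.
  by apply: cvgM; [exact: cvg_cst|rewrite /GRing.exp; apply: cvgM].
apply: (@squeeze_cvgr _ _ _ _ (fun x => - (8 * A * s x ^+ 2 + 32 * s x)) (fun x => 8 * A * s x ^+ 2 + 32 * s x)).
- near=> x.
  have x0 : 0 < x by near: x; apply: nbhs_dnbhs; exact: lt_nbhsr.
  have x9 : x < 9 by near: x; apply: nbhs_dnbhs; apply: lt_nbhsl; lra.
  have x1 : x != 1 by near: x; exact: nbhs_dnbhs_neq.
  have [_ z1] : zmap_ok x by apply: zmap_okP => //; exact: ltW.
  have z2 : 1 / 2 <= zmap x.
    near: x; apply: nbhs_dnbhs.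
    have zc : zmap x @[x --> (1 : R)] --> zmap 1 by apply: der_cvg; exact: der_zmap.
    have e : zmap 1 = 1 :> R by rewrite /zmap; field.
    by move/cvgr_ge : zc; apply; rewrite e; lra.
  have u0 : 0 < 1 - zmap x by rewrite subr_gt0.
  have sp : 0 < s x by rewrite !sqrtr_gt0.
  have s4 : s x ^+ 4 = 1 - zmap x.
    by rewrite (exprM _ 2 2) /s !sqr_sqrtr ?sqrtr_ge0// ltW.
  have h := hA (s x) sp.
  have {h}h : hypG (zmap x) <= A + 4 / s x.
    have -> : zmap x = 1 - s x ^+ 4 by rewrite s4; ring.
    by apply: h; rewrite s4; lra.
  have g0 : 0 <= hypG (zmap x) by apply: hypG_ge0; rewrite zmap_ge0 ?(ltW x0).
  (* After squaring, this is $(3+x)^3\le 8^2\cdot27=12^3$, which holds for $x<9$. *)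
  have xs : `|x - 1| <= 8 * s x ^+ 2.
    rewrite -ler_sqr ?nnegrE ?mulr_ge0 ?exprn_ge0 ?(ltW sp)//.
    rewrite real_normK ?num_real// exprMn -exprM s4 zmap_onem ?(ltW x0)//.
    rewrite mulrA ler_pdivlMr ?exprn_gt0 ?ltr_wpDr ?(ltW x0)//.
    rewrite [leRHS](_ : _ = 8 ^+ 2 * 27 * (x - 1) ^+ 2); last by ring.
    rewrite [leLHS]mulrC ler_wpM2r ?sqr_ge0//.
    apply: (@le_trans _ _ (12 ^+ 3)); last lra.
    by rewrite lerXn2r ?nnegrE; lra.
  have : `|(x - 1) * hypG (zmap x)| <= 8 * A * s x ^+ 2 + 32 * s x.
    rewrite normrM (ger0_norm g0).
    apply: (@le_trans _ _ (8 * s x ^+ 2 * (A + 4 / s x))).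
      by apply: ler_pM.
    by rewrite le_eqVlt; apply/orP; left; apply/eqP; field; rewrite gt_eqF.
  by rewrite ler_norml.
- by rewrite -oppr0; apply: cvgN.
- exact: bnd.
Unshelve. all: by end_near. Qed.

Definition lim1 : R := 4 * k * hypc_lim.

(** Near 1 the form is [c1] times $(1-z)G'(z)$ plus [c2] times $(x-1)G(z)$. The second product
    vanishes in the limit, and $c_1(1)=4k$ for every [n]. *)
Lemma momH_cvg1 n : momH k n x @[x --> (1 : R)^'] --> lim1.
Proof.
pose c1 (x : R) := k * (x ^+ n * (x * (9 - x) ^+ 2 * ((3 + x)^-1) ^+ 2)).
pose c2 (x : R) := - (k * ((x ^+ n * (x * (x - 9)) * ((3 + x)^-1) ^+ 2) + n%:R * x ^+ n.-1 * (x * (x - 9)) * (3 + x)^-1)).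
have dV : isder (fun y : R => (3 + y)^-1) 1 (- 1 / (3 + 1) ^+ 2).
  by apply: derV; [rewrite gt_eqF//; lra|der; ring].
have [a ha] : exists a, isder c1 1 a by der0.
have [b hb] : exists a, isder c2 1 a by der0.
have -> : lim1 = c1 1 * hypc_lim + c2 1 * 0.
  by rewrite /lim1 /c1 mulr0 addr0 expr1n; field.
have : c1 x * ((1 - zmap x) * hypG' (zmap x)) + c2 x * ((x - 1) * hypG (zmap x)) @[x --> (1 : R)^'] --> c1 1 * hypc_lim + c2 1 * 0.
  apply: cvgD; apply: cvgM; [|exact: cvg_hypG'_zmap| |exact: cvg_hypG_zmap].
  - by apply: cvg_trans (der_cvg ha); apply: cvg_app; exact: nbhs_dnbhs.
  - by apply: cvg_trans (der_cvg hb); apply: cvg_app; exact: nbhs_dnbhs.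
apply: cvg_trans; apply: near_eq_cvg; near=> x.
have x0 : 0 <= x.
  by apply: ltW; near: x; apply: nbhs_dnbhs; exact: lt_nbhsr.
have x3 : 3 + x != 0 by rewrite gt_eqF// ltr_wpDr.
rewrite zmap_onem// /momH /hypF' /hypF /c1 /c2 /zmap' /cubic; move: (hypG _) (hypG' _) => G G'.
by field.
Unshelve. all: by end_near. Qed.

Let ok01 x : (0 : R) < x < 1 -> zmap_ok x.
Proof. by move=> /andP[x0 x1]; apply: zmap_okP; rewrite ?ltW ?lt_eqF. Qed.

Let ok1 x : (1 : R) < x -> zmap_ok x.
Proof. by move=> x1; apply: zmap_okP; rewrite ?gt_eqF// ltW// (lt_trans ltr01). Qed.

Lemma momL_der n x : exists a, isder (@momL R n) x a.
Proof. by der0. Qed.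

Lemma Lhyp_cvg n x : zmap_ok x -> - hypF k y * momL n y @[y --> x] --> - hypF k x * momL n x.
Proof.
move=> ok; apply: cvgM; first by apply: cvgN; exact: (der_cvg (der_hypF k ok)).
by have [a /der_cvg] := momL_der n x.
Qed.

Let LF0 x : zmap_ok x -> x <= 3 -> 0 <= - hypF k x * momL 0 x.
Proof.
move=> ok x3; have F0 := hypF_ge0 k0 ok.
rewrite (_ : _ * _ = hypF k x * (3 - x)); first by rewrite mulr_ge0// subr_ge0.
by rewrite /momL expr0 mulr0n; ring.
Qed.

Let hypF_le x : zmap_ok x -> x <= 2 -> `|hypF k x| <= - hypF k x * momL 0 x.
Proof.
move=> ok x2; have F0 := hypF_ge0 k0 ok.
rewrite ger0_norm// (_ : _ * _ = hypF k x * (3 - x)).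
  by rewrite ler_peMr//; lra.
by rewrite /momL expr0 mulr0n; ring.
Qed.

(** For $n=0$ the derivative of [momH] is $(3-x)F$, which is nonnegative and dominates $F$ for
    $x\le2$. Its primitive has finite limits at both ends, so [open_FTC_ge0] yields
    integrability. *)
Lemma hypF_integrable01 : mu.-integrable `]0, 1[ (EFin \o hypF k).
Proof.
have [H _] := @open_FTC_ge0 R (momH k 0) (fun x => - hypF k x * momL 0 x) 0 1 0 lim1 ltr01
  (fun x h => der_momH k 0 (ok01 h)) (fun x h => Lhyp_cvg (ok01 h))
  (cvg_at_right_filter (momH_cvg0 k 0)) (cvg_dnbhs_at_left (momH_cvg1 0))
  (fun x h => LF0 (ok01 h) ltac:(by lra)).
apply: (integrable_le _ H) => //.
- by apply: measurable_oo => x h; exact: (der_cvg (der_hypF k (ok01 h))).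
- by move=> x /=; rewrite in_itv/= => h; apply: hypF_le (ok01 h) _; lra.
Qed.

(** The domination by $(3-x)F$ is available only up to 2; on $[2,9]$ the function is continuous. *)
Lemma hypF_integrable19 : mu.-integrable `]1, 9[ (EFin \o hypF k).
Proof.
have H12 : mu.-integrable `]1, 2[ (EFin \o hypF k).
  have h12 : (1 : R) < 2 by lra.
  have ok12 x : (1 : R) < x < 2 -> zmap_ok x by move=> /andP[? _]; exact: ok1.
  have [H _] := @open_FTC_ge0 R (momH k 0) (fun x => - hypF k x * momL 0 x) 1 2 lim1 (momH k 0 2) h12
    (fun x h => der_momH k 0 (ok12 _ h)) (fun x h => Lhyp_cvg (ok12 _ h))
    (cvg_dnbhs_at_right (momH_cvg1 0)) (cvg_at_left_filter (der_cvg (der_momH k 0 (ok1 h12))))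
    (fun x h => LF0 (ok12 _ h) ltac:(by lra)).
  apply: (integrable_le _ H) => //.
  - by apply: measurable_oo => x h; exact: (der_cvg (der_hypF k (ok12 _ h))).
  - by move=> x /=; rewrite in_itv/= => h; apply: hypF_le (ok12 _ h) _; lra.
have H29 : mu.-integrable `[2, 9] (EFin \o hypF k).
  apply: continuous_compact_integrable; first exact: segment_compact.
  apply: continuous_in_subspaceT => x; rewrite inE/= in_itv/= => /andP[x2 x9].
  by apply: (der_cvg (der_hypF k (ok1 _))); lra.
apply: integrableS (integrable_setU _ _ H12 H29) => //.
  by apply: measurableU.
move=> x /=; rewrite !in_itv/= => /andP[x1 x9].
by case: (ltP x 2) => x2; [left|right]; apply/andP; split => //; exact: ltW.
Qed.

Lemma momL_bounded n : exists C, forall x : R, 0 <= x <= 9 -> `|momL n x| <= C.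
Proof.
exists (n.+1%:R ^+ 2 * 9 ^+ n.+1 + (10 * n%:R ^+ 2 + 10 * n%:R + 3) * 9 ^+ n
  + 9 * n%:R ^+ 2 * 9 ^+ n.-1) => x /andP[x0 x9].
have p m : 0 <= x ^+ m <= 9 ^+ m by rewrite exprn_ge0//= lerXn2r// nnegrE.
have c1 : 0 <= n.+1%:R ^+ 2 :> R by rewrite exprn_ge0.
have c2 : 0 <= 10 * n%:R ^+ 2 + 10 * n%:R + 3 :> R by rewrite !addr_ge0 ?mulr_ge0 ?exprn_ge0.
have c3 : 0 <= 9 * n%:R ^+ 2 :> R by rewrite mulr_ge0 ?exprn_ge0.
rewrite /momL (le_trans (ler_normD _ _))// lerD//.
  rewrite (le_trans (ler_normB _ _))// lerD//.
    by have /andP[q0 q9] := p n.+1; rewrite ger0_norm ?mulr_ge0// ler_wpM2l.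
  by have /andP[q0 q9] := p n; rewrite ger0_norm ?mulr_ge0// ler_wpM2l.
by have /andP[q0 q9] := p n.-1; rewrite ger0_norm ?mulr_ge0// ler_wpM2l.
Qed.

Lemma integrable_LhypF (D : set (measurableTypeR R)) n : measurable D -> (forall x, D x -> 0 <= x <= 9) ->
  mu.-integrable D (EFin \o hypF k) ->
  mu.-integrable D (EFin \o (fun x => - hypF k x * momL n x)).
Proof.
move=> mD D9 Fi; have [C hC] := momL_bounded n.
have mL : measurable_fun D (fun x : R => - momL n x).
  apply: measurable_funTS; apply: der_measurable => x.
  by have [a ha] := momL_der n x; der0.
apply: (@eq_integrable _ _ _ mu D mD (EFin \o (fun x => hypF k x * - momL n x))).
  by move=> x _ /=; rewrite mulrN mulNr.
apply: (integrableM_bounded (C := C) mD Fi mL) => x Dx.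
by rewrite normrN; apply: hC; exact: D9.
Qed.

Lemma Lhyp_int01 n : has_int `]0, 1[ (fun x => - hypF k x * momL n x) (lim1 - 0).
Proof.
apply: (@open_FTC_integrable R (momH k n) _ 0 1 _ _ ltr01
  (fun x h => der_momH k n (ok01 h)) (fun x h => Lhyp_cvg (ok01 h))
  (cvg_at_right_filter (momH_cvg0 k n)) (cvg_dnbhs_at_left (momH_cvg1 n))).
apply: integrable_LhypF hypF_integrable01 => //.
by move=> x /=; rewrite in_itv/= => /andP[? ?]; apply/andP; split; lra.
Qed.

Lemma Lhyp_int19 n : has_int `]1, 9[ (fun x => - hypF k x * momL n x) (0 - lim1).
Proof.
have h19 : (1 : R) < 9 by lra.
have ok19 x : (1 : R) < x < 9 -> zmap_ok x by move=> /andP[? _]; exact: ok1.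
apply: (@open_FTC_integrable R (momH k n) _ 1 9 _ _ h19
  (fun x h => der_momH k n (ok19 _ h)) (fun x h => Lhyp_cvg (ok19 _ h))
  (cvg_dnbhs_at_right (momH_cvg1 n)) (cvg_at_left_filter (momH_cvg9 k n))).
apply: integrable_LhypF hypF_integrable19 => //.
by move=> x /=; rewrite in_itv/= => /andP[? ?]; apply/andP; split; lra.
Qed.

Definition hypD : set R := `]0, 1[%classic `|` `]1, 9[%classic.

Lemma measurable_hypD : measurable (hypD : set (measurableTypeR R)).
Proof. exact: measurableU. Qed.

Lemma hypD_ok x : hypD x -> zmap_ok x.
Proof. by case; rewrite /= in_itv/= => h; [exact: ok01|apply: ok1; case/andP: h]. Qed.

Lemma hypD_le x : hypD x -> 0 <= x <= 9.
Proof. by case; rewrite /= in_itv/= => /andP[? ?]; apply/andP; split; lra. Qed.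

(** A real-valued representative on the whole line; it is 0 also at 0, 1 and 9, where it need not
    agree with the closed formula. *)
Definition hypf : R -> R := hypF k \_ hypD.

Lemma hypf_out x : ~ hypD x -> hypf x = 0.
Proof. by move=> Dx; rewrite /hypf patchE memNset. Qed.

Lemma hypf_in x : hypD x -> hypf x = hypF k x.
Proof. by move=> Dx; rewrite /hypf patchE mem_set. Qed.

Lemma hypf_ge0 x : 0 <= hypf x.
Proof.
by rewrite /hypf patchE; case: ifPn => // /set_mem/hypD_ok; exact: hypF_ge0.
Qed.

Lemma hypF_integrableD : mu.-integrable hypD (EFin \o hypF k).
Proof. by apply: integrable_setU => //; [exact: hypF_integrable01|exact: hypF_integrable19]. Qed.

Lemma hypf_integrable : mu.-integrable setT (EFin \o hypf).
Proof.
have [] := has_int_restrict measurable_hypD (has_int_self hypF_integrableD); exact.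
Qed.

Lemma hypfM_integrable (g : R -> R) (C : R) : measurable_fun setT g ->
  (forall x, 0 <= x <= 9 -> `|g x| <= C) ->
  mu.-integrable setT (EFin \o (fun x => hypf x * g x)).
Proof.
move=> mg gC.
have /= := @integrableM_bounded R hypD (hypF k) g C measurable_hypD hypF_integrableD.
move=> /(_ (measurable_funTS mg) (fun x h => gC x (hypD_le h))) h.
have [] := has_int_restrict measurable_hypD (has_int_self h).
move=> h2 _; apply: eq_integrable h2 => // x _ /=.
by rewrite /hypf !patchE; case: ifP; rewrite ?mul0r.
Qed.

Definition mom n : R := Rintegral mu setT (fun x => hypf x * x ^+ n).

Lemma has_int_mom n : has_int setT (fun x => hypf x * x ^+ n) (mom n).
Proof.
apply: has_int_self; apply: (@hypfM_integrable _ (9 ^+ n)); first exact: exprn_measurable.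
move=> x /andP[x0 x9]; by rewrite ger0_norm ?exprn_ge0// lerXn2r ?nnegrE.
Qed.

Lemma mom_rec n : n.+1%:R ^+ 2 * mom n.+1 =
  (10 * n%:R ^+ 2 + 10 * n%:R + 3) * mom n - 9 * n%:R ^+ 2 * mom n.-1.
Proof.
have h1 := has_int_setU (measurable_itv _) (measurable_itv _) _ (Lhyp_int01 n) (Lhyp_int19 n).
have {}h1 := has_int_restrict measurable_hypD (h1 _).
have [_ <-] : has_int setT (fun x => hypf x * x ^+ n.+1) (mom n.+1) := has_int_mom _.
have h2 := has_intD measurableT (has_intD measurableT (has_intZ (n.+1%:R ^+ 2) measurableT (has_int_mom n.+1))
  (has_intZ (- (10 * n%:R ^+ 2 + 10 * n%:R + 3)) measurableT (has_int_mom n)))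
  (has_intZ (9 * n%:R ^+ 2) measurableT (has_int_mom n.-1)).
have : has_int setT (fun x => -1 * (n.+1%:R ^+ 2 * (hypf x * x ^+ n.+1) +
   - (10 * n%:R ^+ 2 + 10 * n%:R + 3) * (hypf x * x ^+ n) + 9 * n%:R ^+ 2 * (hypf x * x ^+ n.-1)))
  (lim1 - 0 + (0 - lim1)).
  apply: has_int_ext (h1 _) => // [x _|].
    rewrite !patchE /hypf patchE; case: ifP => _; last first.
      by rewrite /point /=; ring.
    by rewrite /momL; ring.
  apply/seteqP; split => x //= [].
  rewrite !in_itv/= => /andP[_ a] /andP[b _].
  by move: (lt_trans a b); rewrite ltxx.
move=> [_ e1]; have [_ e2] := has_intZ (-1) measurableT h2.
by move: e1; rewrite e2 -/(mom n.+1) => ?; lra.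
Qed.

End Moments.

(** * The moment recurrence *)

Section ClosedWalkNumbers.
Context {R : realType}.
Implicit Types (p q : {poly R}).

Definition bessc (n : nat) : R := (n`!%:R ^+ 2)^-1.
(** Truncations replace the power series $B$, so the Leibniz computations take place among
    polynomials. Truncation errors are multiples of $X^{N+1}$ and never reach the coefficients in
    use. *)
Definition besspoly (N : nat) : {poly R} := \poly_(i < N.+1) bessc i.
Definition cubec (n : nat) : R := (besspoly n ^+ 3)`_n.
Definition mu_ (n : nat) : R := n`!%:R ^+ 2 * cubec n.

Lemma fact_neq0 n : (n`!%:R : R) != 0.
Proof. by rewrite pnatr_eq0 -lt0n fact_gt0. Qed.

Lemma bessc_ge0 n : 0 <= bessc n.
Proof. by rewrite invr_ge0 exprn_ge0. Qed.

Lemma besscS n : n.+1%:R ^+ 2 * bessc n.+1 = bessc n.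
Proof.
by rewrite /bessc factS natrM exprMn invfM mulrA divff ?mul1r// expf_neq0.
Qed.

Definition theta (p : {poly R}) : {poly R} := 'X * p^`().

Lemma coef_theta p n : (theta p)`_n = n%:R * p`_n.
Proof.
by rewrite /theta coefXM; case: n => [|n] /=; rewrite ?mul0r// coef_deriv mulr_natl.
Qed.

Lemma thetaD p q : theta (p + q) = theta p + theta q.
Proof. by rewrite /theta derivD mulrDr. Qed.

Lemma thetaM p q : theta (p * q) = theta p * q + p * theta q.
Proof. by rewrite /theta derivM; ring. Qed.

Lemma thetaC (c : R) : theta c%:P = 0.
Proof. by rewrite /theta derivC mulr0. Qed.

Lemma thetaX : theta 'X = 'X.
Proof. by rewrite /theta derivX mulr1. Qed.

Lemma thetaXn n : theta 'X^n = n%:R * 'X^n.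
Proof.
rewrite /theta derivXn; case: n => [|n]; first by rewrite mulr0n mulr0 mul0r.
by rewrite exprS -mulr_natl; ring.
Qed.

Lemma thetaN p : theta (- p) = - theta p.
Proof. by rewrite /theta derivN mulrN. Qed.

Lemma theta_besspoly N : theta (theta (besspoly N)) =
  'X * besspoly N - (bessc N)%:P * 'X^(N.+1).
Proof.
apply/polyP => n; rewrite !coef_theta coefB coefXM coefCM coefXn !coef_poly.
case: n => [|n] /=; first by rewrite mul0r mulr0 subrr.
rewrite !ltnS eqSS; case: (ltngtP n N) => nN.
- by rewrite mulr0 subr0 mulrA -expr2 besscS.
- by rewrite !mulr0 subrr.
- by rewrite nN !mulr0 mulr1 subrr.
Qed.

(* [B = sum x^n / n!^2] satisfies [theta^2 B = x B], hence the symmetric cube of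
   this equation annihilates [B^3]. *)
Lemma theta_cube N : exists Q : {poly R}, let w := besspoly N ^+ 3 in
  theta (theta (theta (theta w))) =
  'X * (10 * theta (theta w) + 10 * theta w + 3 * w) - 9 * 'X ^+ 2 * w + 'X^(N.+1) * Q.
Proof.
set B := besspoly N.
have [E hB] : exists E, theta B = E by eexists.
have := theta_besspoly N; rewrite -/B hB.
pose m : {poly R} := 'X^(N.+1).
pose a : {poly R} := (bessc N)%:P; pose T : {poly R} := 'X * B - a * m.
pose U : {poly R} := 'X * B + 'X * E - a * (N.+1%:R * m).
pose V : {poly R} := 'X * B + 'X * E + ('X * E + 'X * T) - a * (N.+1%:R * (N.+1%:R * m)).
rewrite -/m -/a -/T => hE.
have hm : theta m = N.+1%:R * m by exact: thetaXn.
have ha : theta a = 0 by exact: thetaC.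
have hn n : theta n%:R = 0 by rewrite -polyC_natr thetaC.
have hT : theta T = U.
  by rewrite thetaD thetaN !thetaM thetaX hB hm ha mul0r add0r.
have hU : theta U = V.
  by rewrite !thetaD thetaN !thetaM thetaX hB hE hm ha hn !mul0r !add0r.
(* [Q] collects what the defect $-am$ of $\theta^2B=XB$ contributes on both sides, with one factor
   $m=X^{N+1}$ taken out. The term $-30XB^2$ comes from $10X\theta^2(B^3)$. *)
exists (- a * (36 * E ^+ 2 + 36 * 'X * B ^+ 2 - 18 * B * a * m + 24 * N.+1%:R * B * E
  + 3 * 'X * B ^+ 2 + 3 * N.+1%:R ^+ 2 * B ^+ 2 - 30 * 'X * B ^+ 2)) => /=.
have h1 : theta (B ^+ 3) = 3 * B ^+ 2 * E by rewrite !exprS expr0 !thetaM hB -(polyC1 R) thetaC; ring.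
have h2 : theta (3 * B ^+ 2 * E) = 6 * B * E ^+ 2 + 3 * B ^+ 2 * T.
  by rewrite !expr2 !thetaM hB hE hn; ring.
have h3 : theta (6 * B * E ^+ 2 + 3 * B ^+ 2 * T) = 6 * E ^+ 3 + 18 * B * E * T + 3 * B ^+ 2 * U.
  by rewrite thetaD !expr2 !thetaM hB hE hT !hn; ring.
have h4 : theta (6 * E ^+ 3 + 18 * B * E * T + 3 * B ^+ 2 * U) =
   36 * E ^+ 2 * T + 18 * B * T ^+ 2 + 24 * B * E * U + 3 * B ^+ 2 * V.
  by rewrite !thetaD !exprS !expr0 !thetaM hB hE hT hU !hn -(polyC1 R) thetaC; ring.
rewrite h1 h2 h3 h4 /V /U /T -/m; ring.
Qed.

Lemma coef_mul_le (N : nat) p p' q q' : (forall i, (i <= N)%N -> p`_i = p'`_i) ->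
  (forall i, (i <= N)%N -> q`_i = q'`_i) -> forall i, (i <= N)%N -> (p * q)`_i = (p' * q')`_i.
Proof.
move=> hp hq i iN; rewrite !coefM; apply: eq_bigr => j _; congr (_ * _).
  by apply: hp; rewrite (leq_trans _ iN)// -ltnS.
by apply: hq; rewrite (leq_trans _ iN)// leq_subr.
Qed.

Lemma cubecE N n : (n <= N)%N -> (besspoly N ^+ 3)`_n = cubec n.
Proof.
move=> nN; rewrite /cubec !exprS expr0.
have h i : (i <= n)%N -> (besspoly N)`_i = (besspoly n)`_i.
  by move=> i_n; rewrite !coef_poly !ltnS i_n (leq_trans i_n nN).
have hM p q : (forall i, (i <= n)%N -> p`_i = q`_i) ->
    forall i, (i <= n)%N -> (besspoly N * p)`_i = (besspoly n * q)`_i.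
  by move=> pq; exact: coef_mul_le.
by apply: (hM _ _ (hM _ _ (hM _ _ (fun i _ => erefl)))).
Qed.

Lemma cubec_rec n : n.+1%:R ^+ 4 * cubec n.+1 =
  (10 * n%:R ^+ 2 + 10 * n%:R + 3) * cubec n - 9 * (if n is m.+1 then cubec m else 0).
Proof.
(* With truncation degree $n+1$ the remainder starts at $X^{n+2}$, so the coefficient of $X^{n+1}$
   is exact. *)
have [Q /= hQ] := theta_cube n.+1.
have th p : exists2 q, theta p = q & forall i, q`_i = i%:R * p`_i.
  by exists (theta p) => // i; exact: coef_theta.
have [w1 h1 c1] := th (besspoly n.+1 ^+ 3); have [w2 h2 c2] := th w1.
have [w3 h3 c3] := th w2; have [w4 h4 c4] := th w3.
rewrite h1 h2 h3 h4 in hQ.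
have := congr1 (fun p : {poly R} => p`_n.+1) hQ.
have natc (c : nat) p i : (c%:R * p)`_i = c%:R * p`_i by rewrite -polyC_natr coefCM.
rewrite !coefD coefXM coefXnM ltnSn addr0 coefN /= !coefD -mulrA !natc expr2 -mulrA !coefXM /=.
rewrite c4 c3 !c2 !c1 cubecE// (cubecE (leqnSn n)) => e.
transitivity (n.+1%:R * (n.+1%:R * (n.+1%:R * (n.+1%:R * cubec n.+1)))); first by ring.
rewrite e {e h1 h2 h3 h4 hQ}; case: n {Q w1 w2 w3 w4 c1 c2 c3 c4} => [|n] /=; first by rewrite mulr0; ring.
by rewrite (cubecE (leq_trans (leqnSn n) (leqnSn _))); ring.
Qed.

Lemma mu0 : mu_ 0 = 1.
Proof.
rewrite /mu_ /cubec fact0 expr1n mul1r !exprS expr0 mulr1 !coef0M coef_poly /=.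
by rewrite /bessc fact0 expr1n invr1 !mul1r.
Qed.

Lemma mu_rec n : n.+1%:R ^+ 2 * mu_ n.+1 =
  (10 * n%:R ^+ 2 + 10 * n%:R + 3) * mu_ n - 9 * n%:R ^+ 2 * mu_ n.-1.
Proof.
have := cubec_rec n; rewrite /mu_ => e.
transitivity (n`!%:R ^+ 2 * (n.+1%:R ^+ 4 * cubec n.+1)).
  by rewrite factS natrM; ring.
rewrite e; case: n e => [|n] e /=; first by rewrite mulr0n; ring.
by rewrite factS natrM; ring.
Qed.

(** At $n=0$ the coefficient of [u n.-1] vanishes, so this three-term recurrence has a single free
    initial value. *)
Lemma mu_unique (u : nat -> R) : (forall n, n.+1%:R ^+ 2 * u n.+1 =
    (10 * n%:R ^+ 2 + 10 * n%:R + 3) * u n - 9 * n%:R ^+ 2 * u n.-1) ->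
  forall n, u n = u 0%N * mu_ n.
Proof.
move=> hu n; suff : u n = u 0%N * mu_ n /\ u n.+1 = u 0%N * mu_ n.+1 by case.
elim: n => [|n [h1 h2]]; split => //.
- by rewrite mu0 mulr1.
- have := hu 0%N; have := mu_rec 0; rewrite mu0 mulr0n !expr1n !mul1r => -> ->; ring.
- apply: (@mulfI _ (n.+2%:R ^+ 2)); first by rewrite expf_neq0// pnatr_eq0.
  rewrite hu /= h1 h2; transitivity (u 0%N * (n.+2%:R ^+ 2 * mu_ n.+2)); last by ring.
  by rewrite mu_rec /=; ring.
Qed.

Definition walknum (n : nat) : nat :=
  \sum_(u < n.+1) 'C(n, u) ^ 2 * \sum_(v < (n - u).+1) 'C(n - u, v) ^ 2.

Lemma bin_fact_R n u : (u <= n)%N -> ('C(n, u)%:R : R) = n`!%:R / (u`!%:R * (n - u)`!%:R).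
Proof.
move=> un; by rewrite -(bin_fact un) !natrM mulfK// mulf_neq0 ?fact_neq0.
Qed.

Lemma mu_walknum n : mu_ n = (walknum n)%:R.
Proof.
rewrite /mu_ /cubec (_ : besspoly n ^+ 3 = besspoly n * (besspoly n * besspoly n)); last by ring.
rewrite coefM mulr_sumr /walknum natr_sum.
apply: eq_bigr => u _; rewrite coefM natrM natr_sum !mulr_sumr.
have un : (u <= n)%N by rewrite -ltnS.
apply: eq_bigr => v _; have vn : (v <= n - u)%N by rewrite -ltnS.
rewrite !coef_poly !ltnS un (leq_trans vn (leq_subr _ _)).
have l : (n - u - v <= n)%N by rewrite (leq_trans (leq_subr _ _)) ?leq_subr.
rewrite l /bessc !natrX.
rewrite (bin_fact_R un) (bin_fact_R vn).
by field; rewrite !fact_neq0.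
Qed.

End ClosedWalkNumbers.

(** * Normalization *)

Section Normalization.
Context {R : realType}.
Local Notation mu := (@lebesgue_measure R).

Lemma sum_sqr_le (m : nat) (f : nat -> nat) :
  (\sum_(i < m) f i ^ 2 <= (\sum_(i < m) f i) ^ 2)%N.
Proof.
elim: m => [|m IH]; first by rewrite !big_ord0.
rewrite !big_ord_recr /= sqrnD; apply: leq_trans (leq_addr _ _).
by rewrite leq_add2r.
Qed.

(** The trinomial coefficients of order [n] sum to $3^n$; a sum of squares is at most the square of
    the sum, applied to the inner and then to the outer sum. *)
Lemma walknum_le n : (walknum n <= 9 ^ n)%N.
Proof.
have -> : (9 ^ n = (\sum_(u < n.+1) 'C(n, u) * 2 ^ (n - u)) ^ 2)%N.
  rewrite -(expnM 3 2) mulnC expnM; congr (_ ^ 2)%N.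
  by rewrite -[3%N]/(2 + 1)%N expnDn; apply: eq_bigr => i _; rewrite exp1n muln1.
apply: leq_trans (sum_sqr_le n.+1 (fun u => 'C(n, u) * 2 ^ (n - u))%N).
rewrite /walknum; apply: leq_sum => u _; rewrite expnMn leq_mul2l; apply/orP; right.
apply: (leq_trans (sum_sqr_le (n - u).+1 (fun v => 'C(n - u, v)))).
rewrite leq_sqr -[X in (_ <= X ^ _)%N]/(1 + 1)%N expnDn.
by apply: leq_sum => i _; rewrite !exp1n !muln1.
Qed.

Definition muc (n : nat) : R := mu_ n / 9 ^+ n.

Lemma mu_ge0 n : 0 <= mu_ n :> R.
Proof. by rewrite mu_walknum. Qed.

Lemma mu_le n : mu_ n <= 9 ^+ n :> R.
Proof. by rewrite mu_walknum -natrX ler_nat walknum_le. Qed.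

Lemma muc_bounded n : `|muc n| <= 1.
Proof.
rewrite ger0_norm ?divr_ge0 ?mu_ge0 ?exprn_ge0//.
by rewrite ler_pdivrMr ?exprn_gt0// mul1r mu_le.
Qed.

Lemma muc_rec n : 9 * n.+1%:R ^+ 2 * muc n.+1 =
  (10 * n%:R ^+ 2 + 10 * n%:R + 3) * muc n - n%:R ^+ 2 * muc n.-1.
Proof.
have e := @mu_rec R n; rewrite /muc.
have n9 m : (9 : R) ^+ m != 0 by rewrite expf_neq0.
transitivity ((n.+1%:R ^+ 2 * @mu_ R n.+1) / 9 ^+ n); first by rewrite (exprS 9 n); field; rewrite n9.
rewrite e; case: n e => [|n] e /=; first by rewrite mulr0n !expr0; field.
by rewrite (exprS 9 n); field; rewrite n9.
Qed.

Definition muc_conv := conv_in_bounded muc_bounded.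
Definition muc_conv' := conv_in_diffs muc_conv.
Definition muc_conv'' := conv_in_diffs muc_conv'.

Definition phi : R -> R := psum muc.
Definition phi' : R -> R := psum (pseries_diffs muc).

Lemma der_phi x : `|x| < 1 -> isder phi x (phi' x).
Proof. by move=> x1; apply: psum_der x1; exact: muc_conv. Qed.

(** Division by $9^n$ moves the singular points 0, 1/9, 1 of the generating function to 0, 1, 9, and
    the equation becomes the one of [hypF]. Coefficientwise it is [muc_rec]. *)
Lemma phi_ode x : `|x| < 1 -> isder (fun y => cubic y * phi' y) x (- (x - 3) * phi x).
Proof.
move=> x1.
have h0 := conv_inP muc_conv x1.
have h1 := conv_inP muc_conv' x1.
have h2 := conv_inP muc_conv'' x1.
apply: der_eq.
  apply: derM; first exact: der_cubic.
  by apply: psum_der x1; exact: muc_conv'.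
apply/eqP; rewrite -subr_eq0; apply/eqP.
apply: (@pcvg_unique _ (fun=> 0) x); last exact: pcvg0.
apply: pcvg_eq; first (apply: pcvg_ext; last first).
- exact: (pcvgD (pcvgD
   (pcvgD (pcvgD (pcvg_shiftup (pcvg_shiftup (pcvg_shiftup h2))) (pcvgZ (k := -10) (pcvg_shiftup (pcvg_shiftup h2))))
         (pcvgZ (k := 9) (pcvg_shiftup h2)))
   (pcvgD (pcvgD (pcvgZ (k := 3) (pcvg_shiftup (pcvg_shiftup h1))) (pcvgZ (k := -20) (pcvg_shiftup h1)))
     (pcvgZ (k := 9) h1)))
   (pcvgD (pcvg_shiftup h0) (pcvgZ (k := -3) h0))).
- move=> [|[|[|n]]] /=; rewrite /pseries_diffs.
  + by have := muc_rec 0; rewrite mulr0n expr0n/= => e; lra.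
  + by have := muc_rec 1 => e /=; move: e; rewrite /= expr1n; lra.
  + by have := muc_rec 2 => /= e; lra.
  + have := muc_rec n.+3; rewrite /= -!(natr1 n.+3) -!(natr1 n.+2) -!(natr1 n.+1) -!(natr1 n) => e.
    rewrite -[RHS](subrr (9 * (n%:R + 1 + 1 + 1 + 1) ^+ 2 * muc n.+4)) {2}e; ring.
- by rewrite /cubic -/phi -/phi'; ring.
Qed.

Lemma hypG_ge1 z : 0 <= z < 1 -> 1 <= @hypG R z.
Proof.
move=> /andP[z0 z1]; apply: limr_ge.
  by apply: hypc_conv; rewrite ger0_norm.
near=> n; rewrite /pseries /series /=.
have n0 : (0 < n)%N by near: n; exact: nbhs_infty_gt.
rewrite -(prednK n0) big_nat_recl//= hypc0 expr0 mulr1 lerDl.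
by apply: sumr_ge0 => i _; rewrite mulr_ge0 ?hypc_ge0 ?exprn_ge0.
Unshelve. all: by end_near. Qed.

Lemma hypF_gt0 (k x : R) : 0 < k -> zmap_ok x -> 0 < hypF k x.
Proof.
move=> k0 [x0 x1]; rewrite /hypF mulr_gt0//.
  by rewrite divr_gt0// ltr_wpDr.
by rewrite (lt_le_trans ltr01)// hypG_ge1// zmap_ge0.
Qed.

(** The polynomial $p$ times the Wronskian of two solutions is constant, and here it is 0 because
    $p(0)=0$ and both solutions are regular at 0. Hence their quotient is constant; both take the
    value 1 at 0, which explains the factor 3. *)
Lemma phi_hypF x : 0 < x < 1 -> phi x = hypF 3 x /\ phi' x = hypF' 3 x.
Proof.
have ok01 y : 0 <= y < 1 -> zmap_ok (y : R).
  by move=> /andP[y0 y1]; apply: zmap_okP => //; rewrite lt_eqF.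
have n01 y : (0 : R) <= y < 1 -> `|y| < 1 by move=> /andP[? ?]; rewrite ger0_norm.
pose W y := phi y * (cubic y * hypF' 3 y) - (cubic y * phi' y) * hypF 3 y.
have dW y : 0 <= y < 1 -> isder W y 0.
  move=> y01; have o := ok01 _ y01; have n := n01 _ y01.
  apply: der_eq.
    apply: derD; first by apply: derM; [exact: der_phi n|exact: hypF_ode o].
    by apply: derN; apply: derM; [exact: phi_ode n|exact: der_hypF o].
  by rewrite /=; ring.
have h00 : (0 : R) <= (0 : R) < (1 : R) by rewrite (lexx (0 : R)) (@ltr01 R).
have w01 y : (0 : R) < y < 1 -> 0 <= y < 1 by move=> /andP[/ltW -> ->].
have cst (f : R -> R) : (forall y, 0 <= y < 1 -> isder f y 0) -> forall y, 0 < y < 1 -> f y = f 0.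
  move=> df y y01.
  have f0 : f t @[t --> 0^'+] --> f 0 by apply: cvg_at_right_filter; exact: der_cvg (df _ h00).
  have f1 : f t @[t --> 0^'+] --> f y.
    apply: cvg_near_cst; near=> t; apply: (const_oo (a := 0) (b := 1)) => //.
      by move=> u /w01/df.
    by apply/andP; split; near: t; [exact: nbhs_right_gt|exact: nbhs_right_lt].
  exact: (cvg_unique _ f1 f0).
have W0 y : 0 < y < 1 -> W y = 0.
  by move=> y01; rewrite (cst _ dW)// /W /cubic; ring.
have Fp (y : R) : 0 <= y < 1 -> 0 < hypF 3 y by move=> h; exact: (hypF_gt0 _ (ok01 _ h)).
have key y : 0 < y < 1 -> phi y * hypF' 3 y = phi' y * hypF 3 y.
  move=> y01; have := W0 _ y01; rewrite /W => h.
  have c0 : cubic y != 0.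
    rewrite /cubic (_ : _ + _ = y * (y - 1) * (y - 9)); last by ring.
    case/andP: y01 => y0 y1; have y9 : y < 9 by lra.
    by rewrite !mulf_neq0 ?subr_eq0 ?(gt_eqF y0) ?(lt_eqF y1) ?(lt_eqF y9).
  by apply: (mulfI c0); apply/eqP; rewrite -subr_eq0 -[X in _ == X]h; apply/eqP; ring.
pose q y := phi y * (hypF 3 y)^-1.
have dq y : 0 <= y < 1 -> isder q y ((phi' y * hypF 3 y - phi y * hypF' 3 y) / hypF 3 y ^+ 2).
  move=> y01; have f0 := Fp _ y01; apply: der_eq.
    apply: derM; first exact: der_phi (n01 _ y01).
    by apply: derV; [rewrite gt_eqF|exact: der_hypF (ok01 _ y01)].
  by rewrite /=; field; rewrite gt_eqF.
move=> x01.
have q1 : q x = 1.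
  have f0 : q t @[t --> 0^'+] --> q 0 by apply: cvg_at_right_filter; exact: der_cvg (dq _ h00).
  have f1 : q t @[t --> 0^'+] --> q x.
    apply: cvg_near_cst; near=> t; apply: (const_oo (a := 0) (b := 1)) => //.
      by move=> u u01; apply: der_eq (dq _ (w01 _ u01)) _; rewrite key// subrr mul0r.
    by apply/andP; split; near: t; [exact: nbhs_right_gt|exact: nbhs_right_lt].
  rewrite (cvg_unique _ f1 f0)// /q /hypF /zmap mul0r mul0r hypG0 /phi (pcvgP (@pcvg_at0 _ muc)).
  by rewrite /muc mu0 expr0; field.
have xf0 := Fp _ (w01 _ x01).
have e : phi x = hypF 3 x.
  by move: q1; rewrite /q => /(congr1 ( *%R^~ (hypF 3 x))); rewrite divfK ?gt_eqF// mul1r.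
split=> //; have := key _ x01; rewrite e mulrC => /mulIf ->//.
by rewrite gt_eqF.
Unshelve. all: by end_near. Qed.

(** As $p=x(1-x)(9-x)$, this is [momH 3 0] divided by $x(9-x)$, with limit $12/8$ times
    [hypc_lim]. *)
Lemma cvg_phi' : (1 - x) * phi' x @[x --> (1 : R)^'-] --> 3 / 2 * (hypc_lim : R).
Proof.
have c : (x * (9 - x))^-1 @[x --> (1 : R)^'-] --> ((1 * (9 - 1))^-1 : R).
  apply: cvg_at_left_filter; apply: cvgV; first by rewrite mulf_neq0//; lra.
  by apply: cvgM => //; apply: cvgB => //; exact: cvg_cst.
have : (x * (9 - x))^-1 * momH 3 0 x @[x --> (1 : R)^'-] --> 3 / 2 * (hypc_lim : R).
  rewrite (_ : 3 / 2 * hypc_lim = (1 * (9 - 1))^-1 * lim1 3); last by rewrite /lim1; field.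
  by apply: cvgM c _; exact: (cvg_dnbhs_at_left (@momH_cvg1 R 3 0)).
apply: cvg_trans; apply: near_eq_cvg; near=> x.
have x01 : 0 < x < 1.
  by apply/andP; split; near: x; [exact: nbhs_left_gt|exact: nbhs_left_lt].
have [_ ->] := phi_hypF x01.
have /andP[x0 x1] := x01.
rewrite /momH /cubic mulr0n expr0 mul0r mul0r subr0 mul1r; move: (hypF' 3 x) => F.
have x9 : x != 9 by rewrite lt_eqF//; lra.
have d9 : 9 - x != 0 by rewrite subr_eq0 eq_sym.
by field; rewrite ?(gt_eqF x0) ?d9.
Unshelve. all: by end_near. Qed.

Section Total.
Variable k : R.
Hypothesis k0 : 0 < k.

Lemma has_int_pow n : has_int hypD (fun x : R => x ^+ n) (9 ^+ n.+1 / n.+1%:R).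
Proof.
pose H (x : R) := x ^+ n.+1 / n.+1%:R.
have dH x : isder H x (x ^+ n).
  by der; field.
have cH x : H t @[t --> x] --> H x by exact: der_cvg (dH x).
have cf (x : R) : t ^+ n @[t --> x] --> x ^+ n by exact: exprn_continuous.
have -> : 9 ^+ n.+1 / n.+1%:R = (H 1 - H 0) + (H 9 - H 1).
  by rewrite /H expr0n /= mul0r; ring.
apply: has_int_setU => //.
- apply/seteqP; split => x //= [].
  rewrite !in_itv/= => /andP[_ a] /andP[b _].
  by move: (lt_trans a b); rewrite ltxx.
- apply: (open_FTC_ge0 (H := H)) => //.
  + by apply: cvg_at_right_filter.
  + by apply: cvg_at_left_filter.
  + by move=> x /andP[x0 _]; rewrite exprn_ge0// ltW.
- apply: (open_FTC_ge0 (H := H)) => //; first by lra.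
  + by apply: cvg_at_right_filter.
  + by apply: cvg_at_left_filter.
  + by move=> x /andP[x0 _]; rewrite exprn_ge0//; lra.
Qed.

Lemma has_int_momD n : has_int hypD (fun x => hypF k x * x ^+ n) (mom k n).
Proof.
have [fi e] := has_int_mom (ltW k0) n; split.
- apply: (@eq_integrable _ _ _ mu hypD measurable_hypD (EFin \o (fun x => hypf k x * x ^+ n))).
    by move=> x /set_mem xD /=; rewrite hypf_in.
  by apply: integrableS fi => //; exact: measurable_hypD.
- rewrite -e Rintegral_mkcond; apply: eq_Rintegral => x _.
  by rewrite /hypf !patchE; case: ifP; rewrite ?mul0r.
Qed.

Lemma cvg_pow_mul (q : R) : 0 <= q < 1 -> n.+1%:R * q ^+ n @[n --> \oo] --> 0.
Proof.
move=> /andP[q0 q1]; pose s := (q + 1) / 2.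
have s0 : 0 < s by rewrite /s; lra.
have s1 : s < 1 by rewrite /s; lra.
have [M hM] : exists M, forall n, n.+1%:R * s ^+ n <= M.
  by apply: pow_mul_bounded; rewrite (ltW s0).
have r0 : 0 <= q / s by rewrite divr_ge0// ltW.
have c : M * (q / s) ^+ n @[n --> \oo] --> 0.
  rewrite -(mulr0 M); apply: cvgM; first exact: cvg_cst.
  by apply: cvg_expr; rewrite ger0_norm// ltr_pdivrMr// /s; lra.
apply: (@squeeze_cvgr _ _ _ _ (fun=> 0) (fun n => M * (q / s) ^+ n)) => //; last exact: cvg_cst.
apply: nearW => n; rewrite mulr_ge0 ?exprn_ge0//=.
rewrite expr_div_n mulrA ler_pdivlMr ?exprn_gt0//.
by rewrite mulrAC ler_wpM2r ?exprn_ge0.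
Qed.

(** The weight $x^n$ concentrates at 9, where the density is continuous: above [q] it is replaced by
    its value at 9, and below [q] everything is $O(q^n)$, negligible against $9^n/n$. *)
Lemma cvg_mom : n.+1%:R * (mom k n / 9 ^+ n) @[n --> \oo] --> 9 * hypF k 9.
Proof.
have ok9 : zmap_ok (9 : R) by apply: zmap_okP => //; rewrite gt_eqF//; lra.
have F9 := hypF_ge0 (ltW k0) ok9.
have m0 : 0 <= mom k 0.
  by rewrite /mom; apply: Rintegral_ge0 => x _; rewrite expr0 mulr1 hypf_ge0// ltW.
apply/cvgrPdist_le => e e0.
(* The integral of $x^n$ over $[0,9]$, multiplied by $(n+1)/9^n$, is 9; so this error finally counts
   as $e/2$. *)
have e9 : 0 < e / 18 by rewrite divr_gt0.
have /cvgrPdist_le/(_ _ e9) := der_cvg (der_hypF k ok9).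
move=> /nbhs_ballP[d /= d0 hd].
pose q := Num.max (9 - d) 0.
have q0 : 0 <= q by rewrite le_max lexx orbT.
have q9 : q < 9 by rewrite gt_max; apply/andP; split; lra.
have near9 x : q < x -> x < 9 -> `|hypF k x - hypF k 9| <= e / 18.
  move=> qx x9; rewrite distrC; apply: hd; rewrite /ball/= gtr0_norm ?subr_gt0//.
  by move: qx; rewrite gt_max => /andP[? _]; lra.
have bnd n : `|mom k n - hypF k 9 * (9 ^+ n.+1 / n.+1%:R)| <=
    e / 18 * (9 ^+ n.+1 / n.+1%:R) + q ^+ n * (mom k 0 + hypF k 9 * 9).
  have h1 := has_int_momD n.
  have h2 := has_intZ (- hypF k 9) measurable_hypD (has_int_pow n).
  have [i1 e1] := has_intD measurable_hypD h1 h2.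
  have h3 := has_intZ (e / 18) measurable_hypD (has_int_pow n).
  have h4 := has_intZ (q ^+ n) measurable_hypD (has_intD measurable_hypD (has_int_momD 0)
    (has_intZ (hypF k 9) measurable_hypD (has_int_pow 0))).
  have [i2 e2] := has_intD measurable_hypD h3 h4.
  rewrite expr1 divr1 in e2.
  rewrite -mulNr -e1 -e2.
  apply: (le_trans (le_normr_Rintegral measurable_hypD i1)).
  apply: le_Rintegral => //; first exact: measurable_hypD.
    by apply: eq_integrable (integrable_abse i1) => //; exact: measurable_hypD.
  move=> x xD; have ok := hypD_ok xD; have /andP[x0 x9] := hypD_le xD.
  have Fx := hypF_ge0 (ltW k0) ok.
  rewrite -mulrDl normrM (ger0_norm (exprn_ge0 n x0)) !expr0 !mulr1.
  have x9' : x < 9.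
    by case: xD; rewrite /= in_itv/= => /andP[? ?] //; lra.
  have p0 : 0 <= x ^+ n by rewrite exprn_ge0.
  have pq : 0 <= q ^+ n by rewrite exprn_ge0.
  case: (ltP q x) => qx.
    rewrite (le_trans (ler_wpM2r p0 (near9 x qx x9')))// lerDl mulr_ge0// addr_ge0//.
  apply: (@le_trans _ _ ((hypF k x + hypF k 9) * q ^+ n)).
    apply: ler_pM => //.
      by rewrite (le_trans (ler_normB _ _))// !ger0_norm.
    by rewrite lerXn2r ?nnegrE.
  by rewrite mulrC lerDr mulr_ge0// ltW.
have c : (n.+1%:R * (q / 9) ^+ n) * (mom k 0 + hypF k 9 * 9) @[n --> \oo] --> 0.
  rewrite -(mul0r (mom k 0 + hypF k 9 * 9)); apply: cvgM; last exact: cvg_cst.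
  by apply: cvg_pow_mul; rewrite divr_ge0//= ltr_pdivrMr// mul1r.
have e2 : 0 < e / 2 by rewrite divr_gt0.
move/cvgrPdist_le : c => /(_ _ e2); apply: filterS => n.
rewrite sub0r normrN => hn.
have p9 : 0 < n.+1%:R / 9 ^+ n :> R by rewrite divr_gt0 ?exprn_gt0.
have n0 : n.+1%:R != 0 :> R by rewrite pnatr_eq0.
have n9 : 9 ^+ n != 0 :> R by rewrite expf_neq0.
rewrite distrC (_ : _ - _ = (n.+1%:R / 9 ^+ n) * (mom k n - hypF k 9 * (9 ^+ n.+1 / n.+1%:R))); last first.
  by rewrite exprS; move: n9 n0; move: (9 ^+ n : R) (n.+1%:R : R) => a b a0 b0; field; rewrite ?a0 ?b0.
rewrite normrM (gtr0_norm p9).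
apply: (le_trans (ler_wpM2l (ltW p9) (bnd n))).
rewrite mulrDr (_ : _ * (e / 18 * _) = e / 2); last by rewrite exprS; move: n9 n0; move: (9 ^+ n : R) (n.+1%:R : R) => a b a0 b0; field; rewrite ?a0 ?b0.
rewrite (_ : _ * (q ^+ n * _) = n.+1%:R * (q / 9) ^+ n * (mom k 0 + hypF k 9 * 9)); last first.
  by rewrite expr_div_n; field.
have := le_trans (ler_norm _) hn; lra.
Qed.

Lemma mom_mu n : mom k n = mom k 0 * mu_ n.
Proof. by apply: mu_unique => m; exact: mom_rec (ltW k0) m. Qed.

(** The limit of $(n+1)\mu_n/9^n$ is computed twice: as $9F(9)$ divided by the total mass, and, by
    Abel's theorem, as the limit of $(1-x)\varphi'(x)$. *)
Lemma mom0E : mom k 0 = k / (2 * hypc_lim).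
Proof.
have ok9 : zmap_ok (9 : R) by apply: zmap_okP => //; rewrite gt_eqF//; lra.
have F9 : hypF k 9 = k / 12.
  by rewrite /hypF (_ : zmap 9 = 0) ?hypG0 /zmap; field.
have cp : 0 < hypc_lim :> R by rewrite /hypc_lim mulr_gt0 ?sqrtr_gt0// invr_gt0 mulr_gt0 ?pi_gt0.
have cm := cvg_mom.
(* If the total mass were 0, all moments would vanish, against the positive limit in [cvg_mom]. *)
have M0 : mom k 0 != 0.
  apply/eqP => M0; move: cm; under eq_fun do rewrite mom_mu M0 !mul0r mulr0.
  have c0 : (fun=> 0) @ \oo --> (0 : R) by exact: cvg_cst.
  move=> h; have e0 : (0 : R) = 9 * hypF k 9 by exact: (cvg_unique _ c0 h).
  by move: e0 k0; rewrite F9; lra.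
pose L := 9 * hypF k 9 / mom k 0.
have cb : n.+1%:R * muc n @[n --> \oo] --> L.
  have : n.+1%:R * (mom k n / 9 ^+ n) * (mom k 0)^-1 @[n --> \oo] --> L.
    by apply: cvgM cm _; exact: cvg_cst.
  apply: cvg_trans; apply: near_eq_cvg; apply: nearW => n.
  by rewrite mom_mu /muc; field; rewrite M0 expf_neq0.
have cb' : pseries_diffs muc n @[n --> \oo] --> L.
  (* The differentiated series has coefficients $(n+1)c_{n+1}$ instead of $(n+2)c_{n+1}$; the last
     factor is $(n+1)/(n+2)$. *)
  have c2 : n.+2%:R * muc n.+1 * (1 - (harmonic n.+1 : R)) @[n --> \oo] --> L * (1 - 0).
    apply: cvgM; first by rewrite (cvg_shiftS (fun n => n.+1%:R * muc n)).
    apply: cvgB; first exact: cvg_cst.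
    by rewrite (cvg_shiftS (harmonic : nat -> R)); exact: cvg_harmonic.
  rewrite subr0 mulr1 in c2; apply: cvg_trans c2; apply: near_eq_cvg; apply: nearW => n.
  rewrite /pseries_diffs /harmonic /= -(natr1 n.+1); field.
  by rewrite ?natr1 ?nat1r ?pnatr_eq0.
have e : L = 3 / 2 * hypc_lim by exact: (cvg_unique _ (abel_limit cb') cvg_phi').
move: e; rewrite /L F9 => e.
have c0 : 2 * hypc_lim != 0 :> R by rewrite gt_eqF// mulr_gt0.
apply: (mulIf c0); rewrite (divfK c0).
have : 9 * (k / 12) / mom k 0 * mom k 0 = 3 / 2 * hypc_lim * mom k 0 by rewrite e.
rewrite mulfVK//; lra.
Qed.

End Total.

Definition kap : R := Num.sqrt 3 / pi.

Lemma kap_gt0 : 0 < kap.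
Proof. by rewrite /kap divr_gt0 ?sqrtr_gt0 ?pi_gt0. Qed.

Lemma mom_kap n : mom kap n = mu_ n.
Proof.
rewrite (mom_mu kap_gt0) (mom0E kap_gt0) (_ : kap / _ = 1) ?mul1r//.
have s0 : Num.sqrt 3 != 0 :> R by rewrite gt_eqF// sqrtr_gt0.
rewrite /kap /hypc_lim; move: (@pi_gt0 R); move: (pi : R) => p p0.
by field; rewrite s0 gt_eqF.
Qed.

End Normalization.

(** * Determinacy of the moment problem *)

Section MomentProblem.
Context {R : realType}.
Local Notation mu := (@lebesgue_measure R).

Lemma bernoulli_ge (a : R) m : 0 <= a <= 1 -> 1 - m%:R * a <= (1 - a) ^+ m.
Proof.
move=> /andP[a0 a1]; elim: m => [|m IH]; first by rewrite mul0r subr0 expr0.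
rewrite exprS; apply: (@le_trans _ _ ((1 - a) * (1 - m%:R * a))).
  rewrite -(natr1 m) -subr_ge0 (_ : _ - _ = m%:R * a ^+ 2); last by ring.
  by rewrite mulr_ge0 ?sqr_ge0.
by rewrite ler_wpM2l// subr_ge0.
Qed.

Lemma bernoulli_le (a : R) m : 0 <= a <= 1 -> (1 - a) ^+ m <= (1 + m%:R * a)^-1.
Proof.
move=> /andP[a0 a1].
have h : 1 + m%:R * a <= (1 + a) ^+ m.
  elim: m => [|m IH]; first by rewrite mul0r addr0 expr0.
  rewrite exprS; apply: (@le_trans _ _ ((1 + a) * (1 + m%:R * a))).
    rewrite -(natr1 m) -subr_ge0 (_ : _ - _ = m%:R * a ^+ 2); last by ring.
    by rewrite mulr_ge0 ?sqr_ge0.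
  by rewrite ler_wpM2l// addr_ge0.
have p : 0 < 1 + m%:R * a by rewrite ltr_pwDl// mulr_ge0.
rewrite -[(_ + _)^-1]mul1r ler_pdivlMr//.
apply: (@le_trans _ _ ((1 - a) ^+ m * (1 + a) ^+ m)).
  by rewrite ler_wpM2l// exprn_ge0// subr_ge0.
rewrite -exprMn (_ : _ * _ = 1 - a ^+ 2); last by ring.
rewrite exprn_ile1//; last by rewrite gerBl sqr_ge0.
by rewrite subr_ge0 exprn_ile1.
Qed.

(* The proof of the Weierstrass theorem by Brosowski and Deutsch: these
   polynomials converge on [0, 1] to the indicator of [0, 1/2). *)
Definition steppow (u : R) (n : nat) : R := (1 - u ^+ n) ^+ (n.+1 * 2 ^ n).

Lemma steppow_01 u n : 0 <= u <= 1 -> 0 <= steppow u n <= 1.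
Proof.
move=> /andP[u0 u1]; have h : 0 <= u ^+ n <= 1 by rewrite exprn_ge0// exprn_ile1.
rewrite /steppow; have /andP[? ?] : 0 <= 1 - u ^+ n <= 1 by apply/andP; split; lra.
by rewrite exprn_ge0// exprn_ile1.
Qed.

(** The two Bernoulli bounds compare with $(n+1)(2u)^n$, which tends to 0 for $u<1/2$ and is at
    least $n+1$ otherwise. The factor $n+1$ in the exponent decides the case $u=1/2$, so atoms at
    the threshold are treated correctly. *)
Lemma cvg_steppow u : 0 <= u <= 1 ->
  steppow u n @[n --> \oo] --> (if u < 1 / 2 then 1 else 0 : R).
Proof.
move=> u01; have /andP[u0 u1] := u01.
have p01 n : 0 <= u ^+ n <= 1 by rewrite exprn_ge0// exprn_ile1.
case: ifPn => [u2|]; last rewrite -leNgt => u2.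
- apply: (@squeeze_cvgr _ _ _ _ (fun n => 1 - n.+1%:R * (2 * u) ^+ n) (fun=> 1)); last exact: cvg_cst.
    apply: nearW => n; have /andP[_ ->] := steppow_01 n u01; rewrite andbT.
    apply: le_trans (bernoulli_ge _ (p01 n)).
    by rewrite natrM natrX exprMn mulrA.
  rewrite -[X in _ --> X]subr0; apply: cvgB; first exact: cvg_cst.
  by apply: cvg_pow_mul; apply/andP; split; lra.
- apply: (@squeeze_cvgr _ _ _ _ (fun=> 0) (harmonic : nat -> R)); [|exact: cvg_cst|exact: cvg_harmonic].
  apply: nearW => n; have /andP[-> _] := steppow_01 n u01; rewrite /=.
  apply: (le_trans (bernoulli_le _ (p01 n))).
  rewrite lef_pV2 ?posrE//; last by rewrite ltr_pwDl// mulr_ge0// exprn_ge0.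
  rewrite natrM natrX -mulrA -exprMn (@le_trans _ _ (n.+1%:R * 1))//; first by rewrite mulr1.
  rewrite (le_trans _ (_ : n.+1%:R * (2 * u) ^+ n <= _)) ?ler_wpDl//.
  by rewrite ler_wpM2l// exprn_ege1//; lra.
Qed.

Section Uniqueness.
Variables (rho : probability (measurableTypeR R) R) (f : R -> R) (L : R).
Hypothesis f0 : forall x, 0 <= f x.
Hypothesis fi : mu.-integrable setT (EFin \o f).
Hypothesis fL : forall x, L < `|x| -> f x = 0.
Hypothesis rhoL : rho (~` `[- L, L]%classic) = 0%E.
Hypothesis moments : forall n, (\int[rho]_x (x ^+ n)%:E = \int[mu]_x (f x * x ^+ n)%:E)%E.

Let D : set (measurableTypeR R) := `[- L, L]%classic.
Let mD : measurable D. Proof. exact: measurable_itv. Qed.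

Let inD x : D x -> `|x| <= L.
Proof. by rewrite /D /= in_itv/= ler_norml. Qed.

Let mf : measurable_fun setT f.
Proof. by move/measurable_int : fi => /measurable_EFinP. Qed.

Let rho_D (g : R -> R) : measurable_fun setT g ->
  (\int[rho]_x (g x)%:E = \int[rho]_(x in D) (g x)%:E)%E.
Proof.
move=> mg; rewrite -(setUv D) integral_setU//.
- rewrite [X in (_ + X)%E]null_set_integral ?adde0//; first exact: measurableC.
  by apply/measurable_EFinP; exact: measurable_funTS.
- exact: measurableC.
- by rewrite setUv; exact/measurable_EFinP.
- by apply/disj_set2P; rewrite setICr.
Qed.

Let bounded_int (g : R -> R) (C : R) : measurable_fun setT g ->
  (forall x, D x -> `|g x| <= C) -> rho.-integrable D (EFin \o g).
Proof.
move=> mg gC; apply: measurable_bounded_integrable => //.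
- by rewrite (le_lt_trans (probability_le1 rho mD))// ltry.
- exact: measurable_funTS.
- exists C; split; first exact: num_real.
  by move=> y Cy x Dx /=; exact: le_trans (gC x Dx) (ltW Cy).
Qed.

Let fg_int (g : R -> R) (C : R) : measurable_fun setT g ->
  (forall x, D x -> `|g x| <= C) -> mu.-integrable setT (EFin \o (fun x => f x * g x)).
Proof.
move=> mg gC.
apply: (@integrable_le _ setT _ (fun x => C * f x)) => //.
- by have [] := has_intZ C measurableT (has_int_self fi).
- exact: measurable_funM.
- move=> x _; rewrite normrM (ger0_norm (f0 x)).
  have [xL|xL] := leP `|x| L; last by rewrite fL// mul0r mulr0.
  by rewrite mulrC ler_wpM2r// gC// /D /= in_itv/= -ler_norml.
Qed.

Let pow_le n x : D x -> `|x ^+ n| <= L ^+ n.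
Proof.
move=> /inD xL; rewrite normrX lerXn2r ?nnegrE//.
exact: le_trans (normr_ge0 _) xL.
Qed.

Let mpow n : measurable_fun setT (fun x : R => x ^+ n).
Proof. by apply: continuous_measurable => x; exact: exprn_continuous. Qed.

Let mhorner (p : {poly R}) : measurable_fun setT (fun x : R => p.[x]).
Proof. by apply: continuous_measurable => x; exact: continuous_horner. Qed.

Let poly_bound (p : {poly R}) : exists C, forall x, D x -> `|p.[x]| <= C.
Proof.
exists (\sum_(i < size p) `|p`_i| * L ^+ i) => x Dx; rewrite horner_coef.
apply: (le_trans (ler_norm_sum _ _ _)); apply: ler_sum => i _.
by rewrite normrM ler_wpM2l// pow_le.
Qed.

Let poly_moments (p : {poly R}) :
  (\int[rho]_(x in D) (p.[x])%:E = \int[mu]_x (f x * p.[x])%:E)%E.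
Proof.
under eq_integral do rewrite horner_coef -sumEFin.
rewrite integral_sum//; last first.
  move=> i; have := @bounded_int (fun x => p`_i * x ^+ i) (`|p`_i| * L ^+ i).
  apply; first by apply: measurable_funM => //; exact: mpow.
  by move=> x Dx; rewrite normrM ler_wpM2l// pow_le.
under [RHS]eq_integral do rewrite horner_coef mulr_sumr -sumEFin.
rewrite [RHS]integral_sum//; last first.
  move=> i; have := @fg_int (fun x => p`_i * x ^+ i) (`|p`_i| * L ^+ i).
  apply; first by apply: measurable_funM => //; exact: mpow.
  by move=> x Dx; rewrite normrM ler_wpM2l// pow_le.
apply: eq_bigr => i _.
under eq_integral do rewrite EFinM.
rewrite integralZl//; last by apply: (bounded_int (C := L ^+ i)); [exact: mpow|exact: pow_le].
under [RHS]eq_integral do rewrite mulrCA EFinM.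
rewrite [RHS]integralZl//; last by apply: (fg_int (C := L ^+ i)); [exact: mpow|exact: pow_le].
by rewrite -moments rho_D.
Qed.

Lemma moments_ray (c : R) : rho `]-oo, c[%classic = (\int[mu]_(x in `]-oo, c[) (f x)%:E)%E.
Proof.
have [L0|L0] := ltP L 0.
  have : rho setT = 0%E.
    rewrite -rhoL; congr (rho _); apply/seteqP; split => // x _ /=.
    by rewrite in_itv/= => /andP[? ?]; lra.
  by rewrite probability_setT => /eqP; rewrite onee_eq0.
(* On $[-L,L]$ one has $|x-c|\le M$, so the affine map [u] takes values in $[1/4,3/4]$ and sends [c]
   to the threshold 1/2. *)
pose M := L + `|c| + 1.
have M0 : 0 < M by rewrite /M ltr_wpDl// addr_ge0.
pose u (x : R) : R := 1 / 2 + (x - c) / (4 * M).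
pose up : {poly R} := (1 / 2 - c / (4 * M))%:P + (1 / (4 * M))%:P * 'X.
pose P n : {poly R} := (1 - up ^+ n) ^+ (n.+1 * 2 ^ n).
have PE n x : (P n).[x] = steppow (u x) n.
  rewrite /P /up /steppow /u !(horner_exp, hornerE); congr ((1 - _ ^+ _) ^+ _).
  by field; rewrite gt_eqF.
have uD x : D x -> 0 <= u x <= 1.
  move=> /inD xL; have h : `|(x - c) / (4 * M)| <= 1 / 4.
    rewrite normrM normfV (gtr0_norm (_ : 0 < 4 * M)) ?mulr_gt0// ler_pdivrMr ?mulr_gt0//.
    by have := ler_normB x c; rewrite /M; lra.
  by move: h; rewrite ler_norml /u => /andP[? ?]; apply/andP; split; lra.
have uc x : (u x < 1 / 2) = (x < c).
  by rewrite /u gtrDl pmulr_llt0 ?subr_lt0// invr_gt0 mulr_gt0.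
have PD n x : D x -> `|(P n).[x]| <= 1.
  by move=> /uD h; rewrite PE; have /andP[? ?] := steppow_01 n h; rewrite ger0_norm.
have Pc x : D x -> (P n).[x] @[n --> \oo] --> (if x < c then 1 else 0 : R).
  by move=> /uD h; under eq_fun do rewrite PE; rewrite -uc; exact: cvg_steppow.
pose g (x : R) : R := if x < c then 1 else 0.
have gE : g = \1_(`]-oo, c[%classic).
  by apply/funext => x; rewrite /g indicE mem_setE in_itv/=; case: ifP.
have mg : measurable_fun setT g by rewrite gE; exact: measurable_indic.
have h1 : (\int[rho]_(x in D) ((P n).[x])%:E @[n --> \oo] --> \int[rho]_(x in D) (g x)%:E)%E.
  have [] := @dominated_convergence _ _ _ rho D mD (fun n x => ((P n).[x])%:E) (EFin \o g) (cst 1%E).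
  - by move=> n; apply/measurable_EFinP; apply: measurable_funTS; exact: mhorner.
  - by apply/measurable_EFinP; apply: measurable_funTS; exact: mg.
  - by apply: aeW => x Dx; apply: cvg_EFin (Pc x Dx); exact: nearW.
  - by apply: (bounded_int (g := cst 1) (C := 1)) => // x _; rewrite /= normr1.
  - by apply: aeW => x n Dx; rewrite /= lee_fin; exact: PD.
  - by [].
have h2 : (\int[mu]_x (f x * (P n).[x])%:E @[n --> \oo] --> \int[mu]_x (f x * g x)%:E)%E.
  have fD x : ~ D x -> f x = 0.
    by move=> Dx; apply: fL; rewrite ltNge; apply/negP => xL; apply: Dx; rewrite /D /= in_itv/= -ler_norml.
  have [] := @dominated_convergence _ _ _ mu setT measurableT (fun n x => (f x * (P n).[x])%:E)
    (fun x => (f x * g x)%:E) (EFin \o f).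
  - by move=> n; apply/measurable_EFinP; apply: measurable_funM; [exact: mf|exact: mhorner].
  - by apply/measurable_EFinP; apply: measurable_funM; [exact: mf|exact: mg].
  - apply: aeW => x _; apply: cvg_EFin; first exact: nearW.
    case: (pselect (D x)) => Dx; first by apply: cvgM; [exact: cvg_cst|exact: Pc].
    by rewrite fD// mul0r; under eq_fun do rewrite mul0r; exact: cvg_cst.
  - exact: fi.
  - apply: aeW => x n _; rewrite /= lee_fin normrM (ger0_norm (f0 x)).
    case: (pselect (D x)) => Dx; last by rewrite fD// mul0r.
    by rewrite ler_piMr// PD.
  - by [].
have e : (\int[rho]_(x in D) (g x)%:E = \int[mu]_x (f x * g x)%:E)%E.
  have h3 : (\int[rho]_(x in D) ((P n).[x])%:E @[n --> \oo] --> \int[mu]_x (f x * g x)%:E)%E.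
    by under eq_fun do rewrite poly_moments; exact: h2.
  exact: (cvg_unique (@ereal_hausdorff R) h1 h3).
have e1 : (\int[rho]_(x in D) (g x)%:E = rho `]-oo, c[%classic)%E.
  rewrite -rho_D// gE integral_indic ?setIT//.
rewrite -e1 e [RHS]integral_mkcond; apply: eq_integral => x _.
rewrite patchE gE indicE; case: ifP => _; first by rewrite mulr1.
by rewrite mulr0.
Qed.

Lemma moments_density (A : set (measurableTypeR R)) : measurable A ->
  rho A = (\int[mu]_(x in A) (f x)%:E)%E.
Proof.
have mfE B : measurable_fun B (EFin \o f) by apply/measurable_EFinP; exact: measurable_funTS.
have int1 : (\int[mu]_x (f x)%:E = 1)%E.
  have := moments 0; under eq_integral do rewrite expr0.
  rewrite integral_cst// mul1e => e.
  apply: etrans (etrans (esym e) (probability_setT rho)).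
  by apply: eq_integral => x _; rewrite expr0 mulr1.
have f0E B : (0 <= \int[mu]_(x in B) (f x)%:E)%E.
  by apply: integral_ge0 => x _; rewrite lee_fin.
move=> mA; suff H S : <<s @RGenInftyO.G R >> S -> rho S = (\int[mu]_(x in S) (f x)%:E)%E.
  have : (@RGenInftyO.G R).-sigma.-measurable A by rewrite -RGenInftyO.measurableE.
  exact: H.
move: S; apply: (@dynkin_induction _ (measurableTypeR R) (@RGenInftyO.G R)
  (fun S => rho S = (\int[mu]_(x in S) (f x)%:E)%E)).
- exact: RGenInftyO.measurableE.
- move=> _ _ [x ->] [y ->]; exists (Num.min x y).
  by apply/seteqP; split => z /=; rewrite !in_itv/= lt_min => /andP.
- by rewrite probability_setT int1.
- by move=> _ [x ->]; exact: moments_ray.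
- move=> S mS e.
  have fin : (\int[mu]_(x in S) (f x)%:E < +oo)%E.
    by rewrite -e (le_lt_trans (probability_le1 rho mS))// ltry.
  rewrite probability_setC// e -int1 -(setUv S) ge0_integral_setU//.
  + by rewrite addeAC subee ?add0e// ge0_fin_numE.
  + exact: measurableC.
  + exact: mfE.
  + by move=> x _; rewrite lee_fin.
  + by apply/disj_set2P; rewrite setICr.
- move=> F mF tF e.
  have h : (\int[mu]_(x in \bigcup_k F k) (f x)%:E = \sum_(k <oo) \int[mu]_(x in F k) (f x)%:E)%E.
    apply: (@ge0_integral_bigcup _ (measurableTypeR R) R mu F (fun x => (f x)%:E) mF (mfE _) _ tF).
    by move=> x _; rewrite lee_fin.
  apply: etrans (esym h); rewrite (@measure_semi_bigcup _ _ _ rho F mF tF); last exact: bigcupT_measurable.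
  by apply: eq_eseriesr => n _; exact: e.
Qed.

End Uniqueness.
End MomentProblem.

(** * The hexagonal density *)

Section SquareSubstitution.
Context {R : realType}.
Local Notation mu := (@lebesgue_measure R).
Variables (a b m : R) (g : R -> R).
Hypotheses (a0 : 0 <= a) (ab : a < b).
Hypothesis g0 : forall x, a ^+ 2 < x < b ^+ 2 -> 0 <= g x.
Hypothesis gc : forall x, a ^+ 2 < x < b ^+ 2 -> g y @[y --> x] --> g x.
Hypothesis gm : has_int `]a ^+ 2, b ^+ 2[ g m.

(** The substitution goes through a primitive: [Phi (s ^+ 2)] has derivative $2s\,g(s^2)$ and limits
    0 and [m] at the ends. Thus [open_FTC_ge0] applies although [g] may be unbounded there, and
    gives integrability as well. *)
Let Phi x : R := Rintegral mu `]a ^+ 2, x] g.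

Let gi : mu.-integrable `]a ^+ 2, b ^+ 2[ (EFin \o g) := gm.1.

Let ab2 : a ^+ 2 < b ^+ 2.
Proof. by rewrite ltrXn2r ?nnegrE// (le_trans a0)// ltW. Qed.

Let dPhi x : a ^+ 2 < x < b ^+ 2 -> isder Phi x (g x).
Proof.
move=> axb; have /andP[ax xb] := axb.
have [] := @continuous_FTC1 R g (BRight (a ^+ 2)) x ((x + b ^+ 2) / 2) _ _ _ (gc axb).
- lra.
- apply: integrableS gi => // y /=; rewrite !in_itv/= => /andP[-> yx] /=.
  by apply: le_lt_trans yx _; lra.
- by rewrite ?bnd_simp ?lte_fin ?ax.
- by move=> d e; apply: DeriveDef => //; rewrite -derive1E.
Qed.

Let Phi_b : Phi x @[x --> (b ^+ 2)^'-] --> m.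
Proof.
apply/cvg_at_leftP => u [ub ucv].
have := @cvg_integral_increasing_integrable _ _ _ mu `]a ^+ 2, b ^+ 2[
   (fun n => `]a ^+ 2, u n]%classic) (EFin \o g) (measurable_itv _) (fun n => measurable_itv _).
move=> /(_ _ _ _ gi) h; rewrite -gm.2 /Rintegral.
apply: fine_cvg; rewrite fineK; last exact: integrable_fin_num gi.
apply: h.
- move=> n x /=; rewrite !in_itv/= => /andP[-> xu] /=; exact: le_lt_trans xu (ub n).
- move=> x; rewrite /= in_itv/= => /andP[ax xb].
  move/cvgr_ge : ucv => /(_ _ xb); apply: filterS => n xu.
  by rewrite /= in_itv/= ax xu.
- exact: measurable_int gi.
Qed.

Let Phi_a : Phi x @[x --> (a ^+ 2)^'+] --> 0.
Proof.
apply/cvg_at_rightP => u [ua ucv].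
have h : Rintegral mu `]u n, b ^+ 2[ g @[n --> \oo] --> m.
  have := @cvg_integral_increasing_integrable _ _ _ mu `]a ^+ 2, b ^+ 2[
     (fun n => `]u n, b ^+ 2[%classic) (EFin \o g) (measurable_itv _) (fun n => measurable_itv _).
  move=> /(_ _ _ _ gi) h; rewrite -gm.2 /Rintegral.
  apply: fine_cvg; rewrite fineK; last exact: integrable_fin_num gi.
  apply: h.
  - move=> n x /=; rewrite !in_itv/= => /andP[ux ->]; rewrite andbT; exact: lt_trans (ua n) ux.
  - move=> x; rewrite /= in_itv/= => /andP[ax xb].
    move/cvgr_lt : ucv => /(_ _ ax); apply: filterS => n xu.
    by rewrite /= in_itv/= xu.
  - exact: measurable_int gi.
have {}h : m - Rintegral mu `]u n, b ^+ 2[ g @[n --> \oo] --> 0.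
  by rewrite -(subrr m); apply: cvgB => //; exact: cvg_cst.
apply: cvg_trans h; apply: near_eq_cvg.
move/cvgr_lt : ucv => /(_ _ ab2); apply: filterS => n ub.
have := @Rintegral_itvB R g (BRight (a ^+ 2)) (BLeft (b ^+ 2)) (u n) gi.
rewrite !bnd_simp => /(_ (ltW (ua n)) ub) <-.
by rewrite gm.2 /Phi; ring.
Qed.

Let sq_in x : a < x < b -> a ^+ 2 < x ^+ 2 < b ^+ 2.
Proof.
move=> /andP[ax xb]; have x0 : 0 <= x by rewrite (le_trans a0)// ltW.
by rewrite !ltrXn2r ?nnegrE// (le_trans x0)// ltW.
Qed.

Let sqr_right (c : R) : 0 <= c -> x ^+ 2 @[x --> c^'+] --> (c ^+ 2)^'+.
Proof.
move=> c0 A; rewrite /at_right /within /= => hA.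
have hz : \forall x \near c, c ^+ 2 < x ^+ 2 -> A (x ^+ 2) by exact: (@exprn_continuous R 2 c _ hA).
change (\forall x \near c^'+, A (x ^+ 2)); near=> x.
have cx : c < x by near: x; exact: nbhs_right_gt.
have : c ^+ 2 < x ^+ 2 -> A (x ^+ 2) by near: x; apply: cvg_within.
by apply; rewrite ltrXn2r ?nnegrE// (le_trans c0)// ltW.
Unshelve. all: by end_near. Qed.

Let sqr_left (c : R) : 0 < c -> x ^+ 2 @[x --> c^'-] --> (c ^+ 2)^'-.
Proof.
move=> c0 A; rewrite /at_left /within /= => hA.
have hz : \forall x \near c, x ^+ 2 < c ^+ 2 -> A (x ^+ 2) by exact: (@exprn_continuous R 2 c _ hA).
change (\forall x \near c^'-, A (x ^+ 2)); near=> x.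
have cx : x < c by near: x; exact: nbhs_left_lt.
have x0 : 0 < x by near: x; exact: nbhs_left_gt.
have : x ^+ 2 < c ^+ 2 -> A (x ^+ 2) by near: x; apply: cvg_within.
by apply; rewrite ltrXn2r ?nnegrE// ltW.
Unshelve. all: by end_near. Qed.

Let cvg_sq (x : R) : y ^+ 2 @[y --> x] --> x ^+ 2. Proof. exact: exprn_continuous. Qed.

Lemma has_int_sqr : has_int `]a, b[ (fun s => 2 * s * g (s ^+ 2)) m.
Proof.
have b0 : 0 < b by exact: le_lt_trans ab.
rewrite -[m]subr0; apply: (open_FTC_ge0 (H := fun s => Phi (s ^+ 2))) => //.
- move=> x /sq_in h; apply: der_eq.
    by apply: der_comp; [apply: derX; exact: derI|exact: dPhi h].
  by rewrite /= expr1 mulr1 mulrC.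
- move=> x /sq_in h; apply: cvgM; first by apply: cvgM => //; exact: cvg_cst.
  exact: (cvg_comp _ _ (@cvg_sq x) (gc h)).
- exact: (cvg_comp _ _ (sqr_right a0) Phi_a).
- exact: (cvg_comp _ _ (sqr_left b0) Phi_b).
- move=> x h; rewrite mulr_ge0 ?g0 ?sq_in// mulr_ge0//.
  by case/andP : h => h _; rewrite (le_trans a0)// ltW.
Qed.

Lemma has_int_sqrN : has_int `]- b, - a[ (fun s => - (2 * s * g (s ^+ 2))) m.
Proof.
have b0 : 0 < b by exact: le_lt_trans ab.
have sqN x : - b < x < - a -> a ^+ 2 < x ^+ 2 < b ^+ 2.
  by move=> /andP[? ?]; rewrite -(sqrrN x); apply: sq_in; apply/andP; split; lra.
rewrite -[m]add0r -[X in has_int _ _ (_ + X)]opprK.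
apply: (open_FTC_ge0 (H := fun s => - Phi (s ^+ 2))); first by rewrite ltrN2.
- move=> x /sqN h; apply: derN; apply: der_eq.
    by apply: der_comp; [apply: derX; exact: derI|exact: dPhi h].
  by rewrite /= expr1 mulr1 mulrC.
- move=> x /sqN h; apply: cvgN; apply: cvgM; first by apply: cvgM => //; exact: cvg_cst.
  exact: (cvg_comp _ _ (@cvg_sq x) (gc h)).
- apply: cvgN; rewrite at_rightN; change (Phi ((- s) ^+ 2) @[s --> b^'-] --> m).
  by under eq_fun do rewrite sqrrN; exact: (cvg_comp _ _ (sqr_left b0) Phi_b).
- rewrite -oppr0; apply: cvgN; rewrite at_leftN; change (Phi ((- s) ^+ 2) @[s --> a^'+] --> 0).
  by under eq_fun do rewrite sqrrN; exact: (cvg_comp _ _ (sqr_right a0) Phi_a).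
- move=> x h; have p : 0 <= g (x ^+ 2) by apply: g0; exact: sqN.
  have x0 : x <= 0 by case/andP : h => _ /ltW h; rewrite (le_trans h)// oppr_le0.
  by rewrite oppr_ge0 mulr_le0_ge0// mulr_ge0_le0.
Qed.

End SquareSubstitution.

(** * The symmetrized density on the line *)

Section HexagonalDensity.
Context {R : realType}.
Local Notation mu := (@lebesgue_measure R).

Definition sqD : set R := `]0, 1[%classic `|` `]1, 3[%classic.
Definition sqDN : set R := `](- 1), 0[%classic `|` `](- 3), (- 1)[%classic.

Lemma measurable_sqD : measurable (sqD : set (measurableTypeR R)).
Proof. exact: measurableU. Qed.

Lemma measurable_sqDN : measurable (sqDN : set (measurableTypeR R)).
Proof. exact: measurableU. Qed.

Lemma sqDP x : sqD x <-> 0 < x /\ hypD (x ^+ 2).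
Proof.
rewrite /sqD /hypD /= !in_itv/=; split.
- case=> /andP[x0 x1]; split; try lra; [left|right]; apply/andP; split; nra.
- move=> [x0]; rewrite exprn_gt0//= => -[x1|/andP[x1 x9]]; [left|right].
    by rewrite x0 /=; nra.
  by apply/andP; split; nra.
Qed.

Lemma sqDNP x : sqDN x <-> sqD (- x).
Proof.
rewrite /sqD /sqDN /= !in_itv/=; split; case=> /andP[? ?].
- by left; apply/andP; split; lra.
- by right; apply/andP; split; lra.
- by left; apply/andP; split; lra.
- by right; apply/andP; split; lra.
Qed.

Variable k : R.
Hypothesis k0 : 0 < k.

Let sqF (g : R -> R) (C : R) : (forall x, 0 <= x <= 9 -> 0 <= g x <= C) ->
  (forall x : R, 0 < x -> g y @[y --> x] --> g x) -> forall a b, 0 <= a -> a < b -> b <= 3 ->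
  (forall x, a ^+ 2 < x < b ^+ 2 -> zmap_ok x) ->
  mu.-integrable `]a ^+ 2, b ^+ 2[ (EFin \o hypF k) ->
  let m := Rintegral mu `]a ^+ 2, b ^+ 2[ (fun x => hypF k x * g x) in
  [/\ has_int `]a ^+ 2, b ^+ 2[ (fun x => hypF k x * g x) m,
    has_int `]a, b[ (fun s => 2 * s * (hypF k (s ^+ 2) * g (s ^+ 2))) m &
    has_int `]- b, - a[ (fun s => - (2 * s * (hypF k (s ^+ 2) * g (s ^+ 2)))) m].
Proof.
move=> gC gc a b a0 ab b3 ok Fi m.
have in9 x : a ^+ 2 < x < b ^+ 2 -> 0 <= x <= 9.
  by move=> /andP[ax xb]; apply/andP; split; nra.
have x0 x : a ^+ 2 < x < b ^+ 2 -> 0 < x by move=> /andP[ax xb]; nra.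
have gi : mu.-integrable `]a ^+ 2, b ^+ 2[ (EFin \o (fun x => hypF k x * g x)).
  apply: (integrableM_bounded (C := C) _ Fi) => //.
    by apply: measurable_oo => x /x0; exact: gc.
  by move=> x /=; rewrite in_itv/= => /in9/gC/andP[? ?]; rewrite ger0_norm.
have h := has_int_self gi.
have F0 x : a ^+ 2 < x < b ^+ 2 -> 0 <= hypF k x * g x.
  move=> xab; rewrite mulr_ge0 ?(hypF_ge0 (ltW k0) (ok _ xab))//.
  by case/andP : (gC x (in9 x xab)).
have Fc x : a ^+ 2 < x < b ^+ 2 -> hypF k y * g y @[y --> x] --> hypF k x * g x.
  move=> xab; apply: cvgM; last exact: gc (x0 _ xab).
  exact: der_cvg (der_hypF k (ok _ xab)).
split=> //; [exact: has_int_sqr F0 Fc h|exact: has_int_sqrN F0 Fc h].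
Qed.

Lemma hex_int (g : R -> R) (C : R) : (forall x, 0 <= x <= 9 -> 0 <= g x <= C) ->
  (forall x : R, 0 < x -> g y @[y --> x] --> g x) ->
  exists m, [/\ has_int hypD (fun x => hypF k x * g x) m,
    has_int sqD (fun s => 2 * s * (hypF k (s ^+ 2) * g (s ^+ 2))) m &
    has_int sqDN (fun s => - (2 * s * (hypF k (s ^+ 2) * g (s ^+ 2)))) m].
Proof.
move=> gC gc.
have e0 : (0 : R) = 0 ^+ 2 by rewrite expr0n.
have e1 : (1 : R) = 1 ^+ 2 by rewrite expr1n.
have e9 : (9 : R) = 3 ^+ 2 by lra.
have okD x : hypD x -> zmap_ok (x : R) by exact: hypD_ok.
have [] := @sqF g C gC gc 0 1 (lexx 0) ltr01 _ _ _.
- by lra.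
- by move=> x; rewrite -e0 -e1 => h; apply: okD; left; rewrite /= in_itv.
- by rewrite -e0 -e1; exact: hypF_integrable01 (ltW k0).
rewrite -e0 -e1 oppr0 => a1 a2 a3.
have [] := @sqF g C gC gc 1 3 ler01 _ _ _ _.
- by lra.
- by [].
- by move=> x; rewrite -e9 -e1 => h; apply: okD; right; rewrite /= in_itv.
- by rewrite -e9 -e1; exact: hypF_integrable19 (ltW k0).
rewrite -e9 -e1 => b1 b2 b3.
exists (Rintegral mu `]0, 1[ (fun x => hypF k x * g x) + Rintegral mu `]1, 9[ (fun x => hypF k x * g x)).
have disj (u v w : R) : `]u, v[%classic `&` `]v, w[%classic = set0.
  apply/seteqP; split => x //= [].
  rewrite !in_itv/= => /andP[_ p] /andP[q _].
  by move: (lt_trans p q); rewrite ltxx.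
by split; apply: has_int_setU => //; rewrite setIC.
Qed.

(** The law of the square root of a variable with density [hypf]. Its symmetrization is [hexf], and
    it is also the weight whose Hankel transform is $J_0^3$. *)
Definition hexp : R -> R := (fun s => 2 * s * hypF k (s ^+ 2)) \_ sqD.

Definition hexf (x : R) : R := `|x| * hypf k (x ^+ 2).

Lemma hexpE x : hexp x = if 0 < x then 2 * hexf x else 0.
Proof.
rewrite /hexp /hexf patchE; case: ifPn => [/set_mem/sqDP[x0 Dx]|/negP Dx].
  by rewrite x0 hypf_in// gtr0_norm//; ring.
case: ifP => // x0; rewrite hypf_out ?mulr0// => h.
by apply: Dx; rewrite inE; apply/sqDP.
Qed.

Lemma hexf_ge0 x : 0 <= hexf x.
Proof. by rewrite mulr_ge0// hypf_ge0// ltW. Qed.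

Lemma hexfE x : hexf x = (hexp x + hexp (- x)) / 2.
Proof.
rewrite !hexpE oppr_gt0; case: (ltgtP x 0) => [x0|x0|->].
- by rewrite add0r /hexf normrN sqrrN; field.
- by rewrite addr0; field.
- by rewrite /hexf normr0 mul0r addr0 mul0r.
Qed.

Lemma hexfN x : hexf (- x) = hexf x.
Proof. by rewrite /hexf normrN sqrrN. Qed.

Lemma hexf_out x : 3 < `|x| -> hexf x = 0.
Proof.
move=> x3; rewrite /hexf hypf_out ?mulr0// => /hypD_le/andP[_].
by rewrite -(ger0_norm (sqr_ge0 x)) normrX => ?; nra.
Qed.

Lemma hexf_int (g : R -> R) (C : R) : (forall x, 0 <= x <= 9 -> 0 <= g x <= C) ->
  (forall x : R, 0 < x -> g y @[y --> x] --> g x) ->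
  exists m, [/\ has_int hypD (fun x => hypF k x * g x) m,
    has_int setT (fun s => hexp s * g (s ^+ 2)) m &
    has_int setT (fun s => hexp (- s) * g (s ^+ 2)) m].
Proof.
move=> gC gc; have [m [h1 h2 h3]] := hex_int gC gc; exists m; split => //.
- apply: has_int_ext (has_int_restrict measurable_sqD h2) => // x _.
  by rewrite /hexp !patchE; case: ifP => _; rewrite ?mul0r// mulrA.
- apply: has_int_ext (has_int_restrict measurable_sqDN h3) => // x _.
  rewrite /hexp !patchE; have -> : (x \in sqDN) = (- x \in sqD).
    by apply/idP/idP; rewrite !inE => /sqDNP.
  by case: ifP => _; rewrite ?mul0r// sqrrN; ring.
Qed.

End HexagonalDensity.

Section HexagonalMoments.
Context {R : realType}.
Local Notation mu := (@lebesgue_measure R).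
Local Notation kap := (@kap R).

Lemma has_int_mu n : has_int hypD (fun x => hypF kap x * x ^+ n) (mu_ n).
Proof. by rewrite -mom_kap; exact: has_int_momD (@kap_gt0 R) n. Qed.

Let pow_ok n (x : R) : 0 <= x <= 9 -> 0 <= x ^+ n <= 9 ^+ n.
Proof. by move=> /andP[x0 x9]; rewrite exprn_ge0//= lerXn2r ?nnegrE. Qed.

Lemma hexp_mom n : has_int setT (fun s => hexp kap s * s ^+ (2 * n)) (mu_ n).
Proof.
have [m [h1 h2 _]] := hexf_int (@kap_gt0 R) (pow_ok n) (fun x _ => @exprn_continuous R n x).
have -> : mu_ n = m by rewrite -(has_int_mu n).2 -h1.2.
by apply: has_int_ext h2 => // x _; rewrite exprM.
Qed.

Lemma hexf_mom n : has_int setT (fun s => hexf kap s * s ^+ n)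
  (if odd n then 0 else mu_ n./2).
Proof.
have mT : measurable ([set: R] : set (measurableTypeR R)) by exact: measurableT.
case: ifP => on.
(* For odd [n] this gives $g(s^2)=|s|^n$; the two half-lines carry equal integrals of it, and they
   enter with opposite signs. *)
- pose g (x : R) := x ^+ n./2 * Num.sqrt x.
  have gC (x : R) : 0 <= x <= 9 -> 0 <= g x <= 9 ^+ n./2 * Num.sqrt 9.
    move=> x09; have /andP[x0 x9] := x09; have /andP[p0 p9] := pow_ok n./2 x09.
    by rewrite mulr_ge0 ?sqrtr_ge0//= ler_pM ?sqrtr_ge0// ler_sqrt.
  have gc (x : R) : 0 < x -> g y @[y --> x] --> g x.
    by move=> _; apply: cvgM; [exact: exprn_continuous|exact: sqrt_continuous].
  have [m [_ h2 h3]] := hexf_int (@kap_gt0 R) gC gc.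
  have := has_intZ 2^-1 mT (has_intD mT h2 (has_intZ (-1) mT h3)).
  rewrite mulN1r subrr mulr0; apply: has_int_ext => // x _.
  have nE : n = (n./2.*2).+1 by rewrite -[LHS]odd_double_half on add1n.
  rewrite /g sqrtr_sqr -exprM mul2n [in RHS]nE exprSr !hexpE oppr_gt0 hexfN.
  case: (ltgtP x 0) => [x0|x0|->].
  + by rewrite ltr0_norm//; field.
  + by rewrite gtr0_norm//; field.
  + by rewrite normr0; ring.
- have h1 := hexp_mom n./2.
  have [m [h2 h3 h4]] := hexf_int (@kap_gt0 R) (pow_ok n./2) (fun x _ => @exprn_continuous R n./2 x).
  have -> : mu_ n./2 = m by rewrite -(has_int_mu n./2).2 -h2.2.
  have := has_intZ 2^-1 mT (has_intD mT h3 h4).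
  rewrite (_ : 2^-1 * (m + m) = m); last by field.
  apply: has_int_ext => // x _.
  have nE : n = n./2.*2 by rewrite -[LHS]odd_double_half on.
  by rewrite hexfE [in RHS]nE -mul2n exprM; field.
Qed.

End HexagonalMoments.

(** * Bessel functions *)

Section Bessel.
Context {R : realType}.
Local Notation mu := (@lebesgue_measure R).
Local Notation besc := (@bessc R).

Lemma bessc_le n : besc n <= (n`!%:R)^-1.
Proof.
have f1 : 1 <= n`!%:R :> R by rewrite ler1n fact_gt0.
rewrite /bessc.
rewrite lef_pV2 ?posrE ?exprn_gt0 ?(lt_le_trans ltr01 f1)//.
by rewrite expr2 ler_peMr// ltW// (lt_le_trans ltr01 f1).
Qed.

Lemma is_cvg_exp_pseries (x : R) : cvgn (pseries (fun n => (n`!%:R : R)^-1) x).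
Proof.
have := @is_cvg_series_exp_coeff R x.
by rewrite (_ : exp_coeff x = fun i => (i`!%:R : R)^-1 * x ^+ i)//; apply/funext => i; rewrite /exp_coeff /= mulrC.
Qed.

Lemma conv_in_le (c d : R^nat) (r : R) : (forall n, `|c n| <= d n) ->
  (forall x : R, 0 <= x -> cvgn (pseries d x)) -> conv_in c r.
Proof.
move=> cd dv z _; apply: normed_cvg.
apply: (@series_le_cvg _ _ (fun i => d i * `|z| ^+ i)) => //= [n|n|].
- by rewrite mulr_ge0 ?exprn_ge0// (le_trans _ (cd n)).
- by rewrite normrM normrX ler_wpM2r ?exprn_ge0.
- exact: dv.
Qed.

Lemma bessc_conv r : conv_in besc r.
Proof.
apply: (conv_in_le (d := fun n => (n`!%:R : R)^-1)).
  by move=> n; rewrite ger0_norm ?bessc_ge0// bessc_le.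
by move=> x _; exact: is_cvg_exp_pseries.
Qed.

Lemma bessc_pcvg z : pcvg besc z (psum besc z).
Proof. by apply: (conv_inP (@bessc_conv (`|z| + 1))); rewrite ltrDl. Qed.

Definition bessB (z : R) : R := psum besc z.
Definition bessB' (z : R) : R := psum (pseries_diffs besc) z.
Definition bessB'' (z : R) : R := psum (pseries_diffs (pseries_diffs besc)) z.

Lemma der_bessB z : isder bessB z (bessB' z).
Proof. by apply: (psum_der (@bessc_conv (`|z| + 1))); rewrite ltrDl. Qed.

Lemma der_bessB' z : isder bessB' z (bessB'' z).
Proof. by apply: (psum_der (conv_in_diffs (@bessc_conv (`|z| + 1)))); rewrite ltrDl. Qed.

Lemma bessB_ode z : z * bessB'' z + bessB' z = bessB z.
Proof.
have z1 : `|z| < `|z| + 1 by rewrite ltrDl.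
have h0 := conv_inP (@bessc_conv (`|z| + 1)) z1.
have h1 := conv_inP (conv_in_diffs (@bessc_conv (`|z| + 1))) z1.
have h2 := conv_inP (conv_in_diffs (conv_in_diffs (@bessc_conv (`|z| + 1)))) z1.
apply: (@pcvg_unique _ besc z); last exact: h0.
apply: pcvg_ext (pcvgD (pcvg_shiftup h2) h1).
move=> [|n] /=; rewrite /pseries_diffs; first by have := @besscS R 0; rewrite expr1n => <-; ring.
by rewrite -(besscS n.+1) -!(natr1 n.+1) -!(natr1 n); ring.
Qed.

Definition J0 (x : R) : R := bessB (- x ^+ 2 / 4).
(** The Bessel function of order 1, written so that $J_0'=-J_1$ is the chain rule and no division by
    [x] occurs. *)
Definition J1 (x : R) : R := x / 2 * bessB' (- x ^+ 2 / 4).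

Lemma besselJ0E : @besselJ0 R = J0.
Proof.
apply/funext => x; rewrite /besselJ0 /J0 /bessB /psum /pseries.
congr (limn (series _)); apply/funext => k /=.
rewrite exprM (_ : - x ^+ 2 / 4 = -1 * (x / 2) ^+ 2); last by field.
by rewrite /bessc [(-1 * _) ^+ k]exprMn; ring.
Qed.

Let der_arg x : isder (fun y : R => - y ^+ 2 / 4) x (- x / 2).
Proof. by der; field. Qed.

Lemma der_J0 x : isder J0 x (- J1 x).
Proof.
by apply: der_eq; [apply: der_comp; [exact: der_arg|exact: der_bessB]|rewrite /J1; field].
Qed.

Lemma der_xJ1 x : isder (fun y => y * J1 y) x (x * J0 x).
Proof.
have hB := der_comp (der_arg x) (der_bessB' (- x ^+ 2 / 4)).
have d2 : isder (fun y : R => y / 2) x (1 / 2) by der; field.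
apply: der_eq.
  by apply: derM; [exact: derI|apply: derM; [exact: d2|exact: hB]].
by rewrite /J0 /J1 -bessB_ode /=; field.
Qed.

Lemma der_J1 x : x != 0 -> isder J1 x (J0 x - J1 x / x).
Proof.
move=> x0; have h := der_xJ1 x.
have hV : isder (fun y : R => y^-1) x (- 1 / x ^+ 2) by apply: derV => //; exact: derI.
have : isder (fun y => (y * J1 y) * y^-1) x (J0 x - J1 x / x).
  by apply: der_eq; [apply: derM; [exact: h|exact: hV]|rewrite /=; field].
apply: der_near; have : \forall y \near x, y != 0.
  by apply: open_nbhs_nbhs; split => //; exact: open_neq.
by apply: filterS => y y0; rewrite mulrAC mulfV// mul1r.
Qed.

Lemma cvg_J0 x : J0 y @[y --> x] --> J0 x.
Proof. exact: der_cvg (der_J0 x). Qed.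

Lemma cvg_J1 x : J1 y @[y --> x] --> J1 x.
Proof.
have d2 : isder (fun y : R => y / 2) x (1 / 2) by der; field.
exact: der_cvg (derM d2 (der_comp (der_arg x) (der_bessB' (- x ^+ 2 / 4)))).
Qed.

(* The energy of [u = sqrt t * J0 t], a solution of [u'' + (1 + 1/(4t^2)) u = 0]. *)
Lemma bessel_bound : exists C : R, 0 <= C /\
  forall t, 0 <= t -> t * (J0 t ^+ 2 + J1 t ^+ 2) <= C.
Proof.
pose E t : R := t * (J0 t ^+ 2 + J1 t ^+ 2) - J0 t * J1 t + J0 t ^+ 2 * (2 * t)^-1.
have dE t : 0 < t -> isder E t (- (J0 t ^+ 2 / (2 * t ^+ 2))).
  move=> t0; have tn : t != 0 by rewrite gt_eqF.
  have h0 := der_J0 t; have h1 := der_J1 tn.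
  have h2 : isder (fun y : R => 2 * y) t 2 by der; ring.
  apply: der_eq.
    apply: derD; first apply: derD.
    - by apply: derM; [exact: derI|apply: derD; apply: derX; [exact: h0|exact: h1]].
    - by apply: derN; apply: derM; [exact: h0|exact: h1].
    - apply: derM; first by apply: derX; exact: h0.
      by apply: derV; [rewrite mulf_neq0|exact: h2].
  by rewrite /=; field.
have E1 t : 1 <= t -> E t <= E 1.
  move=> t1; have := @mono_oo R (fun t => - E t) (fun t => J0 t ^+ 2 / (2 * t ^+ 2)) 0 (t + 1).
  move=> /(_ _ _ 1 t) h; rewrite -lerN2; apply: h => //.
  - by move=> x /andP[x0 _]; rewrite -[X in isder _ _ X]opprK; apply: derN; exact: dE.
  - by move=> x /andP[x0 _]; rewrite divr_ge0 ?sqr_ge0// mulr_ge0// sqr_ge0.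
  - by rewrite ltrDl.
have [C0 hC0] : exists C0, forall t, 0 <= t <= 1 -> t * (J0 t ^+ 2 + J1 t ^+ 2) <= C0.
  have [||c _ hc] := @EVT_max R (fun t => t * (J0 t ^+ 2 + J1 t ^+ 2)) 0 1.
  - exact: ler01.
  - apply: continuous_subspaceT => t.
    apply: cvgM => //; apply: cvgD; rewrite /GRing.exp.
      by apply: cvgM; exact: cvg_J0.
    by apply: cvgM; exact: cvg_J1.
  by eexists => t t01; apply: hc; rewrite in_itv.
exists (Num.max 0 (Num.max C0 (2 * E 1))); split; first by rewrite le_max lexx.
move=> t t0; rewrite !le_max; case: (leP t 1) => t1.
  by rewrite hC0 ?orbT// t0 t1.
apply/orP; right; apply/orP; right.
(* For $t\ge1$ the cross term is absorbed: $2J_0J_1\le t(J_0^2+J_1^2)$, hence $t(J_0^2+J_1^2)\le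
   2E(t)$. *)
apply: le_trans (_ : 2 * E t <= _); last by rewrite ler_pM2l// E1// ltW.
rewrite /E.
have h1 : 0 <= J0 t ^+ 2 / (2 * t) by rewrite divr_ge0 ?sqr_ge0// mulr_ge0.
have h2 : 2 * (J0 t * J1 t) <= t * (J0 t ^+ 2 + J1 t ^+ 2).
  apply: (@le_trans _ _ (1 * (J0 t ^+ 2 + J1 t ^+ 2))).
    by rewrite mul1r; have := sqr_ge0 (J0 t - J1 t); nra.
  by rewrite ler_wpM2r ?addr_ge0 ?sqr_ge0// ltW.
move: h1 h2; move: (J0 t ^+ 2 / (2 * t)) (J0 t * J1 t) (t * (J0 t ^+ 2 + J1 t ^+ 2)) => A B C; lra.
Unshelve. all: by end_near. Qed.

End Bessel.

(** * Hankel transforms *)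

Section HankelPairs.
Context {R : realType}.
Local Notation mu := (@lebesgue_measure R).
Let mT : measurable ([set: R] : set (measurableTypeR R)) := measurableT.

Lemma coef_besspoly_ge0 N i : 0 <= (@besspoly R N)`_i.
Proof. by rewrite coef_poly; case: ifP => // _; exact: bessc_ge0. Qed.

Lemma coef_mul_homo (p p' q q' : {poly R}) : (forall i, 0 <= p`_i <= p'`_i) ->
  (forall i, 0 <= q`_i <= q'`_i) -> forall i, 0 <= (p * q)`_i <= (p' * q')`_i.
Proof.
move=> hp hq i; rewrite !coefM; apply/andP; split.
  apply: sumr_ge0 => j _; have /andP[p0 _] := hp j; have /andP[q0 _] := hq (i - j)%N.
  exact: mulr_ge0.
apply: ler_sum => j _; have /andP[p0 p1] := hp j; have /andP[q0 q1] := hq (i - j)%N.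
exact: ler_pM.
Qed.

Lemma coef_cube_le N i : 0 <= (@besspoly R N ^+ 3)`_i <= cubec i.
Proof.
have [iN|Ni] := leqP i N.
  rewrite cubecE// lexx andbT /cubec.
  have h j : 0 <= (@besspoly R i)`_j <= (besspoly i)`_j by rewrite coef_besspoly_ge0 lexx.
  rewrite !exprS expr0 mulr1.
  by have /andP[] := coef_mul_homo h (coef_mul_homo h h) i.
rewrite /cubec !exprS !expr0 !mulr1.
have h j : 0 <= (@besspoly R N)`_j <= (besspoly i)`_j.
  rewrite coef_besspoly_ge0 !coef_poly !ltnS /=; case: leqP => jN; last first.
    by case: ifP => // _; exact: bessc_ge0.
  by rewrite (leq_trans jN (ltnW Ni)).
by apply: coef_mul_homo => //; exact: coef_mul_homo.
Qed.

Lemma cubec_ge0 n : 0 <= @cubec R n.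
Proof. by have /andP[h1 h2] := coef_cube_le n n; exact: le_trans h2. Qed.

Lemma bessc_mu n : bessc n * mu_ n = @cubec R n.
Proof. by rewrite /mu_ /bessc mulKf// expf_neq0// fact_neq0. Qed.

Lemma cubec_conv r : conv_in (@cubec R) r.
Proof.
apply: (conv_in_le (d := fun n => 9 ^+ n * (n`!%:R : R)^-1)).
  move=> n; rewrite ger0_norm ?cubec_ge0// -bessc_mu mulrC.
  by rewrite ler_pM ?mu_ge0 ?bessc_ge0 ?mu_le ?bessc_le.
move=> x _; have := @is_cvg_exp_pseries R (9 * x).
rewrite (_ : pseries _ _ = pseries (fun n => 9 ^+ n * (n`!%:R : R)^-1) x)//.
by rewrite /pseries; congr series; apply/funext => i /=; rewrite exprMn; ring.
Qed.

Lemma cubec_pcvg z : pcvg (@cubec R) z (psum cubec z).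
Proof. by apply: (conv_inP (@cubec_conv (`|z| + 1))); rewrite ltrDl. Qed.

(** The cube of the truncation agrees with the series up to degree [N]. Its coefficients from $N+1$
    to $3N$ are nonnegative and at most [cubec], so the difference is bounded by a tail of the
    series at $|z|$. *)
Lemma psum_cubec (z : R) : psum cubec z = bessB z ^+ 3.
Proof.
pose P N := (@besspoly R N).[z].
have hP : P N @[N --> \oo] --> bessB z.
  have h := @bessc_pcvg R z; rewrite /pcvg -cvg_shiftS in h.
  rewrite (_ : P = fun n => pseries (@bessc R) z n.+1)//.
  by apply/funext => N; rewrite /P horner_poly /pseries /series /= big_mkord.
have hP3 : P N ^+ 3 @[N --> \oo] --> bessB z ^+ 3.
  rewrite (_ : (fun N => P N ^+ 3) = fun N => P N * (P N * P N)).
    by rewrite !exprS expr0 mulr1; apply: cvgM => //; exact: cvgM.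
  by apply/funext => N; rewrite !exprS expr0 mulr1.
pose S w N := pseries (@cubec R) w N.
have hS w : S w N @[N --> \oo] --> psum cubec w by exact: cubec_pcvg.
have key N : `|P N ^+ 3 - S z N.+1| <= S `|z| (3 * N).+1 - S `|z| N.+1.
  rewrite /P -horner_exp (horner_coef_wide (n := (3 * N).+1)); last first.
    apply: leq_trans (size_poly_exp_leq _ _) _; rewrite ltnS.
    rewrite mulnC leq_mul2l/= -ltnS.
    by have := size_poly N.+1 (@bessc R); case: size.
  rewrite /S /pseries /series /= !big_mkord.
  rewrite -(subnKC (_ : N.+1 <= (3 * N).+1)%N); last by rewrite ltnS leq_pmull.
  rewrite !big_split_ord /= [X in `|X - _|]addrC [X in _ <= X - _]addrC -!addrA.
  have -> : \sum_(i < N.+1) (besspoly N ^+ 3)`_i * z ^+ i = \sum_(i < N.+1) cubec i * z ^+ i.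
    by apply: eq_bigr => i _; rewrite cubecE// -ltnS.
  rewrite !subrr !addr0; apply: le_trans (ler_norm_sum _ _ _) _.
  apply: ler_sum => i _; rewrite normrM normrX ler_wpM2r ?exprn_ge0//.
  by have /andP[h1 h2] := coef_cube_le N (N.+1 + i); rewrite ger0_norm.
have h0 : P N ^+ 3 - S z N.+1 @[N --> \oo] --> 0.
  have h1 : S `|z| (3 * N).+1 - S `|z| N.+1 @[N --> \oo] --> psum cubec `|z| - psum cubec `|z|.
    apply: cvgB; last by rewrite (cvg_shiftS (S `|z|)); exact: hS.
    apply: (cvg_comp (fun N => (3 * N).+1) (S `|z|)) (hS _).
    apply/cvgnyPge => A; near=> N.
    rewrite ltnW// ltnS; apply: (@leq_trans N); last by rewrite leq_pmull.
    by near: N; exact: nbhs_infty_ge.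
  rewrite subrr in h1.
  apply: norm_cvg0; apply: squeeze_cvgr h1; last exact: cvg_cst.
  by near=> N; rewrite normr_ge0 key.
have h2 : S z N.+1 @[N --> \oo] --> bessB z ^+ 3 - 0.
  have -> : (fun N => S z N.+1) = fun N => P N ^+ 3 - (P N ^+ 3 - S z N.+1).
    by apply/funext => N; ring.
  exact: cvgB.
rewrite subr0 (cvg_shiftS (S z)) in h2.
exact: (cvg_unique _ (hS z) h2).
Unshelve. all: by end_near. Qed.

(** * Termwise integration of the Bessel series against a weight *)

Section Swap.
Variables (q : R -> R) (m : nat -> R).
Hypothesis mq : measurable_fun setT q.
Hypothesis q0 : forall s, 0 <= q s.
Hypothesis qm : forall n, has_int setT (fun s => q s * s ^+ (2 * n)) (m n).

Let f (w : R) (N : nat) (s : R) : R := q s * pseries (@bessc R) (w * s ^+ 2) N.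

Let f_int w N : has_int setT (f w N) (pseries (fun n => bessc n * m n) w N).
Proof.
elim: N => [|N IH].
  have h := has_intZ 0 mT (qm 0).
  rewrite /pseries /series /= big_geq// -[X in has_int _ _ X](mul0r (m 0)).
  by apply: has_int_ext h => // s _; rewrite /f /pseries /series /= big_geq// mulr0 mul0r.
have h := has_intD mT IH (has_intZ (bessc N * w ^+ N) mT (qm N)).
rewrite /pseries /series /= big_nat_recr//= [bessc N * m N * _]mulrAC.
apply: has_int_ext h => // s _.
rewrite /f /pseries /series /= big_nat_recr//= exprMn -exprM.
by ring.
Qed.

Let bessB_meas (w : R) : measurable_fun setT (fun s : R => bessB (w * s ^+ 2)).
Proof.
apply: der_measurable => s.
have h : isder (fun s : R => w * s ^+ 2) s (2 * w * s) by der; ring.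
by eexists; apply: der_comp h (der_bessB _).
Qed.

(** At $|z|$ all terms are nonnegative, and monotone convergence produces an integrable majorant;
    dominated convergence then applies at [z] itself. *)
Lemma has_int_bessB (z : R) : cvgn (pseries (fun n => bessc n * m n) `|z|) ->
  has_int setT (fun s => q s * bessB (z * s ^+ 2)) (psum (fun n => bessc n * m n) z).
Proof.
move=> cv.
have fcv w s : f w N s @[N --> \oo] --> q s * bessB (w * s ^+ 2).
  by apply: cvgMr; exact: bessc_pcvg.
have mf w N : measurable_fun setT (EFin \o f w N).
  by have [/integrableP[]] := f_int w N.
have mg w : measurable_fun setT (EFin \o (fun s => q s * bessB (w * s ^+ 2))).
  by apply/measurable_EFinP; exact: measurable_funM mq (bessB_meas w).
have f0 N s : 0 <= f `|z| N s.
  rewrite /f mulr_ge0// /pseries /series /=; apply: sumr_ge0 => i _.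
  by rewrite mulr_ge0 ?bessc_ge0 ?exprn_ge0// mulr_ge0// sqr_ge0.
have fh s : {homo (fun N => f `|z| N s) : a b / (a <= b)%N >-> a <= b}.
  apply/nondecreasing_seqP => N; rewrite /f ler_wpM2l// /pseries /series /= big_nat_recr//=.
  by rewrite lerDl mulr_ge0 ?bessc_ge0 ?exprn_ge0// mulr_ge0// sqr_ge0.
have gi : mu.-integrable setT (EFin \o (fun s => q s * bessB (`|z| * s ^+ 2))).
  apply/integrableP; split; first exact: mg.
  have h := @cvg_monotone_convergence _ _ _ mu setT mT (fun N => EFin \o f `|z| N) (mf _).
  have {}h := h (fun N s _ => f0 N s) (fun s _ a b ab => fh s a b ab).
  rewrite (_ : (fun N => _) = fun N => (pseries (fun n => bessc n * m n) `|z| N)%:E) in h; last first.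
    by apply/funext => N; exact: (has_intE mT (f_int _ _)).
  have e : (\int[mu]_s (limn (fun N => (EFin \o f `|z| N) s)) =
      \int[mu]_s (abse \o (EFin \o (fun s : R => (q s * bessB (`|z| * s ^+ 2))%R))) s)%E.
    apply: eq_integral => s _.
    have -> : limn (fun N => (EFin \o f `|z| N) s) = (q s * bessB (`|z| * s ^+ 2))%:E.
      by apply: cvg_lim => //; apply: cvg_EFin; [exact: nearW|exact: fcv].
    rewrite /= [ `|q s * _|]ger0_norm//.
    rewrite (_ : q s * _ = limn (fun N => f `|z| N s)); last by apply/esym/cvg_lim => //; exact: fcv.
    by apply: limr_ge; [exact: cvgP (fcv _ _)|apply: nearW => N; exact: f0].
  rewrite -[X in (X < _)%E]e.
  have h2 : (pseries (fun n => bessc n * m n) `|z| N)%:E @[N --> \oo] -->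
      (limn (pseries (fun n => bessc n * m n) `|z|))%:E.
    by apply: cvg_EFin; [exact: nearW|exact: cv].
  rewrite (_ : (\int[mu]_s _ = (limn (pseries (fun n => bessc n * m n) `|z|))%:E)%E) ?ltry//.
  exact: (cvg_unique _ h h2).
have dom N s : `|f z N s| <= q s * bessB (`|z| * s ^+ 2).
  apply: (@le_trans _ _ (f `|z| N s)).
    rewrite /f normrM ger0_norm// ler_wpM2l// /pseries /series /=.
    apply: le_trans (ler_norm_sum _ _ _) _; apply: ler_sum => i _.
    by rewrite normrM normrX normrM (ger0_norm (bessc_ge0 _)) (ger0_norm (sqr_ge0 s)).
  rewrite (_ : q s * _ = limn (fun N => f `|z| N s)).
    exact: (nondecreasing_cvgn_le (fh s) (cvgP _ (fcv _ _))).
  by apply/esym/cvg_lim => //; exact: fcv.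
have [||hi _ hl] := @dominated_convergence _ _ _ mu setT mT (fun N => EFin \o f z N)
  (EFin \o (fun s => q s * bessB (z * s ^+ 2))) _ (mf z) (mg z) _ gi _.
- by apply: aeW => s _; apply: cvg_EFin; [exact: nearW|exact: fcv].
- by apply: aeW => s N _; rewrite /= lee_fin; exact: dom.
split => //.
rewrite (_ : (fun N => _) = fun N => (pseries (fun n => bessc n * m n) z N)%:E) in hl; last first.
  by apply/funext => N; exact: (has_intE mT (f_int _ _)).
have h3 : Rintegral mu setT (fun s => q s * bessB (z * s ^+ 2)) =
    psum (fun n => bessc n * m n) z.
  have hl' : (pseries (fun n => bessc n * m n) z N)%:E @[N --> \oo] -->
      (Rintegral mu setT (fun s => q s * bessB (z * s ^+ 2)))%:E.
    by rewrite -(has_intE mT (has_int_self hi)).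
  have h4 := fine_cvg hl'.
  by apply/esym; rewrite /psum; apply: (cvg_lim (@Rhausdorff R)); exact: h4.
exact: h3.
Qed.

End Swap.

Lemma hexp_measurable : measurable_fun setT (@hexp R kap).
Proof.
have [/integrableP[/measurable_EFinP h _] _] := @hexp_mom R 0.
apply: (eq_measurable_fun _ _ h) => s _ /=; by rewrite muln0 expr0 mulr1.
Qed.

Lemma hexp_ge0 (s : R) : 0 <= hexp kap s.
Proof. by rewrite hexpE; case: ifP => // _; rewrite mulr_ge0// hexf_ge0// kap_gt0. Qed.

Lemma hexp_J0 (t : R) : has_int setT (fun s => hexp kap s * J0 (t * s)) (J0 t ^+ 3).
Proof.
have h := @has_int_bessB _ _ hexp_measurable hexp_ge0 (@hexp_mom R) (- t ^+ 2 / 4) _.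
have e : (fun n => bessc n * mu_ n) = @cubec R by apply/funext => n; exact: bessc_mu.
rewrite e psum_cubec in h.
apply: has_int_ext (h _) => //.
  move=> s _; rewrite /J0; congr (_ * bessB _).
  by rewrite exprMn; field.
by apply: (@cubec_conv (`|- t ^+ 2 / 4| + 1)); rewrite normr_id ltrDl.
Qed.

(** * The Gaussian Hankel pair *)

Section Gauss.
Variable a : R.
Hypothesis a0 : 0 < a.

(** The primitive of $2as\,e^{-as^2}s^{2n}$ found by repeated integration by parts, normalized to
    vanish at infinity. *)
Fixpoint gaussH n (s : R) : R :=
  if n is n'.+1 then - (expR (- (a * s ^+ 2)) * s ^+ (2 * n)) + n%:R / a * gaussH n' s
  else - expR (- (a * s ^+ 2)).

Lemma der_gaussH n s : isder (gaussH n) s (2 * a * s * expR (- (a * s ^+ 2)) * s ^+ (2 * n)).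
Proof.
have d1 : isder (fun s : R => - (a * s ^+ 2)) s (- (2 * a * s)) by der; ring.
have d2 := der_comp d1 (is_derive_expR _ : isder expR _ _).
elim: n => [|n IH] /=.
  by apply: der_eq (derN d2) _; rewrite muln0 expr0; ring.
rewrite (_ : (2 * n.+1 = (2 * n).+2)%N); last by rewrite mulnS.
apply: der_eq.
  apply: derD; first by apply: derN; apply: derM; [exact: d2|exact: (derX (2 * n).+2 (derI s))].
  by apply: derM; [exact: derC|exact: IH].
cbv beta; rewrite [_.-1]/= -(addn2 (2 * n)) natrD natrM -(natr1 n) addn2 (exprS s (2 * n).+1) (exprS s (2 * n)).
move: (expR _) (s ^+ (2 * n)) => E X; field; by rewrite gt_eqF.
Qed.

Lemma gaussH_0 n : gaussH n 0 = - (n`!%:R / a ^+ n).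
Proof.
elim: n => [|n IH] /=; rewrite expr0n mulr0 oppr0 expR0; first by rewrite fact0 expr0 divr1.
rewrite expr0n muln_eq0/= mulr0 oppr0 add0r IH factS natrM exprS.
by rewrite mulrN mulf_div.
Qed.

Lemma cvg_gaussH n : gaussH n s @[s --> +oo] --> 0.
Proof.
have h k : expR (- (a * s ^+ 2)) * s ^+ (2 * k) @[s --> +oo] --> 0.
  have c : k.+1`!%:R / a ^+ k.+1 * s^-1 @[s --> +oo] --> k.+1`!%:R / a ^+ k.+1 * 0.
    by apply: cvgM; [exact: cvg_cst|apply/gtr0_cvgV0; [near=> s|exact: cvg_id]].
  rewrite mulr0 in c; apply: squeeze_cvgr c; last exact: cvg_cst.
  near=> s; apply/andP; split.
    by rewrite mulr_ge0 ?expR_ge0// exprn_even_ge0// oddM.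
  have s1 : 1 <= s by near: s; apply: nbhs_pinfty_ge; exact: num_real.
  have s0 : 0 < s by exact: lt_le_trans s1.
  have A0 : 0 < a * s ^+ 2 by rewrite mulr_gt0// exprn_gt0.
  have E := @expR_ge1Dxn R (a * s ^+ 2) k (ltW A0).
  rewrite expRN [_^-1 * _]mulrC ler_pdivrMr ?expR_gt0//.
  apply: (@le_trans _ _ (k.+1`!%:R / a ^+ k.+1 / s * ((a * s ^+ 2) ^+ k.+1 / k.+1`!%:R))).
    rewrite (_ : _ * _ = s ^+ (2 * k) * s); first by rewrite ler_peMr// exprn_ge0// ltW.
    rewrite exprMn -exprM mulnS exprD expr2.
    by field; rewrite fact_neq0 expf_neq0 gt_eqF.
  rewrite ler_wpM2l//; last by apply: le_trans E; rewrite lerDr.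
  by rewrite divr_ge0 ?ltW// divr_gt0// ?exprn_gt0// ltr0n fact_gt0.
elim: n => [|n IH].
  rewrite (_ : gaussH 0 = fun s => - (expR (- (a * s ^+ 2)) * s ^+ (2 * 0))).
    by rewrite -oppr0; exact: cvgN (h 0%N).
  by apply/funext => s; rewrite muln0 expr0 mulr1.
suff : gaussH n.+1 s @[s --> +oo] --> - 0 + n.+1%:R / a * 0 by rewrite oppr0 mulr0 addr0.
exact: cvgD (cvgN (h n.+1)) (cvgM (cvg_cst _) IH).
Unshelve. all: by end_near. Qed.

(** Its even moments $n!/a^n$ turn the Bessel series into an exponential series, so its Hankel
    transform is again a Gaussian. *)
Definition gaussp : R -> R := (fun s => 2 * a * s * expR (- (a * s ^+ 2))) \_ `[0, +oo[.

Lemma gausspE s : gaussp s = if 0 <= s then 2 * a * s * expR (- (a * s ^+ 2)) else 0.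
Proof.
rewrite /gaussp patchE; case: ifPn; first by move=> /set_mem /=; rewrite in_itv/= andbT => ->.
by move=> /negP h; case: ifP => // s0; case: h; apply/mem_set; rewrite /= in_itv/= s0.
Qed.

Lemma gaussp_ge0 s : 0 <= gaussp s.
Proof. by rewrite gausspE; case: ifP => // s0; rewrite !mulr_ge0 ?expR_ge0// ltW. Qed.

Lemma gaussp_mom n : has_int setT (fun s => gaussp s * s ^+ (2 * n)) (n`!%:R / a ^+ n).
Proof.
have g0 (s : R) : 0 <= s -> 0 <= 2 * a * s * expR (- (a * s ^+ 2)) * s ^+ (2 * n).
  by move=> s0; rewrite !mulr_ge0 ?expR_ge0 ?exprn_ge0// ltW.
have dg s : exists d, isder (fun s => 2 * a * s * expR (- (a * s ^+ 2)) * s ^+ (2 * n)) s d.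
  have d1 : isder (fun s : R => - (a * s ^+ 2)) s (- (2 * a * s)) by der; ring.
  have d2 := der_comp d1 (is_derive_expR _ : isder expR _ _).
  eexists; apply: derM; first apply: derM; [apply: derM; [exact: derC|exact: derI]|exact: d2|exact: (derX (2 * n) (derI s))].
have mg := der_measurable dg.
have e : (\int[mu]_(x in `[0%R, +oo[) (2 * a * x * expR (- (a * x ^+ 2)) * x ^+ (2 * n))%:E =
    (n`!%:R / a ^+ n)%:E)%E.
  rewrite (@ge0_continuous_FTC2y R _ (gaussH n) 0 0 g0 _ (cvg_gaussH n)) ?sub0e//=.
  - by rewrite gaussH_0 opprK.
  - apply: continuous_subspaceT => s; have [d hd] := dg s; exact: der_cvg hd.
  - by move=> s _; have [] := der_gaussH n s.
  - by apply: cvg_at_right_filter; exact: der_cvg (der_gaussH n 0).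
  - move=> s _; rewrite derive1E; have [_] := der_gaussH n s; exact.
have m0 : measurable (`[0 : R, +oo[%classic : set (measurableTypeR R)) by exact: measurable_itv.
have h : has_int `[0, +oo[ (fun s => 2 * a * s * expR (- (a * s ^+ 2)) * s ^+ (2 * n)) (n`!%:R / a ^+ n).
  split; last by rewrite /Rintegral e.
  apply/integrableP; split; first by apply/measurable_EFinP; apply: measurable_funTS.
  rewrite (_ : (\int[mu]_(x in _) _ = (n`!%:R / a ^+ n)%:E)%E) ?ltry// -e.
  apply: eq_integral => s /set_mem /=.
  by rewrite in_itv/= andbT => s0; rewrite ger0_norm//; exact: g0.
apply: has_int_ext (has_int_restrict m0 h) => // s _.
by rewrite /gaussp !patchE; case: ifP => // _; rewrite mul0r.
Qed.

Lemma measurable_gaussp : measurable_fun setT gaussp.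
Proof.
have [/integrableP[/measurable_EFinP h _] _] := gaussp_mom 0.
apply: (eq_measurable_fun _ _ h) => s _ /=; by rewrite muln0 expr0 mulr1.
Qed.

Lemma gaussp_J0 t : has_int setT (fun s => gaussp s * J0 (t * s)) (expR (- (t ^+ 2 / (4 * a)))).
Proof.
have e w : pseries (fun n => bessc n * (n`!%:R / a ^+ n)) w = pseries (fun n => (n`!%:R : R)^-1) (w / a).
  apply/funext => N; rewrite /pseries /series /=; apply: eq_bigr => i _.
  rewrite /bessc exprMn exprVn; field.
  by rewrite fact_neq0 expf_neq0 ?gt_eqF.
have h := @has_int_bessB _ _ measurable_gaussp gaussp_ge0 gaussp_mom (- t ^+ 2 / 4) _.
rewrite /psum !e in h.
have {h}h := h (@is_cvg_exp_pseries R _).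
have -> : expR (- (t ^+ 2 / (4 * a))) = limn (pseries (fun n => (n`!%:R : R)^-1) (- t ^+ 2 / 4 / a)).
  rewrite expRE; congr (limn _); rewrite /pseries; congr series; apply/funext => i.
  rewrite /=; congr (_ * _ ^+ _); field; by rewrite gt_eqF.
apply: has_int_ext h => //.
move=> s _; rewrite /J0; congr (_ * bessB _).
by rewrite exprMn; field.
Qed.

End Gauss.

(** Hankel inversion for the Gaussian costs nothing: $te^{-t^2/4}$ is twice the weight
    [gaussp (1 / 4)], so the forward formula with $a=1/4$ already evaluates the inverse
    transform. *)
Lemma cvg_gauss_J0 (r : R) :
  Rintegral mu `[0, x] (fun t => t * J0 (r * t) * expR (- (t ^+ 2 / 4))) @[x --> +oo] -->
  2 * expR (- r ^+ 2).
Proof.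
have a0 : 0 < (1 / 4 : R) by lra.
have [hi he] := gaussp_J0 a0 r.
have e : expR (- r ^+ 2) = expR (- (r ^+ 2 / (4 * (1 / 4)))).
  by congr expR; field.
rewrite e -he; apply/cvg_pinftyP => u uy.
have m0 : measurable (`[0 : R, +oo[%classic : set (measurableTypeR R)) by exact: measurable_itv.
pose g : R -> R := fun s => gaussp (1 / 4) s * J0 (r * s).
have E2 x : Rintegral mu `[0, x] (fun t => t * J0 (r * t) * expR (- (t ^+ 2 / 4))) =
    2 * Rintegral mu `[0, x] g.
  have gi : has_int `[0, x] g (Rintegral mu `[0, x] g).
    apply: has_int_self; apply: (@integrableS _ _ _ mu setT) hi => //; exact: measurable_itv.
  have [_ <-] := has_intZ 2 (measurable_itv `[0, x]) gi.
  apply: eq_Rintegral => s /set_mem /=; rewrite in_itv/= => /andP[s0 _].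
  rewrite /g gausspE s0 (_ : 1 / 4 * s ^+ 2 = s ^+ 2 / 4); last by field.
  move: (expR _) (J0 _) => E J; by field.
have -> : (fun n => Rintegral mu `[0, u n] (fun t => t * J0 (r * t) * expR (- (t ^+ 2 / 4)))) =
  fun n => 2 * Rintegral mu `[0, u n] g by apply/funext => n; exact: E2.
apply: cvgM; first exact: cvg_cst.
have -> : Rintegral mu setT g = Rintegral mu `[0, +oo[ g.
  rewrite [RHS]Rintegral_mkcond; apply: eq_Rintegral => s _.
  rewrite patchE; case: ifPn => // /negP h.
  rewrite /g gausspE; case: ifP => [s0|]; last by rewrite mul0r.
  by case: h; apply/mem_set; rewrite /= in_itv/= s0.
have gi : mu.-integrable `[0, +oo[ (EFin \o g).
  by apply: (@integrableS _ _ _ mu setT) hi.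
apply: fine_cvg; rewrite fineK; last exact: integrable_fin_num gi.
have gi1 := gi; apply: cvg_integral_increasing_integrable gi => //.
- by move=> n x /=; rewrite !in_itv/= => /andP[-> _].
- move=> x /=; rewrite in_itv/= andbT => x0.
  by near=> n; rewrite /= in_itv/= x0; near: n; exact: ((cvgryPge u).1 uy x).
- by have /integrableP[] := gi1.
Unshelve. all: by end_near. Qed.

End HankelPairs.

(** * The Riemann-Lebesgue lemma *)

Section RiemannLebesgue.
Context {R : realType}.
Local Notation mu := (@lebesgue_measure R).
Implicit Types (f g d : R -> R) (s x a b : R).

(** A pointwise form of continuous differentiability, so that finitely many bad points can be
    excluded one at a time. *)
Definition c1 f s : Prop :=
  exists d, (\forall y \near s, isder f y (d y)) /\ d y @[y --> s] --> d s.

Lemma c1_der f s : c1 f s -> isder f s (f^`()%classic s).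
Proof.
by move=> [d [/nbhs_singleton h _]]; rewrite derive1E; have [_ ->] := h.
Qed.

Lemma c1_cvg_derive1 f s : c1 f s -> f^`()%classic y @[y --> s] --> f^`()%classic s.
Proof.
move=> [d [h dc]].
have e : \forall y \near s, d y = f^`()%classic y.
  by apply: filterS h => y hy; rewrite derive1E; have [_ ->] := hy.
by rewrite -(nbhs_singleton e); apply: cvg_trans dc; exact: near_eq_cvg.
Qed.

Lemma c1_cvg f s : c1 f s -> f y @[y --> s] --> f s.
Proof. by move=> /c1_der/der_cvg. Qed.

Lemma c1_isder f d s : (forall y, isder f y (d y)) -> d y @[y --> s] --> d s -> c1 f s.
Proof.
move=> h dc; exists d; split; last exact: dc.
by near=> y; exact: h.
Unshelve. all: by end_near. Qed.

Lemma c1_near f g s : (\forall y \near s, f y = g y) -> c1 f s -> c1 g s.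
Proof.
move=> fg [d [h dc]]; exists d; split => //.
apply: filterS2 (nbhs_interior fg) h => y; exact: der_near.
Qed.

Lemma c1C (c : R) s : c1 (fun=> c) s.
Proof. by apply: (c1_isder (d := fun=> 0)) => [y|]; [exact: derC|exact: cvg_cst]. Qed.

Lemma c1I s : c1 (fun y => y) s.
Proof. by apply: (c1_isder (d := fun=> 1)) => [y|]; [exact: derI|exact: cvg_cst]. Qed.

Lemma c1D f g s : c1 f s -> c1 g s -> c1 (fun y => f y + g y) s.
Proof.
move=> [d [h dc]] [e [k ec]]; exists (fun y => d y + e y); split; last exact: cvgD.
by apply: filterS2 h k => y; exact: derD.
Qed.

Lemma c1M f g s : c1 f s -> c1 g s -> c1 (fun y => f y * g y) s.
Proof.
move=> hf hg; have fc := c1_cvg hf; have gc := c1_cvg hg.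
case: hf hg => [d [h dc]] [e [k ec]]; exists (fun y => d y * g y + f y * e y); split.
  by apply: filterS2 h k => y; exact: derM.
by apply: cvgD; apply: cvgM.
Qed.

Lemma c1N f s : c1 f s -> c1 (fun y => - f y) s.
Proof.
move=> [d [h dc]]; exists (fun y => - d y); split; last exact: cvgN.
by apply: filterS h => y; exact: derN.
Qed.

Lemma c1V f s : f s != 0 -> c1 f s -> c1 (fun y => (f y)^-1) s.
Proof.
move=> f0 hf; have fc := c1_cvg hf.
case: hf => [d [h dc]]; exists (fun y => - d y / f y ^+ 2); split.
  have n0 : \forall y \near s, f y != 0.
    by apply: (fc [set z | z != 0]); apply: open_nbhs_nbhs; split => //; exact: open_neq.
  by apply: filterS2 h n0 => y hy ny; exact: derV.
apply: cvgM; first exact: cvgN.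
apply: cvgV; first by rewrite expf_neq0.
by rewrite /GRing.exp; apply: cvgM.
Qed.

Lemma c1_comp f g s : c1 f s -> c1 g (f s) -> c1 (fun y => g (f y)) s.
Proof.
move=> hf; have fc := c1_cvg hf.
case: hf => [d [h dc]] [e [k ec]]; exists (fun y => e (f y) * d y); split.
  by apply: filterS2 h (fc _ k) => y; exact: der_comp.
by apply: cvgM => //; exact: (cvg_comp f e fc ec).
Qed.

(** The kernel [k] oscillates in the sense that it has a bounded primitive [u] up to an error
    $O(1/t)$. For $\sqrt t J_0$ take $u=\sqrt t J_1$; for $\sqrt t J_1$ take $u=-\sqrt t J_0$. *)
Variables (k u e : R -> R) (C : R).
Hypothesis kc : forall t : R, k y @[y --> t] --> k t.
Hypothesis ec : forall t : R, 0 < t -> e y @[y --> t] --> e t.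
Hypothesis kC : forall t, 0 < t -> `|k t| <= C.
Hypothesis uC : forall t, 0 < t -> `|u t| <= C.
Hypothesis eC : forall t, 0 < t -> `|e t| <= C / t.
Hypothesis du : forall t, 0 < t -> isder u t (k t + e t).

Let C0 : 0 <= C. Proof. exact: le_trans (kC ltr01). Qed.

Definition osc_null (D : set R) g : Prop :=
  Rintegral mu D (fun s => g s * k (x * s)) @[x --> +oo] --> (0 : R).

Lemma cvg_arg (w : R -> R) x s : w y @[y --> x * s] --> w (x * s) ->
  w (x * y) @[y --> s] --> w (x * s).
Proof.
move=> wc; apply: (cvg_comp (fun y => x * y) w) wc.
by apply: cvgM; [exact: cvg_cst|exact: cvg_id].
Qed.

(* [u (x * s) / x] is a primitive of [k (x * s)] up to [O(1/x)]: integrate by parts. *)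
Lemma osc_null_cc g a0 a b b0 : 0 <= a0 -> a0 < a -> a < b -> b < b0 ->
  (forall s, a0 < s < b0 -> c1 g s) -> osc_null `[a, b] g.
Proof.
move=> a00 a0a ab bb0 gC.
pose d := g^`()%classic.
have gd s : a0 < s < b0 -> isder g s (d s) by move=> /gC; exact: c1_der.
have dc s : a0 < s < b0 -> d y @[y --> s] --> d s by move=> /gC; exact: c1_cvg_derive1.
have sub s : a <= s <= b -> a0 < s < b0.
  by move=> /andP[? ?]; apply/andP; split; lra.
have bnd (w : R -> R) : (forall s, a0 < s < b0 -> w y @[y --> s] --> w s) ->
    exists M, forall s, a <= s <= b -> `|w s| <= M.
  move=> wc; have [|c _ hc] := @EVT_max R (fun s => `|w s|) a b (ltW ab).
    apply: (@continuous_in_subspaceT _ _ `[a, b] (fun s => `|w s|)) => s /set_mem /=.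
    by rewrite in_itv/= => /sub/wc; exact: cvg_norm.
  by exists `|w c| => s sab; apply: hc; rewrite in_itv.
have [Gm hG] := bnd _ (fun s h => der_cvg (gd s h)).
have [Dm hD] := bnd _ dc.
have aab : a <= a <= b by rewrite lexx ltW.
have bab : a <= b <= b by rewrite lexx ltW.
have G0 : 0 <= Gm := le_trans (normr_ge0 _) (hG _ aab).
have D0 : 0 <= Dm := le_trans (normr_ge0 _) (hD _ aab).
have a_gt0 : 0 < a by lra.
pose K := 2 * (Gm * C) + (b - a) * (Dm * C + Gm * (C / a)).
have key x : 0 < x -> `|Rintegral mu `[a, b] (fun s => g s * k (x * s))| <= K * x^-1.
  move=> x0.
  pose r s := d s * u (x * s) + g s * (x * e (x * s)).
  pose h s := g s * k (x * s).
  have xs s : a0 < s < b0 -> 0 < x * s.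
    by move=> /andP[s0 _]; rewrite mulr_gt0//; lra.
  have dH s : a0 < s < b0 -> isder (fun s => g s * u (x * s)) s (r s + x * h s).
    move=> hs; have dx : isder (fun y : R => x * y) s x by der; ring.
    apply: der_eq; first by apply: derM; [exact: gd|exact: der_comp dx (du (xs _ hs))].
    by rewrite /r /h; ring.
  have rc s : a0 < s < b0 -> r y @[y --> s] --> r s.
    move=> hs; apply: cvgD; apply: cvgM.
    - exact: dc.
    - by apply: cvg_arg; exact: der_cvg (du (xs _ hs)).
    - exact: der_cvg (gd _ hs).
    - by apply: cvgM; [exact: cvg_cst|apply: cvg_arg; exact: ec (xs _ hs)].
  have hc s : a0 < s < b0 -> h y @[y --> s] --> h s.
    move=> hs; apply: cvgM; first exact: der_cvg (gd _ hs).
    by apply: cvg_arg; exact: kc.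
  have int (w : R -> R) : (forall s, a0 < s < b0 -> w y @[y --> s] --> w s) ->
      mu.-integrable `[a, b] (EFin \o w).
    move=> wc; apply: continuous_compact_integrable; first exact: segment_compact.
    by apply: continuous_in_subspaceT => s /set_mem /=; rewrite in_itv/= => /sub/wc.
  have F := FTC_cc a0a ab bb0 dH (fun s hs => cvgD (rc _ hs) (cvgM (cvg_cst x) (hc _ hs))).
  have mab : measurable (`[a, b] : set (measurableTypeR R)) by exact: measurable_itv.
  have [_ E1] := has_intD mab (has_int_self (int _ rc)) (has_intZ x mab (has_int_self (int _ hc))).
  have E2 : Rintegral mu `[a, b] r + x * Rintegral mu `[a, b] h =
      g b * u (x * b) - g a * u (x * a).
    by rewrite -E1 /Rintegral F.
  have rb : `|Rintegral mu `[a, b] r| <= (b - a) * (Dm * C + Gm * (C / a)).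
    apply: le_trans (le_normr_Rintegral mab (int _ rc)) _.
    apply: (@le_trans _ _ (Rintegral mu `[a, b] (fun=> Dm * C + Gm * (C / a)))).
      apply: le_Rintegral => //.
      - apply: int => s hs; apply: cvg_norm; exact: rc.
      - by apply: int => s hs; exact: cvg_cst.
      move=> s /=; rewrite in_itv/= => sab; rewrite /r.
      have xs0 : 0 < x * s by apply: xs; exact: sub.
      apply: le_trans (ler_normD _ _) _; rewrite !normrM; apply: lerD.
        by apply: ler_pM => //; [exact: hD|exact: uC].
      apply: ler_pM => //; [exact: hG|].
      rewrite (gtr0_norm x0); apply: le_trans (ler_wpM2l (ltW x0) (eC xs0)) _.
      have s0 : 0 < s by move: sab => /andP[? _]; lra.
      rewrite (_ : x * (C / (x * s)) = C / s); last by field; rewrite !gt_eqF.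
      by rewrite ler_wpM2l// lef_pV2 ?posrE//; case/andP: sab.
    rewrite Rintegral_cst//= lebesgue_measure_itv/= lte_fin ab /=.
    by rewrite mulrC.
  have E3 : Rintegral mu `[a, b] h = (g b * u (x * b) - g a * u (x * a) - Rintegral mu `[a, b] r) / x.
    by rewrite -E2; field; rewrite gt_eqF.
  rewrite -/h E3 normrM normfV (gtr0_norm x0) ler_wpM2r ?invr_ge0 ?(ltW x0)//.
  apply: le_trans (ler_normB _ _) _; rewrite /K; apply: lerD => //.
  have gu s : a <= s <= b -> `|g s * u (x * s)| <= Gm * C.
    by move=> sab; rewrite normrM ler_pM// ?hG ?uC// xs// sub.
  apply: le_trans (ler_normB _ _) _; have := gu _ aab; have := gu _ bab; lra.
rewrite /osc_null; apply: norm_cvg0.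
apply: (@squeeze_cvgr _ _ _ _ (fun=> 0) (fun x => K * x^-1)).
- by near=> x; rewrite normr_ge0 key.
- exact: cvg_cst.
- rewrite -(mulr0 K); apply: cvgM; first exact: cvg_cst.
  by apply/gtr0_cvgV0; [near=> x|exact: cvg_id].
Unshelve. all: by end_near. Qed.

Lemma osc_integrable (D : set (measurableTypeR R)) g x : measurable D ->
  (forall s, D s -> 0 < s) -> 0 < x ->
  mu.-integrable D (EFin \o g) -> mu.-integrable D (EFin \o (fun s => g s * k (x * s))).
Proof.
move=> mD D0 x0 gi; apply: (integrableM_bounded (C := C)) => //.
- apply: measurable_funTS; apply: continuous_measurable => s; apply: cvg_arg; exact: kc.
- by move=> s /D0 s0; apply: kC; rewrite mulr_gt0.
Qed.

(** As [k] is bounded, the part of the integral outside [E n] is at most [C] times the mass of $|g|$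
    there, uniformly in the frequency. The quotient by [C + 1] covers the case $C=0$. *)
Lemma osc_null_exhaust (D : set (measurableTypeR R)) (E : nat -> set (measurableTypeR R)) g :
  measurable D -> (forall n, measurable (E n)) -> (forall n, E n `<=` D) ->
  (forall s, D s -> \forall n \near \oo, E n s) -> (forall s, D s -> 0 < s) ->
  mu.-integrable D (EFin \o g) -> (forall n, osc_null (E n) g) -> osc_null D g.
Proof.
move=> mD mE ED DE D0 gi hE.
have ai : mu.-integrable D (EFin \o (fun s => `|g s|)) by exact: integrable_norm.
have aiE n : mu.-integrable (E n) (EFin \o (fun s => `|g s|)).
  by apply: (integrableS mD (mE n) (@ED n)).
have lim := @cvg_integral_increasing_integrable _ _ _ mu D E _ mD mE ED DE _ ai.
have {}lim : Rintegral mu (E n) (fun s => `|g s|) @[n --> \oo] --> Rintegral mu D (fun s => `|g s|).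
  apply: fine_cvg; rewrite fineK; first by apply: lim; have /integrableP[] := ai.
  exact: integrable_fin_num ai.
apply/cvgrPdist_le => eps eps0.
have c0 := C0; have C1 : 0 < C + 1 by lra.
have [n hn] : exists n, Rintegral mu D (fun s => `|g s|) - Rintegral mu (E n) (fun s => `|g s|)
    <= eps / 2 / (C + 1).
  have h : 0 < eps / 2 / (C + 1) by rewrite !divr_gt0.
  have [N _ hN] := (cvgrPdist_le _ _).1 lim _ h.
  by exists N; apply: le_trans (ler_norm _) _; apply: hN; exact: leqnn.
have e2 : 0 < eps / 2 by lra.
have {}hE := (cvgrPdist_le _ _).1 (hE n) _ e2.
near=> x; rewrite sub0r normrN.
have x0 : 0 < x by [].
have hx : `|Rintegral mu (E n) (fun s => g s * k (x * s))| <= eps / 2.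
  have : `|0 - Rintegral mu (E n) (fun s => g s * k (x * s))| <= eps / 2 by near: x; exact: hE.
  by rewrite sub0r normrN.
have mDE : measurable (D `\` E n) by exact: measurableD.
have fi := osc_integrable mD D0 x0 gi.
have DDE : D = E n `|` (D `\` E n) by rewrite setDUK.
have DI : E n `&` (D `\` E n) = set0 by rewrite setDIK.
have hs F : measurable F -> F `<=` D -> mu.-integrable F (EFin \o (fun s => g s * k (x * s))).
  by move=> mF FD; exact: integrableS mD mF FD fi.
have sD : D `\` E n `<=` D by move=> s [].
have [_ s1] := has_int_setU (mE n) mDE DI (has_int_self (hs _ (mE n) (@ED n))) (has_int_self (hs _ mDE sD)).
have [_ s2] := has_int_setU (mE n) mDE DI (has_int_self (aiE n))
  (has_int_self (integrableS mD mDE sD ai)).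
rewrite -DDE in s1 s2; rewrite s1.
apply: le_trans (ler_normD _ _) _.
have r2 : `|Rintegral mu (D `\` E n) (fun s => g s * k (x * s))| <= C * (eps / 2 / (C + 1)).
  apply: le_trans (le_normr_Rintegral mDE (hs _ mDE sD)) _.
  apply: (@le_trans _ _ (Rintegral mu (D `\` E n) (fun s => C * `|g s|))).
    apply: le_Rintegral => //.
    - by apply: integrable_norm; exact: hs.
    - by have [] := has_intZ C mDE (has_int_self (integrableS mD mDE sD ai)).
    move=> s [Ds _]; rewrite normrM mulrC ler_wpM2r// kC// mulr_gt0// D0//.
  have [_ ->] := has_intZ C mDE (has_int_self (integrableS mD mDE sD ai)).
  by rewrite ler_wpM2l//; apply: le_trans hn; rewrite s2 [X in X - _]addrC addrK.
have r3 : C * (eps / 2 / (C + 1)) <= eps / 2.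
  by rewrite mulrCA ler_piMr ?(ltW e2)// ler_pdivrMr// mul1r lerDl.
by rewrite [leRHS]splitr; apply: lerD => //; exact: le_trans r2 r3.
Unshelve. all: by end_near. Qed.

Lemma osc_null_oo g a b : 0 <= a -> a < b -> mu.-integrable `]a, b[ (EFin \o g) ->
  (forall s, a < s < b -> c1 g s) -> osc_null `]a, b[ g.
Proof.
move=> a0 ab gi gC.
pose h n : R := (b - a) / (n.+3)%:R.
have h0 n : 0 < h n by rewrite divr_gt0// subr_gt0.
have h3 n : h n <= (b - a) / 3.
  rewrite /h ler_wpM2l ?subr_ge0 ?(ltW ab)// lef_pV2 ?posrE//.
  by rewrite ler_nat.
have hc : h n @[n --> \oo] --> 0.
  rewrite -(mulr0 (b - a)); apply: cvgM; first exact: cvg_cst.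
  by have := @cvg_harmonic R; rewrite -(cvg_shiftn 2) => hh; apply: cvg_trans hh; apply: near_eq_cvg; apply: nearW => n; rewrite /= addn2.
apply: (@osc_null_exhaust `]a, b[ (fun n => `[a + h n, b - h n]%classic)) => //.
- by move=> n s /=; rewrite !in_itv/= => /andP[? ?]; have hn := h0 n; apply/andP; split; lra.
- move=> s /=; rewrite in_itv/= => /andP[s1 s2].
  have m0 : 0 < Num.min (s - a) (b - s) by rewrite lt_min; apply/andP; split; lra.
  near=> n; have : `|0 - h n| < Num.min (s - a) (b - s).
    by near: n; exact: ((cvgrPdist_lt _ _).1 hc _ m0).
  rewrite sub0r normrN gtr0_norm ?h0// lt_min => /andP[? ?].
  by rewrite /= in_itv/=; apply/andP; split; lra.
- by move=> s /=; rewrite in_itv/= => /andP[? _]; exact: le_lt_trans a0 _.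
- move=> n; have hn := h0 n; have hn3 := h3 n.
  by apply: (osc_null_cc (a0 := a) (b0 := b)) => //; lra.
Unshelve. all: by end_near. Qed.

(** Induction on the list: an exceptional point inside the interval splits it, one outside is
    dropped. *)
Lemma osc_null_except (S : seq R) g : forall a b, 0 <= a -> a < b ->
  mu.-integrable `]a, b[ (EFin \o g) ->
  (forall s, a < s < b -> s \notin S -> c1 g s) -> osc_null `]a, b[ g.
Proof.
elim: S => [|z S IH] a b a0 ab gi gC.
  by apply: osc_null_oo => // s sab; exact: gC.
have [/andP[az zb]|zab] := boolP (a < z < b); last first.
  apply: IH => // s sab sS; apply: gC => //; rewrite inE negb_or sS andbT.
  by apply: contraNneq zab => <-.
have i1 : mu.-integrable `]a, z[ (EFin \o g).
  apply: integrableS gi => //; move=> s /=; rewrite !in_itv/= => /andP[-> ?]; lra.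
have i2 : mu.-integrable `]z, b[ (EFin \o g).
  apply: integrableS gi => // s /=; rewrite !in_itv/= => /andP[? ->]; lra.
have h1 : osc_null `]a, z[ g.
  apply: IH => // s /andP[s1 s2] sS; apply: gC; first by rewrite s1 (lt_trans s2 zb).
  by rewrite inE negb_or sS andbT lt_eqF.
have h2 : osc_null `]z, b[ g.
  apply: IH => //; first exact: ltW (le_lt_trans a0 az).
  move=> s /andP[s1 s2] sS; apply: gC; first by rewrite s2 (lt_trans az s1).
  by rewrite inE negb_or sS andbT gt_eqF.
have h12 : Rintegral mu `]a, z[ (fun s => g s * k (x * s)) +
    Rintegral mu `]z, b[ (fun s => g s * k (x * s)) @[x --> +oo] --> (0 : R).
  by rewrite -(addr0 0); exact: cvgD h1 h2.
apply: (cvg_trans _ h12); apply: near_eq_cvg; near=> x.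
have x0 : 0 < x by [].
have pos c : 0 <= c -> forall s, `]c, b[%classic s -> 0 < s.
  by move=> c0 s /=; rewrite in_itv/= => /andP[? _]; exact: le_lt_trans c0 _.
have fi := osc_integrable (measurable_itv _) (pos a a0) x0 gi.
have posz : forall s, `]a, z[%classic s -> 0 < s.
  by move=> s /=; rewrite in_itv/= => /andP[? _]; exact: le_lt_trans a0 _.
have f1 := osc_integrable (measurable_itv _) posz x0 i1.
have z0 : 0 <= z by exact: ltW (le_lt_trans a0 az).
have f2 := osc_integrable (measurable_itv _) (pos z z0) x0 i2.
have I0 : `]a, z[%classic `&` `]z, b[%classic = set0 :> set R.
  by apply/seteqP; split => s //= []; rewrite !in_itv/= => /andP[_ ?] /andP[? _]; lra.
have [_ <-] := has_int_setU (measurable_itv _) (measurable_itv _) I0 (has_int_self f1) (has_int_self f2).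
have e1 : `]a, z[%classic `|` `]z, b[%classic = `]a, b[ `\ z :> set R.
  apply/seteqP; split => s /=; rewrite !in_itv/=.
    by move=> [|] /andP[s1 s2]; (split; [apply/andP; split; lra|lra]).
  by move=> [/andP[s1 s2] /eqP]; rewrite neq_lt => /orP[?|?]; [left|right]; apply/andP.
rewrite e1 /Rintegral integral_setD1//.
- by apply: measurableD => //; exact: measurable_itv.
- have /integrableP[mf _] := fi; apply: measurable_funS mf => // s [].
Unshelve. all: by end_near. Qed.

Lemma riemann_lebesgue (S : seq R) g : mu.-integrable setT (EFin \o g) ->
  (forall s, s <= 0 -> g s = 0) ->
  (forall s, 0 < s -> s \notin S -> c1 g s) -> osc_null setT g.
Proof.
move=> gi g0 gC.
have mp : measurable (`]0, +oo[%classic : set (measurableTypeR R)) by exact: measurable_itv.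
have gp : mu.-integrable `]0, +oo[ (EFin \o g) by apply: integrableS gi.
have h : osc_null `]0, +oo[ g.
  apply: (@osc_null_exhaust `]0, +oo[ (fun n => `]0, n.+1%:R[%classic)) => //.
  - by move=> n s /=; rewrite !in_itv/= => /andP[-> _].
  - move=> s /=; rewrite in_itv/= andbT => s0; near=> n; rewrite /= in_itv/= s0/=.
    apply: (@lt_le_trans _ _ (Num.trunc s).+1%:R); first by apply: truncnS_gt.
    by rewrite ler_nat ltnS; near: n; exact: nbhs_infty_ge.
  - by move=> s /=; rewrite in_itv/= andbT.
  - move=> n; apply: (osc_null_except (S := S)) => //.
      by apply: integrableS gi.
    by move=> s /andP[s0 _]; exact: gC.
rewrite /osc_null.
suff -> : (fun x => Rintegral mu setT (fun s => g s * k (x * s))) =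
    fun x => Rintegral mu `]0, +oo[ (fun s => g s * k (x * s)) by exact: h.
apply/funext => x; rewrite [RHS]Rintegral_mkcond; apply: eq_Rintegral => s _.
rewrite patchE; case: ifPn => // /negP hs; rewrite g0 ?mul0r// leNgt.
by apply/negP => s0; apply: hs; apply/mem_set; rewrite /= in_itv/= s0.
Unshelve. all: by end_near. Qed.

End RiemannLebesgue.

(** * Hankel inversion *)

Section Inversion.
Context {R : realType}.
Local Notation mu := (@lebesgue_measure R).
Let mT : measurable ([set: R] : set (measurableTypeR R)) := measurableT.
Implicit Types (s t x r : R).

(** The continuous functions $x/(x^2+1/(n+1))$ converge to the inverse everywhere, also at 0 because
    of the convention $0^{-1}=0$. *)
Lemma measurable_inv : measurable_fun setT (fun x : R => x^-1).
Proof.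
apply: (@measurable_fun_cvg _ _ _ _ (fun n x => x / (x ^+ 2 + n.+1%:R^-1))) => [n|x _].
  apply: der_measurable => x.
  have p0 : x ^+ 2 + n.+1%:R^-1 != 0 :> R.
    by rewrite gt_eqF// ltr_wpDl ?sqr_ge0// invr_gt0.
  eexists; apply: derM; [exact: derI|apply: derV; [exact: p0|]].
  by apply: derD; [apply: derX; exact: derI|exact: derC].
have [->|x0] := eqVneq x 0.
  by rewrite invr0; apply: cvg_near_cst; apply: nearW => n; rewrite mul0r.
have x2 : x ^+ 2 + 0 != 0 by rewrite addr0 expf_neq0.
have : x / (x ^+ 2 + n.+1%:R^-1) @[n --> \oo] --> x / (x ^+ 2 + 0).
  apply: cvgM; first exact: cvg_cst.
  apply: cvgV => //; apply: cvgD; [exact: cvg_cst|exact: cvg_harmonic].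
by rewrite addr0 expr2 invfM mulrA mulfV// mul1r.
Qed.

Lemma measurable_J0 : measurable_fun setT (@J0 R).
Proof. by apply: continuous_measurable => x; exact: cvg_J0. Qed.

Lemma J0N x : J0 (- x) = J0 x.
Proof. by rewrite /J0 sqrrN. Qed.

Definition bessC : R := xget 0 [set C | 0 <= C /\ forall t, 0 <= t -> t * (J0 t ^+ 2 + J1 t ^+ 2) <= C].

Lemma bessCP : 0 <= bessC /\ forall t, 0 <= t -> t * (J0 t ^+ 2 + J1 t ^+ 2) <= bessC.
Proof. by have [C hC] := @bessel_bound R; rewrite /bessC; case: xgetP => [y _ //|/(_ C)]. Qed.

(** The bound [bessC + 1] stands in for the square root of [bessC], since $C\le(C+1)^2$. *)
Lemma sqrt_bound (x t : R) : 0 <= t -> t * x ^+ 2 <= bessC -> `|Num.sqrt t * x| <= bessC + 1.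
Proof.
move=> t0 h; have [c0 _] := bessCP.
rewrite -(@ler_pXn2r _ 2)// ?nnegrE ?normr_ge0 ?addr_ge0// -normrX exprMn (sqr_sqrtr t0) ger0_norm; last by apply: mulr_ge0 => //; exact: sqr_ge0.
by apply: le_trans h _; nra.
Qed.

Lemma sqrtJ0_bound t : 0 <= t -> `|Num.sqrt t * J0 t| <= bessC + 1.
Proof.
move=> t0; apply: sqrt_bound => //; apply: le_trans (bessCP.2 _ t0).
by rewrite ler_wpM2l// lerDl sqr_ge0.
Qed.

Lemma sqrtJ1_bound t : 0 <= t -> `|Num.sqrt t * J1 t| <= bessC + 1.
Proof.
move=> t0; apply: sqrt_bound => //; apply: le_trans (bessCP.2 _ t0).
by rewrite ler_wpM2l// lerDr sqr_ge0.
Qed.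

Lemma J0_bounded : exists B, 0 <= B /\ forall x, `|@J0 R x| <= B.
Proof.
have [|c _ hc] := @EVT_max R (fun t => `|J0 t|) 0 1 ler01.
  by apply: continuous_subspaceT => t; apply: cvg_norm; exact: cvg_J0.
have [C0 _] := bessCP.
exists (`|J0 c| + (bessC + 1)); split; first by rewrite !addr_ge0.
have pos x : 0 <= x -> `|J0 x| <= `|J0 c| + (bessC + 1).
  move=> x0; case: (leP x 1) => x1.
    by apply: le_trans (hc x _) _; rewrite ?in_itv/= ?x0// lerDl addr_ge0.
  have s1 : 1 <= Num.sqrt x by rewrite -(@sqrtr1 R) ler_wsqrtr// ltW.
  apply: (@le_trans _ _ (`|Num.sqrt x * J0 x|)).
    by rewrite normrM ler_peMl// ger0_norm// (le_trans ler01).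
  by apply: le_trans (sqrtJ0_bound x0) _; rewrite lerDr.
by move=> x; have [|/ltW x0] := leP 0 x; [exact: pos|rewrite -J0N; apply: pos; rewrite oppr_ge0].
Qed.

Let sqrt_err (w : R) t : 0 < t -> `|Num.sqrt t * w| <= bessC + 1 ->
  `|w / (2 * Num.sqrt t)| <= (bessC + 1) / t.
Proof.
move=> t0 h; have s0 : 0 < Num.sqrt t by rewrite sqrtr_gt0.
have c0 := bessCP.1.
have e : w / (2 * Num.sqrt t) = (Num.sqrt t * w) / (2 * t).
  have e2 := sqr_sqrtr (ltW t0); rewrite -[X in _ = _ / (2 * X)]e2 {e2}; move: s0; move: (Num.sqrt t) => z z0.
  by field; rewrite gt_eqF.
rewrite e normrM; apply: ler_pM => //.
by rewrite ger0_norm ?invr_ge0 ?mulr_ge0 ?(ltW t0)// lef_pV2 ?posrE ?mulr_gt0//; lra.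
Qed.

Let cvg_sqrtM (w : R -> R) t : w y @[y --> t] --> w t ->
  Num.sqrt y * w y @[y --> t] --> Num.sqrt t * w t.
Proof. by move=> wc; apply: cvgM => //; exact: sqrt_continuous. Qed.

Let cvg_err (w : R -> R) t : 0 < t -> w y @[y --> t] --> w t ->
  w y / (2 * Num.sqrt y) @[y --> t] --> w t / (2 * Num.sqrt t).
Proof.
move=> t0 wc; apply: cvgM => //; apply: cvgV.
  by rewrite mulf_neq0// gt_eqF// sqrtr_gt0.
by apply: cvgM; [exact: cvg_cst|exact: sqrt_continuous].
Qed.

Lemma riemann_lebesgue_J0 (S : seq R) g : mu.-integrable setT (EFin \o g) ->
  (forall s, s <= 0 -> g s = 0) -> (forall s, 0 < s -> s \notin S -> c1 g s) ->
  osc_null (fun t => Num.sqrt t * J0 t) setT g.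
Proof.
apply: (@riemann_lebesgue _ _ (fun t => Num.sqrt t * J1 t) (fun t => - (J1 t / (2 * Num.sqrt t))) (bessC + 1)).
- by move=> t; apply: cvg_sqrtM; exact: cvg_J0.
- by move=> t t0; apply: cvgN; apply: cvg_err => //; exact: cvg_J1.
- by move=> t t0; apply: sqrtJ0_bound; exact: ltW.
- by move=> t t0; apply: sqrtJ1_bound; exact: ltW.
- by move=> t t0; rewrite normrN; apply: sqrt_err => //; apply: sqrtJ1_bound; exact: ltW.
- move=> t t0; have tn : t != 0 by rewrite gt_eqF.
  apply: der_eq; first by apply: derM; [exact: (is_derive1_sqrt t0)|exact: der_J1 tn].
  have s0 : 0 < Num.sqrt t by rewrite sqrtr_gt0.
  have e2 := sqr_sqrtr (ltW t0); rewrite -[X in J1 t / X]e2; move: s0; move: (Num.sqrt t) => z z0.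
  by field; rewrite gt_eqF.
Qed.

Lemma riemann_lebesgue_J1 (S : seq R) g : mu.-integrable setT (EFin \o g) ->
  (forall s, s <= 0 -> g s = 0) -> (forall s, 0 < s -> s \notin S -> c1 g s) ->
  osc_null (fun t => Num.sqrt t * J1 t) setT g.
Proof.
apply: (@riemann_lebesgue _ _ (fun t => - (Num.sqrt t * J0 t)) (fun t => - (J0 t / (2 * Num.sqrt t))) (bessC + 1)).
- by move=> t; apply: cvg_sqrtM; exact: cvg_J1.
- by move=> t t0; apply: cvgN; apply: cvg_err => //; exact: cvg_J0.
- by move=> t t0; apply: sqrtJ1_bound; exact: ltW.
- by move=> t t0; rewrite normrN; apply: sqrtJ0_bound; exact: ltW.
- by move=> t t0; rewrite normrN; apply: sqrt_err => //; apply: sqrtJ0_bound; exact: ltW.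
- move=> t t0.
  apply: der_eq; first by apply: derN; apply: derM; [exact: (is_derive1_sqrt t0)|exact: der_J0].
  by field; rewrite gt_eqF// sqrtr_gt0.
Qed.

Definition lommel r s T : R := Rintegral mu `[0, T] (fun t => t * J0 (r * t) * J0 (t * s)).

Lemma lommelE r s T : 0 < T -> (s ^+ 2 - r ^+ 2) * lommel r s T =
  T * (s * J1 (T * s) * J0 (T * r) - r * J0 (T * s) * J1 (T * r)).
Proof.
move=> T0.
have da c x : isder (fun y : R => c * y) x c by der; ring.
have dxJ c x := der_comp (da c x) (der_xJ1 (c * x)).
have dJ c x := der_comp (da c x) (der_J0 (c * x)).
(* Up to sign, [t] times the Wronskian of $J_0(rt)$ and $J_0(st)$: the Sturm-Liouville form of
   Bessel's equation leaves only the difference of the eigenvalues. *)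
pose L t := (s * t) * J1 (s * t) * J0 (r * t) - J0 (s * t) * ((r * t) * J1 (r * t)).
pose f t := t * J0 (r * t) * J0 (t * s).
have dL t : isder L t ((s ^+ 2 - r ^+ 2) * f t).
  apply: der_eq.
    by apply: derD; [apply: derM; [exact: dxJ|exact: dJ]|apply: derN; apply: derM; [exact: dJ|exact: dxJ]].
  by rewrite /f (mulrC t s) /=; ring.
have fc t : f y @[y --> t] --> f t.
  by apply: cvgM; [apply: cvgM => //; exact: der_cvg (dJ r t)|
    rewrite /= (mulrC t s); under eq_fun do rewrite (mulrC _ s); exact: der_cvg (dJ s t)].
have m1 : (-1 : R) < 0 by lra.
have T1 : T < T + 1 by lra.
have F := FTC_cc m1 T0 T1 (fun t _ => dL t) (fun t _ => cvgM (cvg_cst _) (fc t)).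
have fi := integrable_cc 0 T fc.
have [_ <-] := has_intZ (s ^+ 2 - r ^+ 2) (measurable_itv _) (has_int_self fi).
rewrite /Rintegral F /L [fine _]/= !mulr0 !mul0r !mulr0 !subr0 ![T * _]mulrC; ring.
Qed.

(** * Inversion at a fixed point away from the singularities *)

Section At.
Variable r : R.
Hypotheses (r0 : 0 < r) (r1 : r ^+ 2 != 1) (r9 : r ^+ 2 != 9).

(* Subtracting this multiple of a Gaussian Hankel pair makes the function vanish
   at [r], which cancels the pole of the Lommel kernel there. *)
Definition hankc : R := hexp kap r / gaussp 1 r.
Definition hankD s : R := hexp kap s - hankc * gaussp 1 s.

Let gr0 : 0 < gaussp 1 r.
Proof. by rewrite gausspE ltW// !mulr_gt0 ?expR_gt0. Qed.

Lemma hankD_r : hankD r = 0.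
Proof. by rewrite /hankD /hankc divfK ?subrr// gt_eqF. Qed.

Lemma hexp_out s : s <= 0 -> hexp kap s = 0.
Proof. by move=> s0; rewrite hexpE ltNge s0. Qed.

Lemma hankD_out s : s <= 0 -> hankD s = 0.
Proof.
move=> s0; rewrite /hankD hexp_out// gausspE; case: ifP => [s1|_]; last by rewrite mulr0 subr0.
by have -> : s = 0; [apply/eqP; rewrite eq_le s0 s1|rewrite mulr0 mul0r mulr0 subr0].
Qed.

Lemma c1_hypF x : 0 < x -> x != 1 -> x != 9 -> c1 (hypF kap) x.
Proof.
move=> x0 x1 x9; exists (hypF' kap).
have n1 : \forall y \near x, y != 1 by apply: open_nbhs_nbhs; split => //; exact: open_neq.
have n0 : \forall y \near x, 0 < y by apply: open_nbhs_nbhs; split => //; exact: open_gt.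
split; first by apply: filterS2 n0 n1 => y y0 y1; apply: der_hypF; apply: zmap_okP => //; exact: ltW.
have cube y : cubic y = y * (y - 1) * (y - 9) by rewrite /cubic; ring.
have n9 : \forall y \near x, y != 9 by apply: open_nbhs_nbhs; split => //; exact: open_neq.
have c0 y : 0 < y -> y != 1 -> y != 9 -> cubic y != 0.
  by move=> y0 y1 y9; rewrite cube !mulf_neq0 ?subr_eq0// gt_eqF.
(* The product [cubic * hypF'] is differentiable by the self-adjoint equation, hence continuous;
   dividing by [cubic] is possible away from its zeros. *)
have h : cubic y * hypF' kap y / cubic y @[y --> x] --> cubic x * hypF' kap x / cubic x.
  apply: cvgM; first by apply: (der_cvg (hypF_ode kap _)); apply: zmap_okP => //; exact: ltW.
  by apply: cvgV; [exact: c0|exact: der_cvg (der_cubic x)].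
rewrite mulrAC mulfV ?c0// mul1r in h.
apply: (cvg_trans _ h); apply: near_eq_cvg; near=> y.
rewrite mulrAC mulfV ?mul1r//; apply: c0; [near: y; exact: n0|near: y; exact: n1|near: y; exact: n9].
Unshelve. all: by end_near. Qed.

Lemma c1_hexp s : 0 < s -> s \notin [:: 1; 3] -> c1 (hexp kap) s.
Proof.
move=> s0; rewrite !inE negb_or => /andP[s1 s3].
have [s3'|s3'] := ltP s 3; last first.
  have {}s3' : 3 < s by rewrite lt_neqAle eq_sym s3.
  apply: (@c1_near _ (fun=> 0)); last exact: c1C.
  have : \forall y \near s, 3 < y by apply: open_nbhs_nbhs; split => //; exact: open_gt.
  apply: filterS => y y3; rewrite hexpE; case: ifP => // y0.
  by rewrite hexf_out ?mulr0// gtr0_norm.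
have nz (c : R) : 0 < c -> s != c -> s ^+ 2 != c ^+ 2.
  by move=> c0 sc; rewrite eqf_sqr negb_or sc/= gt_eqF//; lra.
have e1 : s ^+ 2 != 1 by rewrite -[1](expr1n _ 2); exact: nz.
have e9 : s ^+ 2 != 9 by rewrite (_ : 9 = 3 ^+ 2); [exact: nz|ring].
apply: (@c1_near _ (fun s => 2 * s * hypF kap (s ^+ 2))).
  have D : sqD s.
    have [sl|sl] := ltP s 1; [left|right]; rewrite /= in_itv/= ?s0//.
    by rewrite s3' lt_neqAle eq_sym s1 sl.
  have : nbhs s sqD.
    apply: open_nbhs_nbhs; split => //; apply: openU; exact: interval_open.
  by apply: filterS => y Dy; rewrite /hexp patchE mem_set.
apply: c1M; first by apply: c1M; [exact: c1C|exact: c1I].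
apply: (@c1_comp _ (fun s => s ^+ 2)); last by apply: c1_hypF => //; rewrite exprn_gt0.
by apply: c1M; exact: c1I.
Qed.

Lemma c1_gaussp s : 0 < s -> c1 (gaussp 1) s.
Proof.
move=> s0; apply: (@c1_near _ (fun s => 2 * 1 * s * expR (- (1 * s ^+ 2)))).
  have : \forall y \near s, 0 < y by apply: open_nbhs_nbhs; split => //; exact: open_gt.
  by apply: filterS => y y0; rewrite gausspE ltW.
apply: c1M; first by apply: c1M; [exact: c1C|exact: c1I].
apply: (@c1_comp _ (fun s => - (1 * s ^+ 2)) expR).
  by apply: c1N; apply: c1M; [exact: c1C|apply: c1M; exact: c1I].
apply: (c1_isder (d := expR)); last exact: continuous_expR.
by move=> y; exact: is_derive_expR.
Qed.

Lemma c1_hankD s : 0 < s -> s \notin [:: 1; 3] -> c1 hankD s.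
Proof.
move=> s0 s13; apply: c1D; first exact: c1_hexp.
by apply: c1N; apply: c1M; [exact: c1C|exact: c1_gaussp].
Qed.

Let r13 : r \notin [:: 1; 3].
Proof.
rewrite !inE negb_or; apply/andP; split; apply/eqP => e; move: r1 r9.
  by rewrite e expr1n eqxx.
by rewrite e => _ /eqP; apply; ring.
Qed.

Lemma hankD_lip : exists M d, [/\ 0 <= M, 0 < d, d < r &
  forall s, `|s - r| < d -> `|hankD s| <= M * `|s - r|].
Proof.
have [e [he ec]] := c1_hankD r0 r13.
have hb : \forall y \near r, `|e y| <= `|e r| + 1.
  have en : `|e y| @[y --> r] --> `|e r| by exact: cvg_norm.
  near=> y; have : `| `|e r| - `|e y| | <= 1 by near: y; exact: ((cvgrPdist_le _ _).1 en 1 ltr01).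
  by rewrite ler_distlC => /andP[_].
have [d0 /= d00 hd] := (nbhs_ballP _ _).1 (filterI he hb).
pose d := Num.min d0 (r / 2).
have d_0 : 0 < d by rewrite lt_min d00 divr_gt0.
exists (`|e r| + 1), d; split; [by rewrite addr_ge0|exact: d_0|by rewrite gt_min ltr_pdivrMr// ltr_pMr// ltr1n orbT|].
have inb y : r - d < y < r + d -> isder hankD y (e y) /\ `|e y| <= `|e r| + 1.
  move=> /andP[y1 y2]; apply: hd; rewrite /ball/=.
  have dd : d <= d0 by rewrite ge_min lexx.
  by rewrite ltr_distlC; apply/andP; split; lra.
move=> s; rewrite ltr_distlC => /andP[s1 s2].
have hm := @mvt_oo R hankD e (r - d) (r + d) (fun y h => (inb y h).1).
case: (ltgtP s r) => [sr|rs|->]; last by rewrite hankD_r subrr normr0 mulr0.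
- have [c [c1 c2]] := hm s r ltac:(lra) sr ltac:(lra).
  rewrite hankD_r sub0r => /eqP; rewrite eqr_oppLR => /eqP ->.
  rewrite normrN normrM (distrC s r) ler_wpM2r//; apply: (inb c _).2; apply/andP; split; lra.
- have [c [c1 c2]] := hm r s ltac:(lra) rs ltac:(lra).
  rewrite hankD_r subr0 => ->; rewrite normrM ler_wpM2r//; apply: (inb c _).2; apply/andP; split; lra.
Unshelve. all: by end_near. Qed.

(** Below 1/2 the quotient is at most [B], and from 1/2 on it is at most [2 * q s]. *)
Lemma integrable_divs (q : R -> R) (B : R) : (forall s, 0 <= q s) ->
  mu.-integrable setT (EFin \o q) -> (forall s, s <= 0 -> q s = 0) ->
  (forall s, 0 < s < 1 / 2 -> q s <= B * s) ->
  mu.-integrable setT (EFin \o (fun s => q s / s)).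
Proof.
move=> q0 qi qn qB.
have ci : mu.-integrable `[0, 1] (EFin \o (fun=> `|B|)) by apply: integrable_cc => x; exact: cvg_cst.
have hB := has_int_restrict (measurable_itv `[(0 : R), 1]) (has_int_self ci).
have [gi _] := has_intD mT hB (has_intZ 2 mT (has_int_self qi)).
apply: (integrable_le mT gi).
  by apply: measurable_funM; [move/measurable_int : qi => /measurable_EFinP|exact: measurable_inv].
move=> s _; have [s0|s0] := leP s 0.
  by rewrite qn// mul0r normr0 addr_ge0 ?mulr_ge0// patchE; case: ifP.
rewrite ger0_norm ?divr_ge0 ?(ltW s0)//.
have [s2|s2] := ltP s (1 / 2).
  have -> : ((fun=> `|B|) \_ `[0, 1]) s = `|B|.
    by rewrite patchE mem_set//= in_itv/=; apply/andP; split; lra.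
  rewrite ler_wpDr ?mulr_ge0// ler_pdivrMr//; apply: le_trans (qB s _) _; first by rewrite s0.
  by rewrite ler_wpM2r ?ler_norm// ltW.
rewrite ler_wpDl//; first by rewrite patchE; case: ifP.
rewrite mulrC ler_wpM2r// -[X in _ <= X]invrK lef_pV2 ?posrE ?invr_gt0//; lra.
Qed.

Lemma hexp_le : exists B, forall s, 0 < s < 1 / 2 -> hexp kap s <= B * s.
Proof.
have [|c _ hc] := @EVT_max R (hypF kap) 0 (1 / 2) ltac:(lra).
  apply: continuous_in_subspaceT => x /set_mem /=; rewrite in_itv/= => /andP[x0 x1].
  apply: (der_cvg (der_hypF kap (zmap_okP x0 _))); rewrite lt_eqF//; lra.
exists (2 * hypF kap c) => s /andP[s0 s1].
rewrite /hexp patchE mem_set; last by left; rewrite /= in_itv/= s0/=; lra.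
rewrite mulrAC ler_wpM2r ?(ltW s0)// ler_wpM2l//; apply: hc; rewrite in_itv/= sqr_ge0/=; nra.
Qed.

Let hexp_i n := (@hexp_mom R n).1.
Let gauss_i n := (gaussp_mom (@ltr01 R) n).1.

(** For positive [s] the weight $(1+s^2)/s$ dominates both $\sqrt s$ and $1/\sqrt s$, the two powers
    left over when $\sqrt{Ts}$ is attached to the Bessel factors of Lommel's identity. *)
Definition hankQ s : R := `|hankD s| * ((1 + s ^+ 2) / s).

Lemma hankD_measurable : measurable_fun setT hankD.
Proof.
apply: measurable_funB; first exact: hexp_measurable.
by apply: measurable_funM; [exact: measurable_cst|exact: measurable_gaussp ltr01].
Qed.

Lemma hexp_integrable : mu.-integrable setT (EFin \o hexp (R := R) kap).
Proof.
have [h _] := @hexp_mom R 0; apply: eq_integrable h => // s _ /=.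
by rewrite muln0 expr0 mulr1.
Qed.

Lemma gaussp_integrable : mu.-integrable setT (EFin \o gaussp (1 : R)).
Proof.
have [h _] := gaussp_mom (@ltr01 R) 0; apply: eq_integrable h => // s _ /=.
by rewrite muln0 expr0 mulr1.
Qed.

Lemma hankQ_integrable : mu.-integrable setT (EFin \o hankQ).
Proof.
have [B hB] := hexp_le.
have i1 := integrable_divs hexp_ge0 hexp_integrable hexp_out hB.
have gn s : s <= 0 -> gaussp 1 s = 0.
  move=> s0; rewrite gausspE; case: ifP => // s1.
  by have -> : s = 0; [apply/eqP; rewrite eq_le s0 s1|rewrite mulr0 mul0r].
have gB s : 0 < s < 1 / 2 -> gaussp 1 s <= 2 * s.
  move=> /andP[s0 _]; rewrite gausspE (ltW s0) mulr1 ler_piMr ?mulr_ge0 ?(ltW s0)//.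
  by rewrite -[leRHS]expR0 ler_expR oppr_le0 mul1r sqr_ge0.
have i2 := integrable_divs (gaussp_ge0 ltr01) gaussp_integrable gn gB.
have D F G := has_intD mT (has_int_self F) (has_int_self G).
have [j1 _] := D _ _ i1 hexp_integrable.
have [j2 _] := D _ _ j1 (hexp_i 1).
have [k1 _] := D _ _ i2 gaussp_integrable.
have [k2 _] := D _ _ k1 (gauss_i 1).
have [k3 _] := has_intZ `|hankc| mT (has_int_self k2).
have [j3 _] := D _ _ j2 k3.
apply: (integrable_le mT j3).
  apply: measurable_funM; first by apply: measurableT_comp => //; exact: hankD_measurable.
  apply: measurable_funM; last exact: measurable_inv.
  by apply: measurable_funD; [exact: measurable_cst|exact: exprn_measurable].
move=> s _; have [s0|s0] := leP s 0.
  rewrite /hankQ hankD_out// normr0 mul0r normr0.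
  by rewrite (hexp_out s0) (gn s s0) !mul0r !add0r mulr0.
have h0 := hexp_ge0 s; have g0 := gaussp_ge0 (@ltr01 R) s.
have w : (1 + s ^+ 2) / s <= s^-1 + (1 + s ^+ 2).
  rewrite mulrDl mul1r lerD2l expr2 mulfK ?gt_eqF//; nra.
have w0 : 0 <= (1 + s ^+ 2) / s by rewrite divr_ge0 ?(ltW s0)// addr_ge0// sqr_ge0.
rewrite /hankQ ger0_norm; last exact: mulr_ge0.
apply: (@le_trans _ _ ((hexp kap s + `|hankc| * gaussp 1 s) * (s^-1 + (1 + s ^+ 2)))).
  apply: ler_pM => //; apply: le_trans (ler_normB _ _) _.
  by rewrite normrM (ger0_norm h0) (ger0_norm g0).
by rewrite muln1 le_eqVlt; apply/orP; left; apply/eqP; ring.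
Qed.

Lemma hank_kernel_integrable (W : R -> R) : measurable_fun setT W ->
  (forall s, 0 < s -> 0 <= W s <= (1 + s ^+ 2) / s) ->
  mu.-integrable setT (EFin \o (fun s => hankD s / (s ^+ 2 - r ^+ 2) * W s)).
Proof.
move=> mW W0; have [M [d [M0 d0 dr lip]]] := hankD_lip.
(* Within distance [d] of [r] the Lipschitz bound cancels $|s-r|$, while $s+r\ge r$ and $r-d<s<2r$;
   this gives [K]. Farther away $|s^2-r^2|\ge dr$, and the majorant is [hankQ] divided by
   [d * r]. *)
pose K := M / r * ((1 + 4 * r ^+ 2) / (r - d)).
have rd : 0 < r - d by lra.
have K0 : 0 <= K.
  apply: mulr_ge0; apply: divr_ge0 => //; rewrite ?(ltW r0) ?(ltW rd)//.
  by have := sqr_ge0 r; lra.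
have ci : mu.-integrable `[r - d, r + d] (EFin \o (fun=> K)) by apply: integrable_cc => x; exact: cvg_cst.
have hB := has_int_restrict (measurable_itv `[(r - d : R), r + d]) (has_int_self ci).
have [gi _] := has_intD mT hB (has_intZ (d * r)^-1 mT (has_int_self hankQ_integrable)).
apply: (integrable_le mT gi).
  apply: measurable_funM => //; apply: measurable_funM; first exact: hankD_measurable.
  apply: (measurableT_comp measurable_inv).
  by apply: measurable_funB; [exact: exprn_measurable|exact: measurable_cst].
move=> s _; have dr0 : 0 < d * r by rewrite mulr_gt0.
have c0 : 0 <= ((fun=> K) \_ `[r - d, r + d]) s by rewrite patchE; case: ifP.
have [s0|s0] := leP s 0.
  rewrite hankD_out// !mul0r normr0 addr_ge0// mulr_ge0 ?invr_ge0 ?(ltW dr0)//.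
  by rewrite /hankQ hankD_out// normr0 mul0r.
have /andP[w0 w1] := W0 _ s0.
have q0 : 0 <= hankQ s.
  by rewrite /hankQ mulr_ge0// divr_ge0 ?(ltW s0)// addr_ge0// sqr_ge0.
have e : s ^+ 2 - r ^+ 2 = (s - r) * (s + r) by ring.
have sr0 : 0 < s + r by rewrite addr_gt0.
rewrite normrM (ger0_norm w0) normrM normfV e normrM (gtr0_norm sr0).
have [sd|sd] := ltP `|s - r| d.
  have mem : ((fun=> K) \_ `[r - d, r + d]) s = K.
    move: sd; rewrite ltr_distlC => /andP[? ?].
    by rewrite patchE mem_set//= in_itv/=; apply/andP; split; lra.
  rewrite mem ler_wpDr//; first by rewrite mulr_ge0// invr_ge0 ltW.
  have sd' := sd; move: sd'; rewrite ltr_distlC => /andP[sl sr].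
  rewrite /K; apply: ler_pM => //; first by rewrite divr_ge0// mulr_ge0// ltW.
    have [->|sn] := eqVneq s r.
      by rewrite hankD_r normr0 mul0r divr_ge0// ltW.
    have n0 : 0 < `|s - r| by rewrite normr_gt0 subr_eq0.
    rewrite ler_pdivrMr ?mulr_gt0//; apply: le_trans (lip _ sd) _.
    rewrite (_ : M / r * _ = M * `|s - r| * ((s + r) / r)); last by field; rewrite gt_eqF.
    rewrite ler_peMr ?mulr_ge0// ler_pdivlMr// mul1r; lra.
  apply: le_trans w1 _; apply: ler_pM => //.
  - by rewrite addr_ge0// sqr_ge0.
  - by rewrite invr_ge0 ltW.
  - nra.
  - by rewrite lef_pV2 ?posrE//; lra.
rewrite ler_wpDl// /hankQ mulrA; apply: ler_pM => //.
  by rewrite divr_ge0// mulr_ge0// ltW.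
rewrite mulrC ler_wpM2r// lef_pV2 ?posrE//; last by rewrite mulr_gt0// (lt_le_trans d0).
by apply: ler_pM => //; [exact: ltW|exact: ltW|lra].
Qed.

Lemma fubini_J0 (f g : R -> R) :
  mu.-integrable setT (EFin \o f) -> mu.-integrable setT (EFin \o g) ->
  Rintegral mu setT (fun t => f t * Rintegral mu setT (fun s => g s * J0 (t * s))) =
  Rintegral mu setT (fun s => g s * Rintegral mu setT (fun t => f t * J0 (t * s))).
Proof.
move=> fi gi; have [B [B0 hB]] := J0_bounded.
have mf : measurable_fun setT f by move/measurable_int : fi => /measurable_EFinP.
have mg : measurable_fun setT g by move/measurable_int : gi => /measurable_EFinP.
have mJ c : measurable_fun setT (fun s => J0 (c * s)).
  by apply: (measurableT_comp measurable_J0); apply: measurable_funM => //; exact: measurable_cst.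
have mJ' c : measurable_fun setT (fun s => J0 (s * c)).
  by apply: (measurableT_comp measurable_J0); apply: measurable_funM => //; exact: measurable_cst.
pose h (z : measurableTypeR R * measurableTypeR R) : \bar R := (f z.1 * g z.2 * J0 (z.1 * z.2))%:E.
have mh : measurable_fun setT h.
  apply/measurable_EFinP; apply: measurable_funM.
    apply: measurable_funM; [exact: (measurableT_comp mf measurable_fst)|exact: (measurableT_comp mg measurable_snd)].
  apply: (measurableT_comp measurable_J0); apply: measurable_funM; [exact: measurable_fst|exact: measurable_snd].
have gai : mu.-integrable setT (EFin \o (fun s => `|g s|)) by exact: integrable_norm.
have fai : mu.-integrable setT (EFin \o (fun s => `|f s|)) by exact: integrable_norm.
pose K := B * Rintegral mu setT (fun s => `|g s|).
have hi : (mu \x mu)%E.-integrable setT h.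
  apply/(integrable12ltyP mu mu mh).
  apply: (@le_lt_trans _ _ (\int[mu]_x (K * `|f x|)%:E)%E).
    apply: ge0_le_integral => //.
    - by move=> x _; apply: integral_ge0 => y _; exact: abse_ge0.
    - by apply: (measurable_fun_fubini_tonelli_F (fun z => `|h z|%E)) => //; exact: measurableT_comp.
    - apply/measurable_EFinP; apply: measurable_funM; first exact: measurable_cst.
      exact: measurableT_comp.
    move=> x _; have gK := has_intZ (`|f x| * B) mT (has_int_self gai).
    rewrite (_ : K * `|f x| = `|f x| * B * Rintegral mu setT (fun s => `|g s|)); last by rewrite /K; ring.
    rewrite -(has_intE mT gK); apply: ge0_le_integral => //.
    - apply: measurableT_comp => //; apply/measurable_EFinP; rewrite /h /=.
      by apply: measurable_funM; [apply: measurable_funM; [exact: measurable_cst|exact: mg]|exact: mJ].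
    - apply/measurable_EFinP; apply: measurable_funM; first exact: measurable_cst.
      exact: measurableT_comp.
    move=> y _; rewrite /h /= lee_fin !normrM -mulrA [ `|g y| * _]mulrC mulrA.
    by rewrite ler_wpM2r// ler_wpM2l.
  have [_ _] := has_intZ K mT (has_int_self fai).
  by rewrite (has_intE mT (has_intZ K mT (has_int_self fai))) ltry.
have gJ t : mu.-integrable setT (EFin \o (fun s => g s * J0 (t * s))).
  by apply: (integrableM_bounded mT gi (mJ t)) => x _; exact: hB.
have fJ s : mu.-integrable setT (EFin \o (fun t => f t * J0 (t * s))).
  by apply: (integrableM_bounded mT fi (mJ' s)) => x _; exact: hB.
have F := Fubini hi.
have e1 : (\int[mu]_t (f t * Rintegral mu setT (fun s => g s * J0 (t * s)))%:E =
    \int[mu]_x \int[mu]_y h (x, y))%E.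
  apply: eq_integral => t _; rewrite -(has_intE mT (has_intZ (f t) mT (has_int_self (gJ t)))).
  by apply: eq_integral => s _; rewrite /h /= mulrA.
have e2 : (\int[mu]_s (g s * Rintegral mu setT (fun t => f t * J0 (t * s)))%:E =
    \int[mu]_y \int[mu]_x h (x, y))%E.
  apply: eq_integral => s _; rewrite -(has_intE mT (has_intZ (g s) mT (has_int_self (fJ s)))).
  by apply: eq_integral => t _; rewrite /h /=; congr EFin; ring.
exact: (congr1 fine (etrans e1 (etrans F (esym e2)))).
Qed.

Let cc (w : R -> R) T : (forall x, w y @[y --> x] --> w x) ->
  has_int setT (w \_ `[0, T]) (Rintegral mu `[0, T] w).
Proof.
move=> wc; apply: has_int_restrict; first exact: measurable_itv.
by apply: has_int_self; exact: integrable_cc.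
Qed.

Let J0c c x : J0 (c * y) @[y --> x] --> J0 (c * x).
Proof. by apply: cvg_arg; exact: cvg_J0. Qed.

Let w1 t := t * J0 (r * t) * expR (- (t ^+ 2 / 4)).
Let w3 t := t * J0 (r * t) * J0 t ^+ 3.

(** Writing [hexp] as [hankD] plus [hankc] times the Gaussian weight splits $J_0^3$ accordingly.
    Fubini is used for finite [T] only, where $tJ_0(rt)$ restricted to $[0,T]$ is integrable. *)
Lemma hank_split T : Rintegral mu `[0, T] w3 =
  hankc * Rintegral mu `[0, T] w1 + Rintegral mu setT (fun s => hankD s * lommel r s T).
Proof.
have e1 x : expR (- (y ^+ 2 / 4)) @[y --> x] --> expR (- (x ^+ 2 / 4)).
  have d1 : isder (fun y : R => - (y ^+ 2 / 4)) x (- (x / 2)) by der; field.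
  exact: der_cvg (der_comp d1 (is_derive_expR _ : isder expR _ _)).
have w0c x : y * J0 (r * y) @[y --> x] --> x * J0 (r * x) by apply: cvgM => //; exact: J0c.
have w1c x : w1 y @[y --> x] --> w1 x by apply: cvgM; [exact: w0c|exact: e1].
have w3c x : w3 y @[y --> x] --> w3 x.
  apply: cvgM; first exact: w0c.
  exact: der_cvg (derX 3 (der_J0 x)).
have Dint t : has_int setT (fun s => hankD s * J0 (t * s))
    (J0 t ^+ 3 + - hankc * expR (- (t ^+ 2 / (4 * 1)))).
  have h := has_intD mT (hexp_J0 t) (has_intZ (- hankc) mT (gaussp_J0 ltr01 t)).
  by apply: has_int_ext h => // s _; rewrite /hankD; ring.
have Di : mu.-integrable setT (EFin \o hankD).
  have [h _] := has_intD mT (has_int_self hexp_integrable) (has_intZ (- hankc) mT (has_int_self gaussp_integrable)).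
  by apply: eq_integrable h => // s _ /=; rewrite mulNr.
pose f : R -> R := (fun t => t * J0 (r * t)) \_ `[0, T].
have [fi _] := cc T w0c.
have := fubini_J0 fi Di.
have -> : (fun s => hankD s * Rintegral mu setT (fun t => f t * J0 (t * s))) =
    (fun s => hankD s * lommel r s T).
  apply/funext => s; congr (_ * _); rewrite /lommel [RHS]Rintegral_mkcond.
  by apply: eq_Rintegral => t _; rewrite /f !patchE; case: ifP => // _; rewrite mul0r.
move=> <-.
have Gi : mu.-integrable setT (EFin \o (fun t => f t * Rintegral mu setT (fun s => hankD s * J0 (t * s)))).
  have [h _] := has_intD mT (cc T w3c) (has_intZ (- hankc) mT (cc T w1c)).
  apply: eq_integrable h => // t _ /=; congr EFin.
  rewrite (Dint t).2 mulr1 /f !patchE; case: ifP => _; last by rewrite mul0r mulr0 addr0.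
  by rewrite /w3 /w1; ring.
have [_ <-] := has_intD mT (has_intZ hankc mT (cc T w1c)) (has_int_self Gi).
rewrite [LHS]Rintegral_mkcond; apply: eq_Rintegral => t _.
rewrite (Dint t).2 mulr1 /f !patchE; case: ifP => _; last by rewrite mul0r mulr0 addr0.
by rewrite /w3 /w1; ring.
Qed.

Let W1 s : 0 < s -> 0 <= Num.sqrt s <= (1 + s ^+ 2) / s.
Proof.
move=> s0; rewrite sqrtr_ge0/= ler_pdivlMr//.
have q0 : 0 < Num.sqrt s by rewrite sqrtr_gt0.
have := sqr_sqrtr (ltW s0); move: q0; move: (Num.sqrt s) => z z0 <-.
have h := sqr_ge0 (z ^+ 2 - 1); have h2 := sqr_ge0 (z - 1); nra.
Qed.

Let W0 s : 0 < s -> 0 <= (Num.sqrt s)^-1 <= (1 + s ^+ 2) / s.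
Proof.
move=> s0; have q0 : 0 < Num.sqrt s by rewrite sqrtr_gt0.
rewrite invr_ge0 sqrtr_ge0/= ler_pdivlMr//.
have := sqr_sqrtr (ltW s0); move: q0; move: (Num.sqrt s) => z z0 <-.
rewrite (_ : z^-1 * z ^+ 2 = z); last by field; rewrite gt_eqF.
have h := sqr_ge0 (z ^+ 2 - 1); have h2 := sqr_ge0 (z - 1); nra.
Qed.

Let msqrt : measurable_fun setT (fun s : R => Num.sqrt s).
Proof. by apply: continuous_measurable => x; exact: sqrt_continuous. Qed.

Let c1_sqrt s : 0 < s -> c1 (fun s => Num.sqrt s) s.
Proof.
move=> s0; exists (fun s => (2 * Num.sqrt s)^-1); split.
  have : \forall y \near s, 0 < y by apply: open_nbhs_nbhs; split => //; exact: open_gt.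
  by apply: filterS => y y0; exact: is_derive1_sqrt.
apply: cvgV; first by rewrite mulf_neq0// gt_eqF// sqrtr_gt0.
by apply: cvgM; [exact: cvg_cst|exact: sqrt_continuous].
Qed.

Let c1_frac s : 0 < s -> s \notin [:: 1; 3; r] -> c1 (fun s => hankD s / (s ^+ 2 - r ^+ 2)) s.
Proof.
move=> s0; rewrite !inE !negb_or => /and3P[s1 s3 sr].
apply: c1M; first by apply: c1_hankD => //; rewrite !inE negb_or s1.
apply: c1V.
  have h : - r < s by rewrite (lt_trans _ s0)// oppr_lt0.
  by rewrite subr_eq0 eqf_sqr negb_or sr/= gt_eqF.
by apply: c1D; [apply: c1M; exact: c1I|exact: c1C].
Qed.

Let k1 s := hankD s / (s ^+ 2 - r ^+ 2) * Num.sqrt s.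
Let k0 s := hankD s / (s ^+ 2 - r ^+ 2) * (Num.sqrt s)^-1.

Let k1_null : osc_null (fun t => Num.sqrt t * J1 t) setT k1.
Proof.
apply: (riemann_lebesgue_J1 (S := [:: 1; 3; r])).
- exact: hank_kernel_integrable.
- by move=> s s0; rewrite /k1 hankD_out// !mul0r.
- by move=> s s0 sS; apply: c1M; [exact: c1_frac|exact: c1_sqrt].
Qed.

Let k0_null : osc_null (fun t => Num.sqrt t * J0 t) setT k0.
Proof.
apply: (riemann_lebesgue_J0 (S := [:: 1; 3; r])).
- by apply: hank_kernel_integrable => //; exact: (measurableT_comp measurable_inv msqrt).
- by move=> s s0; rewrite /k0 hankD_out// !mul0r.
- move=> s s0 sS; apply: c1M; first exact: c1_frac.
  by apply: c1V; [rewrite gt_eqF// sqrtr_gt0|exact: c1_sqrt].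
Qed.

Let I1 T := Rintegral mu setT (fun s => k1 s * (Num.sqrt (T * s) * J1 (T * s))).
Let I0 T := Rintegral mu setT (fun s => k0 s * (Num.sqrt (T * s) * J0 (T * s))).

Let osc_int (g w : R -> R) : mu.-integrable setT (EFin \o g) ->
  (forall t, 0 <= t -> `|Num.sqrt t * w t| <= bessC + 1) ->
  (forall t, w y @[y --> t] --> w t) -> forall T,
  mu.-integrable setT (EFin \o (fun s => g s * (Num.sqrt (T * s) * w (T * s)))).
Proof.
move=> gi wb wc T; apply: (integrableM_bounded (C := bessC + 1) mT gi).
  apply: continuous_measurable => s; apply: (cvg_arg (w := fun t => Num.sqrt t * w t)).
  exact: cvg_sqrtM.
move=> s _; have [h|/ltW h] := leP 0 (T * s); first exact: wb.
by rewrite ler0_sqrtr// mul0r normr0 addr_ge0// bessCP.1.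
Qed.

Let k1_i : mu.-integrable setT (EFin \o k1).
Proof. exact: hank_kernel_integrable. Qed.

Let k0_i : mu.-integrable setT (EFin \o k0).
Proof. by apply: hank_kernel_integrable => //; exact: (measurableT_comp measurable_inv msqrt). Qed.

Let bounded_null (w b : R -> R) : (forall t, 0 <= t -> `|Num.sqrt t * w t| <= bessC + 1) ->
  b T @[T --> +oo] --> 0 -> Num.sqrt T * w (T * r) * b T @[T --> +oo] --> 0.
Proof.
move=> wb b0; have q0 : 0 < Num.sqrt r by rewrite sqrtr_gt0.
have bn : (bessC + 1) / Num.sqrt r * `|b T| @[T --> +oo] --> 0.
  rewrite -(mulr0 ((bessC + 1) / Num.sqrt r)); apply: cvgM; first exact: cvg_cst.
  by rewrite -(@normr0 _ R); exact: cvg_norm.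
apply: norm_cvg0; apply: squeeze_cvgr bn; last exact: cvg_cst.
near=> T; have T0 : 0 <= T by [].
rewrite normr_ge0/= normrM ler_wpM2r// ler_pdivlMr//.
rewrite -[X in _ * X](ger0_norm (ltW q0)) -normrM mulrAC -sqrtrM//.
by apply: wb; rewrite mulr_ge0// ltW.
Unshelve. all: by end_near. Qed.

(** In Lommel's formula $T=\sqrt T\sqrt T$: one root joins $\sqrt s$ to normalize the factor in $Ts$
    for Riemann-Lebesgue, and the other keeps the factor in $Tr$ bounded. *)
Lemma hank_lommel T : 0 < T -> Rintegral mu setT (fun s => hankD s * lommel r s T) =
  Num.sqrt T * J0 (T * r) * I1 T - r * (Num.sqrt T * J1 (T * r)) * I0 T.
Proof.
move=> T0.
have i1 := osc_int k1_i sqrtJ1_bound (@cvg_J1 R) T.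
have i0 := osc_int k0_i sqrtJ0_bound (@cvg_J0 R) T.
rewrite -mulNr /I1 /I0.
have [_ <-] := has_intD mT (has_intZ (Num.sqrt T * J0 (T * r)) mT (has_int_self i1))
  (has_intZ (- (r * (Num.sqrt T * J1 (T * r)))) mT (has_int_self i0)).
apply: eq_Rintegral => s _.
have [s0|s0] := leP s 0; first by rewrite /k1 /k0 hankD_out// !(mul0r, mulr0) addr0.
have [->|sr] := eqVneq s r; first by rewrite /k1 /k0 hankD_r !(mul0r, mulr0) addr0.
have n0 : s ^+ 2 - r ^+ 2 != 0.
  have h : - r < s by rewrite (lt_trans _ s0)// oppr_lt0.
  by rewrite subr_eq0 eqf_sqr negb_or sr/= gt_eqF.
have -> : lommel r s T = T * (s * J1 (T * s) * J0 (T * r) - r * J0 (T * s) * J1 (T * r)) / (s ^+ 2 - r ^+ 2).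
  by rewrite -(lommelE r s T0) mulrAC mulfV// mul1r.
rewrite /k1 /k0 sqrtrM ?(ltW T0)//.
have q0 : 0 < Num.sqrt s by rewrite sqrtr_gt0.
have eT := sqr_sqrtr (ltW T0); have es := sqr_sqrtr (ltW s0).
rewrite -[X in X * (s * J1 _ * _ - _)]eT.
move: (J1 (T * s)) (J0 (T * s)) (J0 (T * r)) (J1 (T * r)) => a b c d.
rewrite -[X in X * a * c]es.
move: n0; move: (s ^+ 2 - r ^+ 2) => n n0.
move: q0; move: (Num.sqrt s) (Num.sqrt T) => z w z0.
by field; rewrite n0 gt_eqF.
Qed.

Lemma bessel_inversion : Rintegral mu `[0, T] (fun t => t * J0 (r * t) * J0 t ^+ 3) @[T --> +oo] -->
  2 * hypf kap (r ^+ 2).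
Proof.
have lim1 : Num.sqrt T * J0 (T * r) * I1 T @[T --> +oo] --> 0.
  by apply: bounded_null => //; exact: sqrtJ0_bound.
have lim0 : r * (Num.sqrt T * J1 (T * r)) * I0 T @[T --> +oo] --> 0.
  rewrite -(mulr0 r) (_ : (fun T => _) = fun T => r * (Num.sqrt T * J1 (T * r) * I0 T)).
    apply: cvgM; first exact: cvg_cst.
    by apply: bounded_null => //; exact: sqrtJ1_bound.
  by apply/funext => T; rewrite !mulrA.
have lg := cvgM (cvg_cst hankc) (@cvg_gauss_J0 R r).
have e : hankc * (2 * expR (- r ^+ 2)) = 2 * hypf kap (r ^+ 2).
  rewrite /hankc hexpE r0 /hexf gtr0_norm// gausspE (ltW r0) mul1r.
  move: (expR_gt0 (- r ^+ 2)); move: (expR _) (hypf _ _) => E H E0; field.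
  by rewrite !gt_eqF.
have L : hankc * Rintegral mu `[0, T] w1 + (Num.sqrt T * J0 (T * r) * I1 T -
    r * (Num.sqrt T * J1 (T * r)) * I0 T) @[T --> +oo] --> hankc * (2 * expR (- r ^+ 2)) + (0 - 0).
  by apply: cvgD; [exact: lg|exact: cvgB lim1 lim0].
rewrite subrr addr0 e in L.
apply: (cvg_trans _ L); apply: near_eq_cvg; near=> T.
by rewrite -[RHS]/(Rintegral mu `[0, T] w3) hank_split hank_lommel.
Unshelve. all: by end_near. Qed.

End At.
End Inversion.

(** * Closed walks *)

Fixpoint count_walks (L : Type) (W : eqType) (nb : W -> seq (L * W)) (k : nat) (w w' : W) : nat :=
  if k is k'.+1 then (\sum_(p <- nb w) count_walks nb k' p.2 w')%N else (w == w').

Section CountWalks.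
Variables (V W : choiceType) (G : multigraph V) (emb : W -> V).
Variable nb : W -> seq (edge_label G * W).
Hypothesis emb_inj : injective emb.
Hypothesis nb_uniq : forall w, uniq (nb w).
Hypothesis nbP : forall w e q, edge (emb w) e q <-> exists2 x, q = emb x & (e, x) \in nb w.

Fixpoint enum_walks (k : nat) (w w' : W) : seq (seq (edge_label G * V)) :=
  if k is k'.+1 then
    flatten [seq [seq (p.1, emb p.2) :: s | s <- enum_walks k' p.2 w'] | p <- nb w]
  else if w == w' then [:: [::]] else [::].

Lemma mem_enum_walks k w w' s : s \in enum_walks k w w' <->
  size s = k /\ walk (emb w) s (emb w').
Proof.
elim: k w s => [|k IH] w s /=.
  split; first by case: eqP => // ->; rewrite inE => /eqP ->.
  by move=> [/size0nil -> /= /emb_inj ->]; rewrite eqxx inE.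
split.
  move=> /flattenP[_ /mapP[p pn ->] /mapP[s' /IH[ss ws] ->]] /=.
  split; first by rewrite ss.
  by split => //; apply/nbP; exists p.2 => //; rewrite -surjective_pairing.
case: s => [|[e q] s] [//= [ss] [/nbP[x -> xn] ws]].
apply/flattenP; exists [seq (e, emb x) :: s | s <- enum_walks k x w'].
  by apply/mapP; exists (e, x).
by apply/mapP; exists s => //; apply/IH.
Qed.

Lemma size_enum_walks k w w' : size (enum_walks k w w') = count_walks nb k w w'.
Proof.
elim: k w => [|k IH] w /=; first by case: eqP.
rewrite size_flatten /shape -map_comp sumnE big_map.
by apply: eq_bigr => p _ /=; rewrite size_map IH.
Qed.

Lemma uniq_enum_walks k w w' : uniq (enum_walks k w w').
Proof.
elim: k w => [|k IH] w /=; first by case: eqP.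
apply: (@allpairs_uniq_dep _ _ _ (fun p s => (p.1, emb p.2) :: s) (nb w) (fun p => enum_walks k p.2 w')) => //.
move=> [[e x] s] [[e' x'] s'] _ _ /= [-> /emb_inj -> ->]; reflexivity.
Qed.

(** An explicit duplicate-free list of walks proves the set finite, so [fset_set] has its intended
    value and the cardinal obeys the recursion of [count_walks]. *)
Lemma num_closed_walksE k w : num_closed_walks G (emb w) k = count_walks nb k w w.
Proof.
rewrite /num_closed_walks -size_enum_walks.
have -> : closed_walks (G := G) (emb w) k = [set` seq_fset tt (enum_walks k w w)].
  apply/seteqP; split => s.
    move=> h; change (s \in seq_fset tt (enum_walks k w w)); rewrite seq_fsetE.
    exact/mem_enum_walks.
  move=> h; have : s \in seq_fset tt (enum_walks k w w) by exact: h.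
  by rewrite seq_fsetE => /mem_enum_walks.
by rewrite set_fsetK size_seq_fset undup_id// uniq_enum_walks.
Qed.

End CountWalks.

(** * Commuting translation operators and trinomial coefficients *)

Section StepOperators.
Local Open Scope nat_scope.
Implicit Types (f : int * int -> nat) (p q : int * int).

Definition stepA f p := f p + f ((p.1 + 1)%R, p.2) + f (p.1, (p.2 + 1)%R).
Definition stepB f p := f p + f ((p.1 - 1)%R, p.2) + f (p.1, (p.2 - 1)%R).

Lemma stepAB f p : stepA (stepB f) p = stepB (stepA f) p.
Proof.
case: p => a b; rewrite /stepA /stepB /= !addrK; lia.
Qed.

(** Commutation separates the powers of the operator from those of its adjoint: the latter spread a
    point mass into trinomial coefficients, and the former pair these with themselves, which
    produces the squares. *)
Lemma iter_stepAB n f : iter n (stepA \o stepB) f = iter n stepA (iter n stepB f).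
Proof.
have comm m g : iter m stepA (stepB g) = stepB (iter m stepA g).
  by elim: m => //= m ->; apply/funext => p; exact: stepAB.
by elim: n => //= n ->; rewrite comm.
Qed.

Definition trinom n i j := 'C(n, i) * 'C(n - i, j).

Lemma trinomS n i j : trinom n.+1 i j = trinom n i j +
  (if i is i'.+1 then trinom n i' j else 0) + (if j is j'.+1 then trinom n i j' else 0).
Proof.
rewrite /trinom; case: i => [|i].
  by case: j => [|j]; rewrite ?subn0 ?binS ?bin0; lia.
rewrite binS subSS.
have [ni|ni] := ltnP i n.
  rewrite -(subnSK ni); case: j => [|j]; first by rewrite !bin0; lia.
  by rewrite !binS; lia.
rewrite bin_small ?ltnS//.
by case: j => [|j]; lia.
Qed.

(** Extension by 0 to negative indices, so that the Pascal rule holds without boundary cases. *)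
Definition trinomz n (i j : int) : nat :=
  match i, j with Posz i', Posz j' => trinom n i' j' | _, _ => 0 end.

Lemma trinomzS n i j : trinomz n.+1 i j =
  trinomz n i j + trinomz n (i - 1)%R j + trinomz n i (j - 1)%R.
Proof.
have S1 (m : nat) : (Posz m.+1 - 1 = Posz m)%R by lia.
have N1 (m : nat) : (Negz m - 1 = Negz m.+1)%R by lia.
have Z1 : (Posz 0 - 1 = Negz 0)%R by lia.
case: i => [[|i]|i]; case: j => [[|j]|j]; rewrite ?S1 ?N1 ?Z1 /=.
all: try by rewrite trinomS ?addn0.
all: by [].
Qed.

Lemma iter_stepB n q p :
  iter n stepB (fun w => (w == q) : nat) p = trinomz n (p.1 - q.1)%R (p.2 - q.2)%R.
Proof.
elim: n p => [|n IH] [a b] /=.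
  case: q => a0 b0; rewrite /= xpair_eqE -(subr_eq0 a) -(subr_eq0 b).
  case: (a - a0)%R => [[|i]|i]; case: (b - b0)%R => [[|j]|j] //=.
rewrite /stepB !IH trinomzS /=.
by congr (_ + trinomz _ _ _ + trinomz _ _ _); lia.
Qed.

(** The range [m] is free above [n]: the additional terms vanish, and the induction step gets room
    for its index shifts. *)
Lemma iter_stepA n m f a b : n < m -> iter n stepA f (a, b) =
  \sum_(0 <= i < m) \sum_(0 <= j < m) trinom n i j * f ((a + Posz i)%R, (b + Posz j)%R).
Proof.
elim: n m f => [|n IH] m f nm.
  case: m nm => // m _; rewrite big_nat_recl//= big_nat_recl//= !addr0.
  rewrite {1}/trinom !bin0 !mul1n big1 => [|j _]; last by rewrite /trinom subn0 bin0n muln0.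
  rewrite big1 ?addn0// => i _; rewrite big1// => j _; by rewrite /trinom bin0n.
case: m nm => // m nm; rewrite iterSr (IH m.+1); last exact: ltnW.
pose F i j := f ((a + Posz i)%R, (b + Posz j)%R).
have e i j : trinom n i j * stepA f ((a + Posz i)%R, (b + Posz j)%R) =
    trinom n i j * F i j + trinom n i j * F i.+1 j + trinom n i j * F i j.+1.
  rewrite /stepA /F /= -!mulnDr; congr (_ * (_ + f _ + f _)); congr pair; lia.
under eq_bigr do (under eq_bigr do rewrite e; rewrite !big_split /=).
rewrite !big_split /=.
have e' i j : trinom n.+1 i j * F i j = trinom n i j * F i j +
    (if i is i'.+1 then trinom n i' j else 0) * F i j +
    (if j is j'.+1 then trinom n i j' else 0) * F i j.
  by rewrite trinomS !mulnDl.
under [RHS]eq_bigr do (under eq_bigr do rewrite e'; rewrite !big_split /=).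
rewrite !big_split /=; congr (_ + _ + _).
- rewrite [RHS]big_nat_recl//= [X in _ = X + _]big1_seq ?add0n; last by move=> j _; rewrite mul0n.
  rewrite [LHS]big_nat_recr//= [X in _ + X]big1_seq ?addn0// => j _.
  by rewrite /trinom bin_small.
- apply: eq_bigr => i _.
  rewrite [RHS]big_nat_recl//= mul0n add0n.
  rewrite [LHS]big_nat_recr//= /trinom [X in _ + X * _](_ : _ = 0) ?mul0n ?addn0//.
  by rewrite (@bin_small (n - i))// ?muln0// (leq_ltn_trans (leq_subr _ _)).
Qed.

Lemma iter_step_walknum n q :
  iter n (stepA \o stepB) (fun w => (w == q) : nat) q = walknum n.
Proof.
rewrite iter_stepAB; case: q => a b; rewrite (@iter_stepA _ n.+1)//.
rewrite big_mkord /walknum; apply: eq_bigr => i _.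
transitivity (\sum_(0 <= j < n.+1) 'C(n, i) ^ 2 * 'C(n - i, j) ^ 2).
  apply: eq_bigr => j _; rewrite iter_stepB /= !(addrAC _ _ (- _)%R) !subrr !add0r /=.
  by rewrite /trinom mulnn expnMn.
rewrite big_distrr -[RHS](big_mkord xpredT (fun j => 'C(n, i) ^ 2 * 'C(n - i, j) ^ 2)) /=.
rewrite (@big_cat_nat _ _ _ (n - i).+1)//=; last by rewrite ltnS leq_subr.
rewrite [X in _ + X]big1_seq ?addn0// => j /andP[_]; rewrite mem_index_iota => /andP[h _].
have -> : 'C(n - i, j) = 0 by rewrite bin_small.
by rewrite muln0.
Qed.

End StepOperators.

(** * Nearest neighbours from an integral distance form *)

Section Nearest.
Context {R : realType} {W : choiceType}.
Variables (V : set (R * R)) (emb : W -> R * R) (N : W -> W -> int) (S : W -> seq W).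
Variables (n : nat) (d : int).
Hypothesis embV : forall v, V v <-> exists w, v = emb w.
Hypothesis emb_inj : injective emb.
Hypothesis edistE : forall w x, Defs.edist (emb w) (emb x) = Num.sqrt (N w x)%:~R.
Hypothesis d0 : 0 < d.
Hypothesis n0 : (0 < n)%N.
Hypothesis SP : forall w x, x \in S w <-> N w x = d.
Hypothesis N_ge : forall w x, x <> w -> d <= N w x.
Hypothesis N_w : forall w, N w w = 0.
Hypothesis S_uniq : forall w, uniq (S w).
Hypothesis S_size : forall w, size (S w) = n.

(** Here [d] is the least squared distance and the sphere [S w] has exactly [n] points. Nothing is
    closer than a point of the sphere, while for any other point the whole sphere is strictly
    closer, which exceeds the allowed [m < n]. *)
Lemma nearest_neighbourP w q :
  nearest_neighbour n V (emb w) q <-> exists2 x, q = emb x & x \in S w.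
Proof.
have dist_lt x y : y <> w -> (Defs.edist (emb w) (emb x) < Defs.edist (emb w) (emb y)) = (N w x < N w y).
  move=> yw; rewrite !edistE ltr_sqrt ?ltr_int// ltr0z.
  exact: lt_le_trans d0 (N_ge yw).
have ne x : N w x = d -> x <> w by move=> + e; rewrite e N_w => h; move: d0; rewrite -h ltxx.
split.
  move=> [_ /embV[x ->] xw [m mn hm]]; exists x => //; apply/SP/eqP.
  have {}xw : x <> w by move=> e; apply: xw; rewrite e.
  rewrite eq_le (N_ge xw) andbT leNgt; apply/negP => dN.
  suff : (n <= m)%N by rewrite leqNgt mn.
  rewrite -card_le_II.
  apply: card_le_trans (_ : [set r | [/\ V r, r <> emb w & Defs.edist (emb w) r < Defs.edist (emb w) (emb x)]] #<= _).
    have e : [set` seq_fset tt (map emb (S w))] #= `I_n.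
      apply/card_eq_fsetP; rewrite size_seq_fset undup_id ?size_map ?S_size//.
      by rewrite map_inj_uniq.
    move: e; rewrite card_eq_le => /andP[_ e]; apply: card_le_trans e _.
    apply: subset_card_le => r h; have : r \in seq_fset tt (map emb (S w)) by exact: h.
    rewrite seq_fsetE => /mapP[y /SP yS ->]; split.
    - by apply/embV; exists y.
    - by move=> /emb_inj; exact: ne.
    - by rewrite dist_lt// yS.
  by move: hm; rewrite card_eq_le => /andP[].
move=> [x -> /SP xS]; have xw := ne _ xS; split.
- by apply/embV; exists w.
- by apply/embV; exists x.
- by move=> /emb_inj.
- exists 0%N => //; rewrite (_ : [set r | _] = set0) ?II0 ?card_eqxx//.
  apply/seteqP; split => // r [/embV[y ->] yw]; rewrite dist_lt// xS.
  by apply/negP; rewrite -leNgt; apply: N_ge => e; apply: yw; rewrite e.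
Qed.

End Nearest.

(** * Integer coordinates and walk counts for the two lattices *)

Section LatticeWalks.
Context {R : realType}.
Local Open Scope ring_scope.
Implicit Types (w x : (int * int) * bool) (t p : int * int) (v q : R * R).

(* In these coordinates the squared distance is symmetric, and the neighbours are
   the translates by [dirs3], [- dirs3] and [dirs6]. *)
Definition hex_emb w : R * R := hex_point R w.1.2 (- w.1.1 - w.1.2) w.2.

Definition hex_norm w x : int :=
  let a := x.1.1 - w.1.1 in let b := x.1.2 - w.1.2 in
  let c := (x.2 : nat)%:Z - (w.2 : nat)%:Z in
  3 * (a ^+ 2 + a * b + b ^+ 2) - 3 * (a + b) * c + c ^+ 2.

Lemma hex_embP v : hex_vertices v <-> exists w, v = hex_emb w.
Proof.
split; last by move=> [w ->]; exists w.1.2, (- w.1.1 - w.1.2), w.2.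
move=> [x [y [c ->]]]; exists (- x - y, x, c); rewrite /hex_emb /=.
by congr hex_point; lia.
Qed.

Lemma edist_hex_emb w x : Defs.edist (hex_emb w) (hex_emb x) = Num.sqrt (hex_norm w x)%:~R.
Proof.
rewrite /Defs.edist; congr Num.sqrt; rewrite /hex_norm /hex_emb /hex_point /=.
have s3 := @sqr_sqrtr R 3 (ler0n _ 3).
case: w x => [[a b] c] [[a' b'] c'] /=.
rewrite !(rmorphD, rmorphB, rmorphN, rmorphM, rmorphXn) /= -!pmulrn.
move: s3; move: (Num.sqrt 3) (a%:~R) (b%:~R) (a'%:~R) (b'%:~R) (c%:R) (c'%:R) => s A B A' B' C C' s3.
rewrite (_ : s * B + _ - _ = s * ((B - A) / 2 - (B' - A') / 2)); last by field.
by rewrite exprMn s3; field.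
Qed.

Lemma hex_norm_ge w x : x <> w -> 1 <= hex_norm w x.
Proof.
case: w x => [[a b] c] [[a' b'] c'] xw; rewrite /hex_norm /=.
have h : a' - a <> 0 \/ b' - b <> 0 \/ c <> c'.
  have [e1|] := eqVneq (a' - a) 0; last by move/eqP; left.
  have [e2|] := eqVneq (b' - b) 0; last by move/eqP; right; left.
  right; right => e; apply: xw; rewrite e; congr (_, _, _); lia.
move: h; move: (a' - a) (b' - b) => u v h.
(* The identities $4(u^2+uv+v^2)=(2u+v)^2+3v^2=(2v+u)^2+3u^2$ supply the positive definiteness for
   [nia]. *)
have p1 : 0 <= (2 * u + v) ^+ 2 := sqr_ge0 _.
have p2 : 0 <= (2 * v + u) ^+ 2 := sqr_ge0 _.
case: c c' h {xw} => [] [] h /=; nia.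
Qed.

Lemma hex_emb_inj : injective hex_emb.
Proof.
move=> w x e; apply: contrapT => wx.
have h := edist_hex_emb x w; rewrite e in h.
have n1 := hex_norm_ge wx.
have : 0 < Num.sqrt (hex_norm x w)%:~R :> R by rewrite sqrtr_gt0 ltr0z; lia.
by rewrite -h /Defs.edist !subrr expr0n/= addr0 sqrtr0 ltxx.
Qed.

Definition dirs3 : seq (int * int) := [:: (0, 0); (1, 0); (0, 1)].
Definition dirs6 : seq (int * int) :=
  [:: (1, 0); (-1, 0); (0, 1); (0, -1); (1, -1); (-1, 1)].

Definition hex_nbs w : seq ((int * int) * bool) :=
  [seq (if w.2 then (w.1.1 - p.1, w.1.2 - p.2) else (w.1.1 + p.1, w.1.2 + p.2), ~~ w.2)
     | p <- dirs3].

Lemma mem_dirs3 (u v : int) : u ^+ 2 + u * v + v ^+ 2 - u - v = 0 -> (u, v) \in dirs3.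
Proof.
(* Four times the form is $(2u+v-1)^2+3v^2-2v-1$, so $3v^2-2v-1\le0$ and [v] is 0 or 1. *)
move=> h; have p1 : 0 <= (2 * u + v - 1) ^+ 2 := sqr_ge0 _.
have [v0|v0] : v = 0 \/ v = 1 by nia.
  have [u0|u0] : u = 0 \/ u = 1; first by subst v; nia.
    by rewrite u0 v0.
  by rewrite u0 v0.
have u0 : u = 0 by subst v; nia.
by rewrite u0 v0.
Qed.

Lemma mem_dirs6 (u v : int) : u ^+ 2 + u * v + v ^+ 2 = 1 -> (u, v) \in dirs6.
Proof.
move=> h; have p1 : 0 <= (2 * u + v) ^+ 2 := sqr_ge0 _.
have [v0|[v0|v0]] : v = 0 \/ v = 1 \/ v = -1 by nia.
- have [u0|u0] : u = 1 \/ u = -1; first by subst v; nia.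
    by rewrite u0 v0.
  by rewrite u0 v0.
- have [u0|u0] : u = 0 \/ u = -1; first by subst v; nia.
    by rewrite u0 v0.
  by rewrite u0 v0.
- have [u0|u0] : u = 0 \/ u = 1; first by subst v; nia.
    by rewrite u0 v0.
  by rewrite u0 v0.
Qed.

Lemma hex_nbsP w x : x \in hex_nbs w <-> hex_norm w x = 1.
Proof.
case: w x => [[a b] c] [[a' b'] c']; rewrite /hex_norm /=; split.
  move=> /mapP[p pd] /=; case: c => -[-> -> ->] /=;
    by move: pd; rewrite !inE => /or3P[] /eqP -> /=; lia.
case: c c' => [] [] /= h.
- exfalso; lia.
- apply/mapP; exists (a - a', b - b'); first by apply: mem_dirs3; lia.
  by rewrite /=; congr (_, _, _); lia.
- apply/mapP; exists (a' - a, b' - b); first by apply: mem_dirs3; lia.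
  by rewrite /=; congr (_, _, _); lia.
- exfalso; lia.
Qed.

Lemma hex_nbs_uniq w : uniq (hex_nbs w).
Proof.
case: w => [[a b] c]; rewrite map_inj_uniq// => -[u v] [u' v'] /=.
by case: c => -[h1 h2]; congr pair; lia.
Qed.

Lemma hex_neighbours w q :
  nearest_neighbour 3 (@hex_vertices R) (hex_emb w) q <->
  exists2 x, q = hex_emb x & x \in hex_nbs w.
Proof.
apply: (nearest_neighbourP (N := hex_norm) (d := 1)) => //.
- exact: hex_embP.
- exact: hex_emb_inj.
- exact: edist_hex_emb.
- exact: hex_nbsP.
- exact: hex_norm_ge.
- by move=> [[a b] c]; rewrite /hex_norm /=; lia.
- exact: hex_nbs_uniq.
Qed.

Definition hex_steps w : seq (unit * ((int * int) * bool)) := [seq (tt, x) | x <- hex_nbs w].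

(** The lattice is bipartite: each step flips the sublattice bit. *)
Lemma count_hex_parity k (p q : int * int) c c' : odd k (+) (c (+) c') ->
  count_walks (L := unit) hex_steps k (p, c) (q, c') = 0%N.
Proof.
elim: k p c => [|k IH] p c /=; first by rewrite xpair_eqE; case: c c' => [] []; rewrite ?andbF.
move=> h; rewrite big_map big1_seq// => x /andP[_ xn].
case/mapP: xn => r _ -> /=; apply: IH.
by move: h; case: (odd k) c c' => [] [] [].
Qed.

Lemma count_hexS k t w : count_walks (L := unit) hex_steps k.+1 (t, false) w =
  stepA (fun t' => count_walks (L := unit) hex_steps k (t', true) w) t /\
  count_walks (L := unit) hex_steps k.+1 (t, true) w =
  stepB (fun t' => count_walks (L := unit) hex_steps k (t', false) w) t.
Proof.
case: t => a b; split; rewrite [LHS]/=.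
  rewrite (_ : hex_steps _ = [:: (tt, (a + 0, b + 0, true)); (tt, (a + 1, b + 0, true));
    (tt, (a + 0, b + 1, true))])// !big_cons big_nil !addr0 addn0 addnA.
  by [].
rewrite (_ : hex_steps _ = [:: (tt, (a - 0, b - 0, false)); (tt, (a - 1, b - 0, false));
  (tt, (a - 0, b - 1, false))])// !big_cons big_nil !subr0 addn0 addnA.
by [].
Qed.

Lemma count_hex k (p q : int * int) :
  count_walks (L := unit) hex_steps k.*2 (p, false) (q, false) =
    iter k (stepA \o stepB) (fun t => (t == q) : nat) p /\
  count_walks (L := unit) hex_steps k.*2 (p, true) (q, true) =
    iter k (stepB \o stepA) (fun t => (t == q) : nat) p.
Proof.
elim: k p => [|k IH] p.
  by rewrite /= !xpair_eqE !andbT.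
rewrite doubleS (count_hexS _ p _).1 (count_hexS _ p _).2 !iterS; split; rewrite [RHS]/=; [congr (stepA _ p)|congr (stepB _ p)]; apply/funext => t.
  rewrite (count_hexS _ t _).2; congr (stepB _ t); apply/funext => t'; exact: (IH t').1.
rewrite (count_hexS _ t _).1; congr (stepA _ t); apply/funext => t'; exact: (IH t').2.
Qed.

Lemma hexagonal_closed_walks v n : hex_vertices v ->
  num_closed_walks (hexagonal R) v n = if odd n then 0%N else walknum n./2.
Proof.
move=> /hex_embP[w ->].
rewrite (num_closed_walksE (G := hexagonal R) (nb := hex_steps)).
- case: w => p c; case: ifP => on; first by rewrite count_hex_parity// on addbb.
  rewrite -{1}[n]odd_double_half on add0n.
  have e : stepB \o stepA = stepA \o stepB by apply/funext => f; apply/funext => q; rewrite /= stepAB.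
  by have [h1 h2] := count_hex n./2 p p; case: c; rewrite ?h1 ?h2 ?e iter_step_walknum.
- exact: hex_emb_inj.
- by move=> w'; rewrite map_inj_uniq ?hex_nbs_uniq// => x y [].
- move=> w' [] q /=; rewrite hex_neighbours.
  by split=> -[x -> xn]; exists x; [by []|exact: map_f|by []|case/mapP: xn => y yn [->]].
Qed.

Definition tri_emb t : R * R := hex_emb (t, false).

Definition tri_nbs t : seq (int * int) := [seq (t.1 + p.1, t.2 + p.2) | p <- dirs6].

Lemma tri_embP v : tri_vertices v <-> exists t, v = tri_emb t.
Proof.
split; last by move=> [t ->]; exists t.2, (- t.1 - t.2).
move=> [x [y ->]]; exists (- x - y, x); rewrite /tri_emb /hex_emb /=.
by congr hex_point; lia.
Qed.

Lemma tri_nbsP (t x : int * int) : x \in tri_nbs t <-> hex_norm (t, false) (x, false) = 3.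
Proof.
case: t x => [a b] [a' b']; rewrite /hex_norm /=; split.
  move=> /mapP[p pd] /= [-> ->].
  by move: pd; rewrite !inE => /orP[|/orP[|/orP[|/orP[|/orP[]]]]] /eqP -> /=; lia.
move=> h; apply/mapP; exists (a' - a, b' - b); first by apply: mem_dirs6; lia.
by rewrite /=; congr pair; lia.
Qed.

Lemma tri_nbs_uniq t : uniq (tri_nbs t).
Proof.
by rewrite map_inj_uniq// => -[u v] [u' v'] /= [h1 h2]; congr pair; lia.
Qed.

Lemma tri_neighbours t q :
  nearest_neighbour 6 (@tri_vertices R) (tri_emb t) q <->
  exists2 y, q = tri_emb y & y \in tri_nbs t.
Proof.
apply: (@nearest_neighbourP R _ (@tri_vertices R) tri_emb
  (fun t t' => hex_norm (t, false) (t', false)) tri_nbs 6 3) => //.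
- exact: tri_embP.
- by move=> x y /hex_emb_inj[].
- by move=> x y; exact: edist_hex_emb.
- exact: tri_nbsP.
(* Within one sublattice the form is a multiple of 3, so being at least 1 improves to being at least
   3. *)
- move=> x y yx; have : 1 <= hex_norm (x, false) (y, false).
    by apply: hex_norm_ge => -[].
  by rewrite /hex_norm /=; lia.
- by move=> [a b]; rewrite /hex_norm /=; lia.
- exact: tri_nbs_uniq.
Qed.

Definition tri_steps t : seq (option 'I_3 * (int * int)) :=
  [seq (None, y) | y <- tri_nbs t] ++ [seq (Some i, t) | i <- enum 'I_3].

(** Of the nine terms of [stepA \o stepB] three are the identity, matching the loops; the other six
    are the differences of distinct elements of [dirs3], which are [dirs6]. *)
Lemma count_tri k (p q : int * int) : count_walks (L := option 'I_3) tri_steps k p q =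
  iter k (stepA \o stepB) (fun t => (t == q) : nat) p.
Proof.
elim: k p => [|k IH] p //; rewrite iterS /=.
under eq_bigr do rewrite IH.
move: (iter k _ _) => F.
have e : (\sum_(x <- [seq (Some i : option 'I_3, p) | i <- enum 'I_3]) F x.2 = 3 * F p)%N.
  by rewrite big_map (eq_bigr (fun=> F p))// big_const_seq count_predT size_enum_ord /=; lia.
rewrite /tri_steps big_cat e; case: p {e} => a b.
rewrite /tri_nbs /dirs6 !big_map !big_cons big_nil /= /stepA /stepB /= !addr0 !addrK.
move: (F (a, b)) (F (a + 1, b)) (F (a - 1, b)) (F (a, b + 1)) (F (a, b - 1))
  (F (a + 1, b - 1)) (F (a - 1, b + 1)) => f0 f1 f2 f3 f4 f5 f6; lia.
Qed.

Lemma triangular_closed_walks v n : tri_vertices v ->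
  num_closed_walks (triangular_loops R) v n = walknum n.
Proof.
move=> /tri_embP[t ->].
rewrite (num_closed_walksE (G := triangular_loops R) (nb := tri_steps)).
- by rewrite count_tri iter_step_walknum.
- by move=> x y /hex_emb_inj[].
- move=> x; rewrite cat_uniq; apply/and3P; split.
  + by rewrite map_inj_uniq ?tri_nbs_uniq// => i j [].
  + by apply/hasPn => y /mapP[i _ ->]; apply/negP => /mapP[].
  + by rewrite map_inj_uniq ?enum_uniq// => i j [].
- move=> x [i|] q /=.
    split; first by move=> [_ ->]; exists x => //; rewrite mem_cat; apply/orP; right; apply/mapP; exists i; rewrite ?mem_enum.
    move=> [y -> ]; rewrite mem_cat => /orP[/mapP[]//|/mapP[j _ [_ ->]]].
    by split => //; apply/tri_embP; exists x.
  rewrite tri_neighbours; split=> -[y -> yn]; exists y => //.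
    by rewrite mem_cat; apply/orP; left; apply/mapP; exists y.
  by move: yn; rewrite mem_cat => /orP[/mapP[z zn [->]]//|/mapP[]].
Qed.

End LatticeWalks.

(** * Spectral densities *)

Section SpectralDensities.
Context {R : realType}.
Local Notation mu := (@lebesgue_measure R).
Let mT : measurable ([set: R] : set (measurableTypeR R)) := measurableT.

Lemma ae_except (S : seq R) (P : R -> Prop) : (forall x, x \notin S -> P x) ->
  {ae mu, forall x, P x}.
Proof.
elim: S P => [|a S IH] P h; first by apply: aeW => x; exact: h.
have ha : {ae mu, forall x : R, x != a}.
  exists [set a]; split; [exact: measurable_set1|exact: lebesgue_measure_set1|].
  by move=> x /= /negP; rewrite negbK => /eqP.
have hS : {ae mu, forall x : R, x != a -> P x}.
  by apply: IH => x xS xa; apply: h; rewrite inE negb_or xa.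
apply: negligibleS (negligibleU ha hS) => x /= nP; have [xa|xa] := eqVneq x a.
  by left; apply/negP; rewrite negbK.
by right => hx; apply: nP; exact: hx.
Qed.

Lemma spectral_has_density (G : multigraph (R * R)%type) (p : R * R)
    (rho : probability (measurableTypeR R) R) (f : R -> R) (b : R) :
  (forall x, 0 <= f x) -> mu.-integrable setT (EFin \o f) ->
  (forall x, b < `|x| -> f x = 0) ->
  (forall k, has_int setT (fun x => f x * x ^+ k) (num_closed_walks G p k)%:R) ->
  spectral_density G p rho -> rho `<< mu /\ has_density rho f.
Proof.
move=> f0 fi fb fm [[K Kc rhoK] mom].
have [M [_ hM]] := compact_bounded Kc.
(* One interval must contain both the compact set carrying [rho] and the support of [f];
   [compact_bounded] provides a bound by every number above [M], hence [|M| + 1]. *)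
pose L := Num.max (`|M| + 1) b.
have KL x : K x -> `|x| <= L.
  move=> Kx; rewrite /L le_max; apply/orP; left.
  by apply: hM => //; rewrite (le_lt_trans (ler_norm M))// ltrDl.
have mK : measurable (~` K : set (measurableTypeR R)).
  by apply: measurableC; apply: closed_measurable; apply: compact_closed => //; exact: Rhausdorff.
have rhoL : rho (~` [set` `[- L, L]]) = 0%E.
  apply/eqP; rewrite -measure_le0 -rhoK le_measure ?inE//.
    by apply: measurableC; exact: measurable_itv.
  by apply: subsetC => x Kx; rewrite /= in_itv/= -ler_norml KL.
have dens A : measurable A -> rho A = (\int[mu]_(x in A) (f x)%:E)%E.
  apply: (@moments_density R rho f L) => //.
  - by move=> x Lx; apply: fb; apply: le_lt_trans Lx; rewrite le_max lexx orbT.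
  - by move=> n; rewrite mom (has_intE mT (fm n)).
have mf : measurable_fun setT f by move/measurable_int : fi => /measurable_EFinP.
split; last by split.
apply/null_content_dominatesP => A mA A0; rewrite dens//.
by apply: null_set_integral => //; apply/measurable_EFinP; exact: measurable_funTS.
Qed.

Lemma hyp2F1E (z : R) : hyp2F1 (1 / 3) (2 / 3) 1 z = hypG z.
Proof. by []. Qed.

(** At 0 and 9 the closed formula is positive while [hypf] is 0, and at 1 the hypergeometric
    argument is 1, where the series diverges. *)
Lemma hypf_tri_density (x : R) : x \notin [:: 0; 1; 9] -> hypf kap x = tri_density x.
Proof.
rewrite !inE !negb_or => /and3P[x0 x1 x9]; rewrite /tri_density hyp2F1E.
case: ifP => [/andP[h0 h9]|h].
  rewrite hypf_in.
    rewrite /hypF /kap; congr (_ * _).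
    have x3 : 3 + x != 0 by rewrite gt_eqF// ltr_wpDr.
    by move: (@pi_gt0 R); move: (pi : R) => p p0; field; rewrite x3 gt_eqF.
  have [xl|xl] := ltP x 1; [left|right]; rewrite /= in_itv/=.
    by rewrite lt_neqAle eq_sym x0 h0.
  by rewrite lt_neqAle eq_sym x1 xl/= lt_neqAle x9.
by rewrite hypf_out// => /hypD_le; rewrite h.
Qed.

Lemma hexf_hex_density (x : R) : x \notin [:: 0; 1; -1; 3; -3] -> hexf kap x = hex_density x.
Proof.
rewrite !inE !negb_or => /and5P[x0 x1 xN1 x3 xN3].
have e : (-3 <= x <= 3) = (0 <= x ^+ 2 <= 9).
  rewrite sqr_ge0/= -ler_norml (_ : 9 = 3 ^+ 2); last by ring.
  by rewrite -[X in _ = (X <= _)](real_normK (num_real x)) ler_pXn2r ?nnegrE.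
rewrite /hexf hypf_tri_density; last first.
  have n1 : x ^+ 2 != 1 by rewrite -[1](expr1n _ 2) eqf_sqr negb_or x1.
  have n9 : x ^+ 2 != 9 by rewrite (_ : 9 = 3 ^+ 2); [rewrite eqf_sqr negb_or x3|ring].
  by rewrite !inE !negb_or sqrf_eq0 x0 n1 n9.
rewrite /tri_density /hex_density e; case: ifP => _; last by rewrite mulr0.
by rewrite mulrA; congr (_ * _); rewrite mulrA [ `|x| * _]mulrC.
Qed.

Lemma improper_hypf (r : R) : 0 < r -> r ^+ 2 != 1 -> r ^+ 2 != 9 ->
  improper_integral0y (fun t => t * besselJ0 (r * t) * besselJ0 t ^+ 3) (2 * hypf kap (r ^+ 2)).
Proof. by move=> r0 r1 r9; rewrite /improper_integral0y besselJ0E; exact: bessel_inversion. Qed.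

Lemma improper_integral0yZ (g : R -> R) (c l : R) : (forall x, g y @[y --> x] --> g x) ->
  improper_integral0y g l -> improper_integral0y (fun t => c * g t) (c * l).
Proof.
move=> gc gl; rewrite /improper_integral0y.
have -> : (fun r => Rintegral mu `[0, r] (fun t => c * g t)) = fun r => c * Rintegral mu `[0, r] g.
  apply/funext => r; have gi := integrable_cc 0 r gc.
  by have [_ ->] := has_intZ c (measurable_itv _) (has_int_self gi).
by apply: cvgM; [exact: cvg_cst|exact: gl].
Qed.

Lemma triangular_density (v : R * R) (rho : probability (measurableTypeR R) R) :
  tri_vertices v -> spectral_density (triangular_loops R) v rho -> has_density rho (hypf kap).
Proof.
move=> hv sp; have k0 := ltW (@kap_gt0 R).
apply: (spectral_has_density (b := 9) _ _ _ _ sp).2.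
- exact: hypf_ge0.
- exact: hypf_integrable.
- by move=> x x9; rewrite hypf_out// => /hypD_le/andP[x0 x9']; move: x9; rewrite ger0_norm// ltNge x9'.
- move=> n; rewrite triangular_closed_walks// -mu_walknum -mom_kap.
  exact: has_int_mom.
Qed.

Lemma hexagonal_density (v : R * R) (rho : probability (measurableTypeR R) R) :
  hex_vertices v -> spectral_density (hexagonal R) v rho ->
  rho `<< mu /\ has_density rho (hexf kap).
Proof.
move=> hv sp; apply: (spectral_has_density (b := 3) _ _ _ _ sp).
- exact: hexf_ge0 (@kap_gt0 R).
- have [h _] := @hexf_mom R 0; apply: eq_integrable h => // x _ /=.
  by rewrite expr0 mulr1.
- by move=> x x3; rewrite hexf_out.
- move=> n; rewrite hexagonal_closed_walks// (fun_if (fun m => m%:R)) -mu_walknum.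
  exact: hexf_mom.
Qed.

End SpectralDensities.

Theorem proposition4 (R : realType) :
  (forall (v : R * R) (rho : probability (measurableTypeR R) R),
     hex_vertices v -> spectral_density (hexagonal R) v rho ->
     rho `<< (@lebesgue_measure R) /\
     exists f : R -> R,
       [/\ has_density rho f,
           {ae (@lebesgue_measure R), forall x : R,
              exists2 I : R,
                improper_integral0y
                  (fun t => t * `|x| * besselJ0 (`|x| * t) * besselJ0 t ^+ 3) I &
                f x = 1 / 2 * I} &
           {ae (@lebesgue_measure R), forall x : R, f x = hex_density x}])
  /\
  (forall (v : R * R) (rho : probability (measurableTypeR R) R),
     tri_vertices v -> spectral_density (triangular_loops R) v rho ->
     exists f : R -> R,
       [/\ has_density rho f,
           {ae (@lebesgue_measure R), forall x : R, 0 < x ->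
              exists2 I : R,
                improper_integral0y
                  (fun t => t * besselJ0 (t * Num.sqrt x) * besselJ0 t ^+ 3) I &
                f x = 1 / 2 * I} &
           {ae (@lebesgue_measure R), forall x : R, f x = tri_density x}]).
Proof.
split=> v rho hv sp.
  have [ac dens] := hexagonal_density hv sp; split=> //; exists (hexf kap); split=> //.
    (* The inversion is applied at $r=|x|$ and requires $r>0$ and $r^2\notin\{1,9\}$. *)
    apply: (@ae_except _ [:: 0; 1; -1; 3; -3]) => x.
    rewrite !inE !negb_or => /and5P[x0 x1 xN1 x3 xN3].
    have h : improper_integral0y (fun t => t * besselJ0 (`|x| * t) * besselJ0 t ^+ 3)
        (2 * hypf kap (`|x| ^+ 2)).
      apply: improper_hypf; rewrite ?normr_gt0// real_normK ?num_real//.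
        by rewrite -[1](expr1n _ 2) eqf_sqr negb_or x1 xN1.
      by rewrite (_ : 9 = 3 ^+ 2); [rewrite eqf_sqr negb_or x3 xN3|ring].
    exists (`|x| * (2 * hypf kap (`|x| ^+ 2))).
      rewrite (_ : (fun t => _) = fun t => `|x| * (t * besselJ0 (`|x| * t) * besselJ0 t ^+ 3)).
        apply: improper_integral0yZ h => t; rewrite besselJ0E.
        apply: cvgM; last exact: der_cvg (derX 3 (der_J0 t)).
        by apply: cvgM => //; apply: cvg_arg; exact: cvg_J0.
      by apply/funext => t; ring.
    by rewrite real_normK ?num_real// /hexf; field.
  by apply: ae_except => x; exact: hexf_hex_density.
exists (hypf kap); split; first exact: triangular_density sp.
  apply: (@ae_except _ [:: 1; 9]) => x; rewrite !inE !negb_or => /andP[x1 x9] x0.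
  have xE := sqr_sqrtr (ltW x0).
  exists (2 * hypf kap x); last by field.
  rewrite (_ : (fun t => _) = fun t => t * besselJ0 (Num.sqrt x * t) * besselJ0 t ^+ 3).
    by rewrite -[in hypf _ x]xE; apply: improper_hypf; rewrite ?xE// sqrtr_gt0.
  by apply/funext => t; rewrite [Num.sqrt x * t]mulrC.
by apply: ae_except => x; exact: hypf_tri_density.
Qed.
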